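(* Let $Y=\{Y(t),\,t\ge 0\}$ be a real-valued Lévy process, let $\beta>0$ and $\omega>0$, and let $(\bar Y(T_\zeta),G(T_\zeta))$ (for $\zeta\in\{\beta,\beta+\omega\}$) and $(\bar S_{N_{\beta,\omega}},G_{N_{\beta,\omega}})$ be the random pairs described in the context. Then $$(\bar Y(T_\beta),\,G(T_\beta))\;\sim\;(\bar Y(T_{\beta+\omega}),\,G(T_{\beta+\omega}))+(\bar S_{N_{\beta,\omega}},\,G_{N_{\beta,\omega}}),$$ where the two pairs on the right-hand side are independent.
   Context: The symbol $\sim$ denotes equality in distribution. A statement of the form ''$A\sim B+C$ with $B$ and $C$ independent'' means that $A$ is distributed as the sum of independent random vectors having the laws of $B$ and $C$. For $\zeta>0$, $T_\zeta$ is an exponentially distributed random variable with rate $\zeta$ (mean $1/\zeta$), independent of $Y$. The Lévy process starts at $Y(0)=0$ and has càdlàg paths. Its running maximum is $\bar Y(t):=\sup_{s\in[0,t]}Y(s)$, and $G(t)$ is the last epoch in $[0,t]$ at which the maximum $\bar Y(t)$ is attained, i.e. $G(t)=\sup\{s\in[0,t]: Y(s)=\bar Y(t)\text{ or }Y(s-)=\bar Y(t)\}$ (with $Y(0-):=Y(0)$). Inspection: let $0=I_0<I_1<I_2<\cdots$, where $I_1,I_2,\ldots$ are the epochs of a Poisson process of rate $\omega$, and let $T_\beta$ be an exponential time with rate $\beta$, where $Y$, the Poisson process and $T_\beta$ are independent. Let $N_{\beta,\omega}$ be the number of Poisson inspection epochs before $T_\beta$; thus $\mathbb{P}(N_{\beta,\omega}=n)=(1-q)^nq$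 for $n=0,1,2,\ldots$, with $q=\beta/(\beta+\omega)$. Put $S_0:=0$, $S_n:=\sum_{m=1}^n H_m$ with $H_m:=Y(I_m)-Y(I_{m-1})$, and $\bar S_n:=\max\{S_0,S_1,\ldots,S_n\}$. So $\bar S_{N_{\beta,\omega}}$ is the running maximum of $Y$ until $T_\beta$ when $Y$ is only observed at time $0$ and at the inspection epochs. $G_{N_{\beta,\omega}}$ is the last of the epochs $I_0,I_1,\ldots,I_{N_{\beta,\omega}}$ at which this maximum occurs, i.e. $G_{N_{\beta,\omega}}=I_K$ with $K=\max\{k\in\{0,\ldots,N_{\beta,\omega}\}:S_k=\bar S_{N_{\beta,\omega}}\}$. *)

(* Defs.v *)
From HB Require Import structures.
From mathcomp Require Import all_boot all_order all_algebra finmap.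
From mathcomp Require Import all_classical all_reals all_analysis.

Set Implicit Arguments.
Unset Strict Implicit.
Unset Printing Implicit Defensive.
Import Order.TTheory GRing.Theory Num.Theory.
Import numFieldTopology.Exports numFieldNormedType.Exports.
Local Open Scope classical_set_scope.
Local Open Scope ring_scope.

Section laws.
Context {R : realType}.

(* Measurability is part of the relation, so that asserting it about maps
   defined pathwise includes the claim that they are random variables. *)
Definition eq_law d1 d2 d' (T1 : measurableType d1) (T2 : measurableType d2)
    (E : measurableType d') (P1 : probability T1 R) (X1 : T1 -> E)
    (P2 : probability T2 R) (X2 : T2 -> E) : Prop :=
  [/\ measurable_fun setT X1, measurable_fun setT X2 &
      forall A : set E, measurable A -> P1 (X1 @^-1` A) = P2 (X2 @^-1` A)].

Definition exponential_rv d (T : measurableType d) (P : probability T R)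
    (rate : R) (X : T -> R) : Prop :=
  measurable_fun setT X /\
  forall A : set R, measurable A -> P (X @^-1` A) = exponential_prob rate A.

End laws.

Section independence.
Context {R : realType} {d : measure_display} {T : measurableType d}.
Variable P : probability T R.

Definition independent_systems (J : choiceType) (F : J -> set (set T)) : Prop :=
  forall (K : {fset J}) (A : J -> set T),
    (forall j, j \in K -> F j (A j)) ->
    P (\bigcap_(j in [set` K]) A j) = (\prod_(j <- K) fine (P (A j)))%:E.

Definition independent_list (s : seq (set (set T))) : Prop :=
  independent_systems (fun i : 'I_(size s) => nth set0 s i).

Definition sigma_rv d' (E : measurableType d') (X : T -> E) : set (set T) :=
  g_sigma_algebra_preimage X.

Definition sigma_process (J : Type) (D : set J) d' (E : measurableType d')
    (X : J -> T -> E) : set (set T) :=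
  <<s \bigcup_(j in D) sigma_rv (X j) >>.

End independence.

(* A ~ B + C with B and C independent: the summands are independent copies,
   possibly living on another probability space. *)
Definition eq_law_indep_sum {R : realType} d (T : measurableType d)
    (P : probability T R) (A B C : T -> R * R) : Prop :=
  exists (d' : measure_display) (T' : measurableType d')
    (Q : probability T' R) (B' C' : T' -> R * R),
    [/\ eq_law Q B' P B, eq_law Q C' P C,
        independent_list Q [:: sigma_rv B'; sigma_rv C'] &
        eq_law P A Q (fun w => B' w + C' w)].

(* Time ranges over R, but only times t >= 0 are ever constrained or used. *)
Section paths.
Context {R : realType}.
Implicit Types (y : R -> R) (t s : R).

Definition cadlag y : Prop :=
  (forall t, 0 <= t -> y x @[x --> t^'+] --> y t) /\
  (forall t, 0 < t -> cvg (y x @[x --> t^'-])).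

(* y(s-), with the convention y(0-) = y(0) *)
Definition left_limit y s : R :=
  if s <= 0 then y 0 else lim (y x @[x --> s^'-]).

Definition running_max y t : R := sup [set y s | s in `[0, t]].

Definition last_max_epoch y t : R :=
  sup [set s | s \in `[0, t] /\
    (y s = running_max y t \/ left_limit y s = running_max y t)].

End paths.

Section processes.
Context {R : realType} {d : measure_display} {T : measurableType d}.
Variable P : probability T R.

Record levy_process (Y : R -> T -> R) : Prop := LevyProcess {
  levy_measurable : forall t, 0 <= t -> measurable_fun setT (Y t) ;
  levy_start : forall w, Y 0 w = 0 ;
  levy_cadlag : forall w, cadlag (Y^~ w) ;
  levy_indep : forall (n : nat) (t : nat -> R),
    0 <= t 0%N -> (forall k, (k < n)%N -> t k <= t k.+1) ->
    independent_systems P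
      (fun k : 'I_n => sigma_rv (fun w => Y (t k.+1) w - Y (t k) w)) ;
  levy_stationary : forall s t, 0 <= s -> 0 <= t ->
    eq_law P (fun w => Y (s + t) w - Y s w) P (Y t) }.

(* I_0 = 0 < I_1 < I_2 < ..., the epochs I_1, I_2, ... being those of a
   Poisson process: the interarrival times are i.i.d. exponential. *)
Record poisson_epochs (rate : R) (I : nat -> T -> R) : Prop := PoissonEpochs {
  epochs_start : forall w, I 0%N w = 0 ;
  epochs_incr : forall n w, I n w < I n.+1 w ;
  epochs_exp : forall n, exponential_rv P rate (fun w => I n.+1 w - I n w) ;
  epochs_indep :
    independent_systems P (fun n => sigma_rv (fun w => I n.+1 w - I n w)) }.

End processes.

Section inspection.
Context {R : realType}.
Variables (y : R -> R) (i : nat -> R).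

(* fset_set sends an infinite set to the empty one, so the count is 0 on the
   null event that infinitely many epochs precede t. *)
Definition num_epochs (t : R) : nat :=
  #|` fset_set [set n : nat | (0 < n)%N /\ i n < t] |.

Definition observed_increment (m : nat) : R := y (i m) - y (i m.-1).

Definition observed (n : nat) : R := \sum_(1 <= m < n.+1) observed_increment m.

Definition observed_max (n : nat) : R :=
  \big[Num.max/observed 0]_(k < n.+1) observed k.

Definition last_observed_max_epoch (n : nat) : R :=
  i (\max_(k < n.+1 | observed k == observed_max n) k).

End inspection.

(* Main.v *)
Require Import Defs.
From HB Require Import structures.
From mathcomp Require Import all_boot all_order all_algebra finmap.
From mathcomp Require Import all_classical all_reals all_analysis.
From mathcomp Require Import measurable_realfun.
From mathcomp Require Import ring lra.
Set Implicit Arguments.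
Unset Strict Implicit.
Unset Printing Implicit Defensive.
Import Order.TTheory GRing.Theory Num.Theory.
Import numFieldTopology.Exports numFieldNormedType.Exports.
Local Open Scope classical_set_scope.
Local Open Scope ring_scope.

(** Write X for the pair (running maximum, last epoch of the maximum) at the
exponential time T of rate beta, C for the pair built from the inspection
epochs before T, a for the pair at an exponential time S of rate beta + omega,
and b for the pair (Y(S) minus the maximum up to S, S minus the epoch of that
maximum). Put q = beta / (beta + omega) and p = omega / (beta + omega), and
let K keep a pair whose first entry is nonnegative and replace any other pair
by 0. The claim follows from three facts.

- The increment (Y(S), S) is a + b, and a and b are independent: this is the
  Wiener-Hopf factorisation ([wiener_hopf]).

- Run T against an independent exponential time of rate omega. Their minimum
  is exponential of rate beta + omega; with probability q it is T, and
  otherwise T exceeds it by a fresh copy of T. The maximum over two consecutive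
  intervals is the earlier one, raised by the later one when the latter is at
  least as high ([max_pair_add]). By the Markov property and the independence
  of a and b, X satisfies in law X = a with probability q, and
  X = a + K (b + X') with probability p, for X' a copy of X and a, b, X'
  independent ([max_pair_renewal]).

- The same competition, now between T and the first inspection epoch, gives
  in law C = 0 with probability q, and C = K (a + b + C') with probability p:
  the first inspected increment is a + b, and what follows it is a copy C' of C
  ([inspected_renewal]).

Substituting the last equation in a + C, with a and C independent, shows that
a + C solves the equation of X. The solution is unique, because iterating the
equation n times leaves only an event of probability p ^ n undetermined
([renewal_unique]). Hence X has the law of a + C.

For the Wiener-Hopf factorisation, the path is sampled with step h along the
walk k |-> Y(kh), stopped at the integer part of S / h, a geometric time. A
discrete path attains its last maximum at k exactly when k is the last argmax
of its first k steps and 0 is the last argmax of the steps after k. The Markov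
property at the deterministic time kh and the lack of memory of S turn
E [f(max) g(gap)] into a product of a functional of f and a functional of g
([discrete_wiener_hopf_factor]), which is independence. Letting h tend to 0
recovers the maximum but not its last epoch, since an earlier near-maximum of
the samples may win; so the walk is first tilted by a slope eps > 0, which
favours late epochs, and eps tends to 0 after h ([walk_max_near]). The limit
is taken along this iterated filter by bounded convergence, using that
independence is decided by bounded continuous functions. A description of the
last epoch of the maximum without left limits ([max_epoch]) keeps the
deterministic part of the argument elementary.

Laws are handled throughout as integrals: averaging over independent copies
is iterated integration over sample points of the given probability space. *)

(** * Transfer of integrals and independence between laws *)

Section transfer.
Local Open Scope ereal_scope.
Context {R : realType}.

Lemma eq_law_integral d1 d2 d' (T1 : measurableType d1) (T2 : measurableType d2)
    (E : measurableType d') (P1 : probability T1 R) (X1 : T1 -> E)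
    (P2 : probability T2 R) (X2 : T2 -> E) (f : E -> \bar R) :
  eq_law P1 X1 P2 X2 -> measurable_fun setT f -> (forall x, 0 <= f x) ->
  \int[P1]_w f (X1 w) = \int[P2]_w f (X2 w).
Proof.
move=> [m1 m2 e12] mf f0.
transitivity (\int[pushforward P1 X1]_x f x).
  by rewrite ge0_integral_pushforward.
transitivity (\int[pushforward P2 X2]_x f x).
  by apply: eq_measure_integral => A mA _; exact: e12.
by rewrite ge0_integral_pushforward.
Qed.

Lemma preimage_measurable d d1 (T : measurableType d) (E1 : measurableType d1)
    (X : T -> E1) A :
  measurable_fun setT X -> measurable A -> measurable (X @^-1` A).
Proof. by move=> mX mA; rewrite -[X in measurable X]setTI; exact: mX. Qed.

Context d (T : measurableType d) (P : probability T R).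

Lemma integral_le1 (f : T -> \bar R) : measurable_fun setT f ->
  (forall w, 0 <= f w <= 1) -> 0 <= \int[P]_w f w <= 1.
Proof.
move=> mf f01; have f0 w : 0 <= f w by have /andP[] := f01 w.
rewrite integral_ge0//=; apply: (@le_trans _ _ (\int[P]_w (cst 1 w))).
  by apply: ge0_le_integral => // w _; have /andP[] := f01 w.
by rewrite integral_cst//= mul1e probability_setT.
Qed.

Lemma integral_fin_num01 (f : T -> R) : measurable_fun setT f ->
  (forall w, (0 <= f w <= 1)%R) -> \int[P]_w (f w)%:E \is a fin_num.
Proof.
move=> mf f01; have := @integral_le1 (EFin \o f) _ f01.
rewrite /comp => /(_ _)/andP[|i0 i1]; first exact/measurable_EFinP.
by rewrite ge0_fin_numE// (le_lt_trans i1)// ltry.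
Qed.

Definition indep_rv d1 d2 (E1 : measurableType d1) (E2 : measurableType d2)
    (X : T -> E1) (Z : T -> E2) : Prop :=
  forall A B, measurable A -> measurable B ->
    P (X @^-1` A `&` Z @^-1` B) = P (X @^-1` A) * P (Z @^-1` B).

Lemma indep_rv_sym d1 d2 (E1 : measurableType d1) (E2 : measurableType d2)
    (X : T -> E1) (Z : T -> E2) : indep_rv X Z -> indep_rv Z X.
Proof. by move=> i A B mA mB; rewrite setIC i// muleC. Qed.

Lemma indep_rv_comp d1 d2 d3 d4 (E1 : measurableType d1) (E2 : measurableType d2)
    (E3 : measurableType d3) (E4 : measurableType d4) (X : T -> E1) (Z : T -> E2)
    (f : E1 -> E3) (g : E2 -> E4) :
  measurable_fun setT f -> measurable_fun setT g ->
  indep_rv X Z -> indep_rv (fun w => f (X w)) (fun w => g (Z w)).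
Proof.
move=> mf mg i A B mA mB; have := i (f @^-1` A) (g @^-1` B).
by apply; exact: preimage_measurable.
Qed.

(** Independence means that the joint law is the product of the marginal
laws, so that Fubini applies; both copies are sampled from the same space. *)
Lemma indep_integral d1 d2 (E1 : measurableType d1) (E2 : measurableType d2)
    (X : T -> E1) (Z : T -> E2) (f : E1 * E2 -> \bar R) :
  measurable_fun setT X -> measurable_fun setT Z -> indep_rv X Z ->
  measurable_fun setT f -> (forall x, 0 <= f x) ->
  \int[P]_w f (X w, Z w) = \int[P]_w \int[P]_v f (X w, Z v).
Proof.
move=> mX mZ iXZ mf f0.
pose XX := mfun_Sub (mem_set mX); pose ZZ := mfun_Sub (mem_set mZ).
have mXZ : measurable_fun setT (fun w => (X w, Z w)).
  exact: measurable_fun_pair.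
pose XZ := mfun_Sub (mem_set mXZ).
transitivity (\int[pushforward P XZ]_x f x).
  by rewrite ge0_integral_pushforward.
transitivity (\int[distribution P XX \x distribution P ZZ]_x f x).
  apply: eq_measure_integral => A mA _; apply/esym.
  apply: (@product_measure_unique _ _ _ _ _ (distribution P XX)
    (distribution P ZZ) (distribution P XZ)) => //.
rewrite fubini_tonelli1// ge0_integral_pushforward//.
- by apply: eq_integral => w _; rewrite /fubini_F/= ge0_integral_pushforward//;
    exact: measurableT_comp.
- exact: measurable_fun_fubini_tonelli_F.
- by move=> x _; apply: integral_ge0.
Qed.

End transfer.

(** * Laws and independence checked on pi-systems *)

Section pi_systems.
Local Open Scope ereal_scope.
Context {R : realType}.

Lemma trivIset_preimage_fun (T E I : Type) (X : T -> E) (D : set I)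
    (F : I -> set E) : trivIset D F -> trivIset D (fun i => X @^-1` F i).
Proof. by move=> tF i j Di Dj [x [/= a b]]; apply: (tF i j) => //; exists (X x). Qed.

Lemma eq_law_pi_system d1 d2 d' (T1 : measurableType d1) (T2 : measurableType d2)
    (E : measurableType d') (G : set (set E)) (P1 : probability T1 R)
    (X1 : T1 -> E) (P2 : probability T2 R) (X2 : T2 -> E) :
  @measurable _ E = <<s G >> -> setI_closed G ->
  measurable_fun setT X1 -> measurable_fun setT X2 ->
  (forall A, G A -> P1 (X1 @^-1` A) = P2 (X2 @^-1` A)) -> eq_law P1 X1 P2 X2.
Proof.
move=> GE GI m1 m2 e12; split=> // A; rewrite GE.
apply: (dynkin_induction (P := fun A => P1 (X1 @^-1` A) = P2 (X2 @^-1` A)) GE GI).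
- by rewrite !preimage_setT !probability_setT.
- exact: e12.
- move=> S mS e.
  have h1 := probability_setC P1 (preimage_measurable m1 mS).
  have h2 := probability_setC P2 (preimage_measurable m2 mS).
  by apply: (etrans h1); rewrite e; exact/esym/h2.
- move=> F mF tF e; rewrite !preimage_bigcup !measure_bigcup//.
  + by apply: eq_eseriesr => n _; exact: e.
  + by move=> n _; exact: preimage_measurable.
  + exact: trivIset_preimage_fun.
  + by move=> n _; exact: preimage_measurable.
  + exact: trivIset_preimage_fun.
Qed.

(** The sets A that satisfy the product rule against a fixed event C form a
Dynkin system. Keeping C an arbitrary event lets [indep_rv_pi_system] use
the argument once in each variable. *)
Lemma indep_event_pi_system d d1 (T : measurableType d) (P : probability T R)
    (E1 : measurableType d1) (G : set (set E1)) (X : T -> E1) (C : set T) :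
  @measurable _ E1 = <<s G >> -> setI_closed G ->
  measurable_fun setT X -> measurable C ->
  (forall A, G A -> P (X @^-1` A `&` C) = P (X @^-1` A) * P C) ->
  forall A, measurable A -> P (X @^-1` A `&` C) = P (X @^-1` A) * P C.
Proof.
move=> GE GI mX mZB iXZ A mA.
have mXS S : measurable S -> measurable (X @^-1` S).
  by exact: preimage_measurable.
move: A mA; rewrite GE.
apply: (dynkin_induction (P := fun A => P (X @^-1` A `&` C) =
  P (X @^-1` A) * P (C)) GE GI).
- by rewrite !preimage_setT setTI probability_setT mul1e.
- by move=> A GA; exact: iXZ.
- move=> S mS e.
  have -> : X @^-1` (~` S) `&` C = C `\` X @^-1` S.
    by rewrite setIC setDE.
  rewrite measureD//; [|exact: mXS|]; last first.
    by rewrite (le_lt_trans (probability_le1 _ _)) ?ltry.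
  have h := probability_setC P (mXS _ mS).
  rewrite (_ : P (X @^-1` (~` S)) = 1 - P (X @^-1` S)); last exact: h.
  rewrite setIC [X in _ - X = _](e : _ = _).
  rewrite -[X in X - _](mul1e (P (C))) -muleBl ?fin_num_measure//.
- move=> F mF tF e; rewrite preimage_bigcup setI_bigcupl !measure_bigcup//=.
  + rewrite -(fineK (fin_num_measure P _ mZB)) muleC -nneseriesZl//.
    by apply: eq_eseriesr => n _; rewrite muleC fineK ?fin_num_measure//; exact: e.
  + by move=> n _; exact: mXS.
  + exact: trivIset_preimage_fun.
  + by move=> n _; apply: measurableI => //; exact: mXS.
  + by apply: trivIset_setIr; exact: trivIset_preimage_fun.
Qed.

Lemma indep_rv_pi_system d d1 d2 (T : measurableType d) (P : probability T R)
    (E1 : measurableType d1) (E2 : measurableType d2) (G1 : set (set E1))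
    (G2 : set (set E2)) (X : T -> E1) (Z : T -> E2) :
  @measurable _ E1 = <<s G1 >> -> setI_closed G1 ->
  @measurable _ E2 = <<s G2 >> -> setI_closed G2 ->
  measurable_fun setT X -> measurable_fun setT Z ->
  (forall A B, G1 A -> G2 B ->
    P (X @^-1` A `&` Z @^-1` B) = P (X @^-1` A) * P (Z @^-1` B)) ->
  indep_rv P X Z.
Proof.
move=> G1E G1I G2E G2I mX mZ iXZ A B mA mB.
apply: (indep_event_pi_system G1E G1I mX (preimage_measurable mZ mB)) => // A' GA'.
rewrite setIC muleC.
have mA' : measurable A' by rewrite G1E; exact: sub_sigma_algebra.
apply: (indep_event_pi_system G2E G2I mZ (preimage_measurable mX mA')) => // B' GB'.
by rewrite setIC muleC; exact: iXZ.
Qed.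

End pi_systems.

Section product_independence.
Local Open Scope ereal_scope.
Context {R : realType}.

Definition rectangles d1 d2 (E1 : measurableType d1) (E2 : measurableType d2) :
  set (set (E1 * E2)) := [set A `*` B | A in measurable & B in measurable].

Lemma setI_closed_rectangles d1 d2 (E1 : measurableType d1) (E2 : measurableType d2) :
  setI_closed (@rectangles _ _ E1 E2).
Proof.
move=> _ _ [A1 mA1 [A2 mA2 <-]] [B1 mB1 [B2 mB2 <-]].
exists (A1 `&` B1); first exact: measurableI.
by exists (A2 `&` B2); [exact: measurableI|rewrite setXI].
Qed.

Lemma measurable_rectangles d1 d2 (E1 : measurableType d1) (E2 : measurableType d2) :
  @measurable _ (E1 * E2)%type = <<s @rectangles _ _ E1 E2 >>.
Proof. exact: measurable_prod_measurableType. Qed.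

(** The product rule extends from rectangles, on which both hypotheses
give the same triple product. *)
Lemma indep_rv_assoc d d1 d2 d3 (T : measurableType d) (P : probability T R)
    (E1 : measurableType d1) (E2 : measurableType d2) (E3 : measurableType d3)
    (X : T -> E1) (Y : T -> E2) (W : T -> E3) :
  measurable_fun setT X -> measurable_fun setT Y -> measurable_fun setT W ->
  indep_rv P X Y -> indep_rv P (fun w => (X w, Y w)) W ->
  indep_rv P X (fun w => (Y w, W w)).
Proof.
move=> mX mY mW iXY iXYW.
have iYW : indep_rv P Y W := indep_rv_comp measurable_snd (@measurable_id _ E3 setT) iXYW.
have mYW : measurable_fun setT (fun w => (Y w, W w)) by exact: measurable_fun_pair.
apply: indep_rv_sym.
move=> A B mA mB; move: A mA.
apply: (indep_event_pi_system (@measurable_rectangles _ _ E2 E3)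
  (@setI_closed_rectangles _ _ E2 E3) mYW (preimage_measurable mX mB)).
move=> _ [A1 mA1 [A2 mA2 <-]].
have e1 : (fun w => (Y w, W w)) @^-1` (A1 `*` A2) = Y @^-1` A1 `&` W @^-1` A2 by [].
have e2 : Y @^-1` A1 `&` W @^-1` A2 `&` X @^-1` B =
    (fun w => (X w, Y w)) @^-1` (B `*` A1) `&` W @^-1` A2.
  by apply/seteqP; split => w /= [[? ?] ?].
rewrite e1 e2 iXYW//; last exact: measurableX.
have e3 : (fun w => (X w, Y w)) @^-1` (B `*` A1) = X @^-1` B `&` Y @^-1` A1 by [].
by rewrite e3 iXY// iYW// -muleA muleC.
Qed.

Lemma eq_law_pair d d1 d2 (T : measurableType d) (P : probability T R)
    (E1 : measurableType d1) (E2 : measurableType d2)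
    (X X' : T -> E1) (Y Y' : T -> E2) :
  eq_law P X P X' -> eq_law P Y P Y' -> indep_rv P X Y -> indep_rv P X' Y' ->
  eq_law P (fun w => (X w, Y w)) P (fun w => (X' w, Y' w)).
Proof.
move=> [mX mX' eX] [mY mY' eY] i i'.
apply: (eq_law_pi_system (@measurable_rectangles _ _ E1 E2)
  (@setI_closed_rectangles _ _ E1 E2)); [exact: measurable_fun_pair..|].
move=> _ [A mA [B mB <-]].
by have := i A B mA mB; rewrite eX// eY// -i'.
Qed.

End product_independence.

(** * Exponential random times *)

Lemma measurable_natr_bool {R : realType} d (T : measurableType d) (g : T -> bool) :
  measurable_fun setT g -> measurable_fun setT (fun x => ((g x)%:R : R)%:E).
Proof.
move=> mg; apply/measurable_EFinP.
exact: (measurableT_comp (f := fun b : bool => b%:R : R)).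
Qed.

Section lebesgue_translation.
Local Open Scope ereal_scope.
Context {R : realType}.
Local Notation mu := (@lebesgue_measure R).

Lemma lebesgue_measure_translation (s : R) (A : set R) : measurable A ->
  pushforward mu (+%R s : _ -> measurableTypeR R) A = mu A.
Proof.
move=> mA; apply/esym/lebesgue_measure_unique => //=; first exact: measurable_funD.
move=> ? _ [[a b]] _ <-.
rewrite /= /pushforward (_ : _ @^-1` _ = `](a - s)%R, (b - s)%R]%classic).
  rewrite !lebesgue_measure_itv/= !lte_fin ltrD2r; case: ifPn => // _.
  by rewrite -!EFinD; congr EFin; lra.
by apply/seteqP; split=> x /=; rewrite !in_itv/= => /andP[? ?]; apply/andP; split; lra.
Qed.

Lemma lebesgue_integral_translation (s : R) (f : R -> \bar R) :
  measurable_fun [set: R] f -> (forall t, 0 <= f t) ->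
  \int[mu]_t f t = \int[mu]_t f (s + t)%R.
Proof.
move=> mf f0.
transitivity (\int[pushforward mu (+%R s : _ -> measurableTypeR R)]_t f t).
  apply: eq_measure_integral => //=; first exact: measurable_funD.
  by move=> ? A mA _; rewrite lebesgue_measure_translation.
by rewrite ge0_integral_pushforward//=; exact: measurable_funD.
Qed.

End lebesgue_translation.

Section exponential.
Local Open Scope ereal_scope.
Context {R : realType} d (T : measurableType d) (P : probability T R).
Local Notation mu := (@lebesgue_measure R).
Implicit Types (f : R -> \bar R) (X : T -> R).

Import HBNNSimple.

(** The law of X has a density, so the formula holds for indicators,
hence for simple functions, and passes to monotone limits. *)
Lemma exponential_rv_integral r X f : (0 < r)%R -> exponential_rv P r X ->
  measurable_fun [set: R] f -> (forall t, 0 <= f t) ->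
  \int[P]_w f (X w) = \int[mu]_t (f t * (exponential_pdf r t)%:E).
Proof.
move=> r0 [mX lawX] mf f0.
have pdf0 t : 0 <= (exponential_pdf r t)%:E.
  by rewrite lee_fin exponential_pdf_ge0// ltW.
have mpdf : measurable_fun [set: R] (fun t => (exponential_pdf r t)%:E).
  by apply/measurable_EFinP; exact: measurable_exponential_pdf.
pose f_ := nnsfun_approx measurableT mf.
have cvgf t : (f_ n t)%:E @[n --> \oo] --> f t.
  by apply: cvg_nnsfun_approx.
transitivity (limn (fun n => \int[P]_w (f_ n (X w))%:E)).
  rewrite -monotone_convergence//=.
  - by apply: eq_integral => w _; apply/esym/cvg_lim => //; exact: cvgf.
  - by move=> n; apply/measurable_EFinP; exact: measurableT_comp.
  - by move=> n w _; rewrite lee_fin.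
  - by move=> w _ m n mn; rewrite lee_fin; exact/lefP/nd_nnsfun_approx.
transitivity (limn (fun n => \int[mu]_t ((f_ n t)%:E * (exponential_pdf r t)%:E)));
  last first.
  rewrite -monotone_convergence//=.
  - apply: eq_integral => t _; apply/cvg_lim => //.
    by apply: cvgeZr => //; exact: cvgf.
  - move=> n; apply: emeasurable_funM; last exact: mpdf.
    apply/measurable_EFinP. exact: (@measurable_funP _ _ _ _ setT (f_ n)).
  - by move=> n t _; rewrite mule_ge0// lee_fin.
  - move=> t _ m n mn; apply: lee_wpmul2r => //; rewrite lee_fin.
    by have /lefP/(_ t) := nd_nnsfun_approx measurableT mf mn.
congr (limn _); apply/funext => n.
have mXS (A : set R) : measurable A -> measurable (X @^-1` A).
  by exact: preimage_measurable.
have mfk k : measurable (f_ n @^-1` [set k]) by exact: measurable_funPTI.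
transitivity (\sum_(k \in range (f_ n)) k%:E * P (X @^-1` (f_ n @^-1` [set k]))).
  transitivity (\int[P]_w (\sum_(k \in range (f_ n))
      (k * \1_(f_ n @^-1` [set k]) (X w))%:E)).
    by apply: eq_integral => w _; rewrite fimfunE -fsumEFin.
  rewrite ge0_integral_fsum//; last 2 first.
  - move=> k; apply/measurable_EFinP/measurable_funM => //.
    exact: (measurableT_comp (measurable_indic (mfk k))).
  - by move=> k x _; rewrite nnfun_muleindic_ge0.
  apply: eq_fsbigr => k /set_mem [t _ <-].
  transitivity (\int[P]_x ((f_ n t)%:E * (\1_(X @^-1` (f_ n @^-1` [set (f_ n t)])) x)%:E)).
    by apply: eq_integral => x _; rewrite EFinM.
  have mI := mXS _ (mfk (f_ n t)).
  rewrite ge0_integralZl_EFin//; last exact/measurable_EFinP/measurable_indic.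
  by rewrite integral_indic// setIT.
have mg : forall k : R, measurable_fun [set: R] (fun x => (k * \1_(f_ n @^-1` [set k]) x)%:E).
  move=> k; apply/measurable_EFinP/measurable_funM => //.
apply/esym.
transitivity (\int[mu]_t (\sum_(k \in range (f_ n))
    ((k * \1_(f_ n @^-1` [set k]) t)%:E * (exponential_pdf r t)%:E))).
  apply: eq_integral => t _; rewrite fimfunE -fsumEFin//.
  rewrite -ge0_mule_fsuml// => k; exact: nnfun_muleindic_ge0.
rewrite ge0_integral_fsum//; last 2 first.
- by move=> k; apply: emeasurable_funM; [exact: mg|exact: mpdf].
- by move=> k t _; rewrite mule_ge0// nnfun_muleindic_ge0.
apply: eq_fsbigr => k /set_mem [t _ <-].
rewrite lawX// /exponential_prob.
rewrite -ge0_integralZl_EFin//.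
- rewrite [RHS]integral_mkcond; apply: eq_integral => u _.
  by rewrite epatch_indic /= EFinM -!muleA; congr (_ * _); rewrite muleC.
- exact: mfk.
- exact: (measurable_funS measurableT (@subsetT _ _) mpdf).
Qed.

(** The density vanishes on the negative half-line. *)
Lemma exponential_rv_integral_ge0 r X f g : (0 < r)%R -> exponential_rv P r X ->
  measurable_fun [set: R] f -> (forall t, 0 <= f t) ->
  measurable_fun [set: R] g -> (forall t, 0 <= g t) ->
  (forall t, (0 <= t)%R -> f t = g t) ->
  \int[P]_w f (X w) = \int[P]_w g (X w).
Proof.
move=> r0 eX mf f0 mg g0 fg.
rewrite (exponential_rv_integral r0 eX)// (exponential_rv_integral r0 eX)//.
apply: eq_integral => t _; have [t0|t0] := leP 0%R t; first by rewrite fg.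
by rewrite lt0_exponential_pdf// !mule0.
Qed.

(** The factor exp (- b t) turns the density of rate a into a / (a + b)
times that of rate a + b. Probabilistically, the left-hand side is the
expectation of f(X) on the event that an independent clock of rate b rings
after X. *)
Lemma exponential_rv_tilt (a b : R) X Z f : (0 < a)%R -> (0 < b)%R ->
  exponential_rv P a X -> exponential_rv P (a + b) Z ->
  measurable_fun [set: R] f -> (forall t, 0 <= f t) ->
  \int[P]_w ((expR (- b * X w))%:E * f (X w)) =
  (a / (a + b))%:E * \int[P]_w f (Z w).
Proof.
move=> a0 b0 eX eZ mf f0; have ab0 : (0 < a + b)%R by exact: addr_gt0.
have mpdf r : measurable_fun [set: R] (fun t => (exponential_pdf r t)%:E).
  by apply/measurable_EFinP; exact: measurable_exponential_pdf.
have me : measurable_fun [set: R] (fun t : R => (expR (- b * t))%:E).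
  apply/measurable_EFinP.
  exact: (measurableT_comp (@measurable_expR R) (@mulrl_measurable R setT (- b)%R)).
rewrite (exponential_rv_integral (f := fun t => (expR (- b * t))%:E * f t) a0 eX);
  last 2 first.
- exact: emeasurable_funM.
- by move=> t; rewrite mule_ge0// lee_fin expR_ge0.
rewrite (exponential_rv_integral ab0 eZ)// -ge0_integralZl_EFin//; last 3 first.
- by move=> t _; rewrite mule_ge0// lee_fin exponential_pdf_ge0// ltW.
- exact: (emeasurable_funM mf (mpdf _)).
- by rewrite divr_ge0// ltW.
apply: eq_integral => t _; rewrite [RHS]muleCA [in LHS](muleC _ (f t)) -muleA.
congr (_ * _); rewrite -!EFinM; congr EFin.
have [t0|t0] := leP 0%R t; last by rewrite !lt0_exponential_pdf// !mulr0.
rewrite !exponential_pdfE//.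
have -> : expR (- (a + b) * t) = (expR (- b * t) * expR (- a * t))%R.
  by rewrite -expRD; congr expR; ring.
by field; rewrite gt_eqF.
Qed.

(** On [s, oo) the density of rate r is exp (- r s) times its translate. *)
Lemma exponential_rv_memoryless (r s : R) X f : (0 < r)%R -> (0 <= s)%R ->
  exponential_rv P r X -> measurable_fun [set: R] f -> (forall t, 0 <= f t) ->
  \int[P]_w (((s <= X w)%R%:R)%:E * f (X w)) =
  (expR (- r * s))%:E * \int[P]_w f (s + X w)%R.
Proof.
move=> r0 s0 eX mf f0.
have mpdf : measurable_fun [set: R] (fun t => (exponential_pdf r t)%:E).
  by apply/measurable_EFinP; exact: measurable_exponential_pdf.
have ms : measurable_fun [set: R] (fun t : R => ((s <= t)%R%:R : R)%:E).
  by apply: measurable_natr_bool; apply: measurable_fun_ler => //; exact: measurable_cst.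
have msf : measurable_fun [set: R] (fun t : R => ((s <= t)%R%:R : R)%:E * f t).
  exact: emeasurable_funM.
have mfs : measurable_fun [set: R] (fun t : R => f (s + t)%R).
  by apply: (measurableT_comp mf); exact: measurable_funD.
rewrite (exponential_rv_integral (f := fun t => ((s <= t)%R%:R : R)%:E * f t) r0 eX);
  [|exact: msf|by move=> t; rewrite mule_ge0// lee_fin].
rewrite (exponential_rv_integral (f := fun t => f (s + t)%R) r0 eX)//.
have pdf0 t : 0 <= (exponential_pdf r t)%:E.
  by rewrite lee_fin exponential_pdf_ge0// ltW.
rewrite (lebesgue_integral_translation s); last 2 first.
- exact: (emeasurable_funM msf mpdf).
- by move=> t; rewrite !mule_ge0// lee_fin.
rewrite -ge0_integralZl_EFin//; last 2 first.
- by move=> t _; rewrite mule_ge0.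
- exact: (emeasurable_funM mfs mpdf).
apply: eq_integral => t _; rewrite [RHS]muleCA [in LHS](muleC _ (f _)) -muleA.
congr (_ * _); rewrite -!EFinM; congr EFin; rewrite lerDl.
have [t0|t0] := leP 0%R t; last by rewrite (lt0_exponential_pdf _ t0) mulr0 mul0r.
rewrite mul1r !exponential_pdfE ?addr_ge0//.
have -> : expR (- r * (s + t)) = (expR (- r * s) * expR (- r * t))%R.
  by rewrite -expRD; congr expR; ring.
by ring.
Qed.

Lemma exponential_rv_ge r s X : (0 < r)%R -> (0 <= s)%R -> exponential_rv P r X ->
  \int[P]_w ((s <= X w)%R%:R)%:E = (expR (- r * s))%:E.
Proof.
move=> r0 s0 eX; have := exponential_rv_memoryless (f := cst 1) r0 s0 eX
  (measurable_cst _) (fun=> lee01).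
rewrite (_ : \int[P]_w cst 1 _ = 1); last by rewrite integral_cst//= mul1e probability_setT.
by rewrite mule1 => <-; apply: eq_integral => w _; rewrite mule1.
Qed.

(** Compared with [exponential_rv_ge], only the null event that X equals s is
removed. *)
Lemma exponential_rv_gt r s X : (0 < r)%R -> (0 <= s)%R -> exponential_rv P r X ->
  \int[P]_w ((s < X w)%R%:R)%:E = (expR (- r * s))%:E.
Proof.
move=> r0 s0 eX; rewrite -(exponential_rv_ge r0 s0 eX).
have [mX lawX] := eX.
have prob (i : interval R) : \int[P]_w ((X w \in i)%:R)%:E = exponential_prob r [set` i].
  rewrite -lawX//; have mi : measurable (X @^-1` [set` i]).
    exact: preimage_measurable.
  rewrite -[X @^-1` _]setIT -integral_indic//; apply: eq_integral => w _.
  by rewrite indicE mem_setE.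
transitivity (\int[P]_w ((X w \in `]s, +oo[)%:R)%:E).
  by apply: eq_integral => w _; rewrite in_itv/= andbT.
transitivity (\int[P]_w ((X w \in `[s, +oo[)%:R)%:E); last first.
  by apply: eq_integral => w _; rewrite in_itv/= andbT.
rewrite !prob /exponential_prob integral_itv_obnd_cbnd//.
apply: measurable_funTS; apply/measurable_EFinP.
exact: measurable_exponential_pdf.
Qed.

End exponential.

(** * Iterated limits and bounded convergence *)

Section iterated_limits.
Context {R : realType}.

(** Convergence along this filter is the iterated limit, first in the second
index and then in the first one. *)
Definition iter_oo : set_system (nat * nat) :=
  [set A | \forall j \near \oo, \forall n \near \oo, A (j, n)].

Global Instance iter_oo_filter : ProperFilter iter_oo.
Proof.
split.
  by move=> [j _ /(_ j (leqnn j))] [n _ /(_ n (leqnn n))].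
split.
- by apply: nearW => j; apply: nearW.
- move=> A B; rewrite /iter_oo/= => hA hB.
  by apply: filterS2 hA hB => j; exact: filterI.
- move=> A B AB; rewrite /iter_oo/=.
  by apply: filterS => j; apply: filterS => n; exact: AB.
Qed.

Local Open Scope ereal_scope.
Implicit Types (u : nat -> \bar R) (c : \bar R).

Lemma limn_einf_ereal_sup u : limn_einf u = ereal_sup (range (einfs u)).
Proof. by rewrite limn_einf_lim; apply/cvg_lim => //; exact: cvg_einfs_sup. Qed.

Lemma limn_einf_ge_near u c : (\forall n \near \oo, c <= u n) -> c <= limn_einf u.
Proof.
case=> m _ mP; rewrite limn_einf_ereal_sup.
apply: (@le_trans _ _ (einfs u m)); last by apply: ereal_sup_ubound; exists m.
by apply: le_ereal_inf_tmp => _ [k /= mk <-]; exact: mP.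
Qed.

Lemma limn_einf_le_near u c : (\forall n \near \oo, u n <= c) -> limn_einf u <= c.
Proof.
case=> m _ mP; rewrite limn_einf_ereal_sup.
apply: ge_ereal_sup => _ [k _ <-].
apply: (@le_trans _ _ (u (maxn k m))); last by apply: mP; rewrite /= leq_maxr.
by apply: ereal_inf_lbound; exists (maxn k m) => //=; rewrite leq_maxl.
Qed.

Lemma lt_limn_einf_near u c : c < limn_einf u -> \forall n \near \oo, c < u n.
Proof.
rewrite limn_einf_ereal_sup => /ereal_sup_gt[_ [m _ <-] cm].
exists m => // k /= mk; apply: (lt_le_trans cm).
by apply: ereal_inf_lbound; exists k.
Qed.

(** This reduces a limit along [iter_oo] to two sequential lower limits, to
which measurability and Fatou's lemma apply. *)
Lemma iter_oo_limn_einf (u : nat * nat -> R) (l : R) : u @ iter_oo --> l ->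
  limn_einf (fun j => limn_einf (fun n => (u (j, n))%:E)) = l%:E.
Proof.
move=> /cvgrPdist_le ul; apply/eqP; rewrite eq_le; apply/andP; split.
- apply/lee_addgt0Pr => e e0; apply: limn_einf_le_near.
  have : \forall j \near \oo, \forall n \near \oo, (`|l - u (j, n)| <= e)%R := ul _ e0.
  apply: filterS => j jP; apply: limn_einf_le_near.
  apply: filterS jP => n /=; rewrite -EFinD lee_fin ler_distlC => /andP[_].
  by rewrite addrC; lra.
- apply/lee_addgt0Pr => e e0; rewrite -leeBlDr//.
  apply: limn_einf_ge_near.
  have : \forall j \near \oo, \forall n \near \oo, (`|l - u (j, n)| <= e)%R := ul _ e0.
  apply: filterS => j jP; apply: limn_einf_ge_near.
  by apply: filterS jP => n /=; rewrite -EFinB lee_fin ler_distl => /andP[? ?]; lra.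
Qed.

Context d (T : measurableType d).

Lemma measurable_fun_iter_oo (f : nat * nat -> T -> R) (g : T -> R) :
  (forall x, measurable_fun setT (f x)) ->
  (forall w, f^~ w @ iter_oo --> g w) -> measurable_fun setT g.
Proof.
move=> mf fg; apply/measurable_EFinP.
rewrite (_ : _ \o _ = fun w => - limn_esup (fun j => limn_esup (fun n => - (f (j, n) w)%:E))).
  have mneg j : measurable_fun setT (fun w => limn_esup (fun n => - (f (j, n) w)%:E)).
    apply: (@measurable_fun_limn_esup _ _ _ _ (fun n w => - (f (j, n) w)%:E)) => n.
    by apply: (measurableT_comp (@oppe_measurable R setT)); exact/measurable_EFinP.
  apply: (measurableT_comp (@oppe_measurable R setT)) => //.
  exact: (@measurable_fun_limn_esup _ _ _ _ (fun j w => limn_esup (fun n => - (f (j, n) w)%:E))).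
apply/funext => w /=; rewrite -(iter_oo_limn_einf (fg w)).
rewrite /limn_einf; congr (- limn_esup _); apply/funext => j /=.
by rewrite oppeK.
Qed.

Variable P : probability T R.

(** Fatou's lemma, applied twice to 1 - |f x - g|, shows that the mean of
|f x - g| tends to 0. *)
Lemma integral_iter_oo (f : nat * nat -> T -> R) (g : T -> R) :
  (forall x, measurable_fun setT (f x)) -> (forall x w, 0 <= f x w <= 1)%R ->
  (forall w, f^~ w @ iter_oo --> g w) ->
  fine (\int[P]_w (f x w)%:E) @[x --> iter_oo] --> fine (\int[P]_w (g w)%:E).
Proof.
move=> mf f01 fg.
have mg := measurable_fun_iter_oo mf fg.
(* 1 - D is nonnegative, and its integral has lower limit at least 1 *)
pose D x w : R := `|f x w - g w|%R.
have g01 w : (0 <= g w <= 1)%R.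
  apply/andP; split.
    by apply: (cvgr_to_ge (fg w)); near=> x; have /andP[] := f01 x w.
  by apply: (cvgr_to_le (fg w)); near=> x; have /andP[] := f01 x w.
have D01 x w : (0 <= 1 - D x w)%R.
  rewrite subr_ge0 ler_norml; have /andP[? ?] := f01 x w.
  by have /andP[? ?] := g01 w; apply/andP; split; lra.
have mD x : measurable_fun setT (fun w => (1 - D x w)%:E).
  apply/measurable_EFinP/measurable_funB => //.
  by apply: measurableT_comp => //; exact: measurable_funB.
have Dcvg w : (fun x => 1 - D x w)%R @ iter_oo --> (1 : R)%R.
  rewrite -[X in _ --> X]subr0; apply: cvgB; first exact: cvg_cst.
  by apply/(@norm_cvg0P _ R^o); apply/subr_cvg0; exact: fg.
pose V j w := limn_einf (fun n => (1 - D (j, n) w)%:E).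
have mV j : measurable_fun setT (V j).
  apply: (measurableT_comp (@oppe_measurable R setT)) => //.
  apply: (@measurable_fun_limn_esup _ _ _ _ (fun n w => - (1 - D (j, n) w)%:E)) => n.
  exact: (measurableT_comp (@oppe_measurable R setT)).
have V0 j w : 0 <= V j w.
  by apply: limn_einf_ge_near; apply: nearW => n; rewrite lee_fin.
have le1 : 1 <= limn_einf (fun j => \int[P]_w V j w).
  apply: (@le_trans _ _ (\int[P]_w limn_einf (V^~ w))); last exact: fatou.
  rewrite (_ : (fun w => _) = cst 1); last first.
    by apply/funext => w; rewrite /V (iter_oo_limn_einf (Dcvg w)).
  by rewrite integral_cst//= mul1e probability_setT.
have bound (h : T -> R) : measurable_fun setT h -> (forall w, 0 <= h w <= 1)%R ->
    \int[P]_w (h w)%:E = (fine (\int[P]_w (h w)%:E))%:E.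
  by move=> mh h01; rewrite fineK//; exact: integral_fin_num01.
have key (h k : T -> R) x : measurable_fun setT h -> (forall w, 0 <= h w <= 1)%R ->
    measurable_fun setT k -> (forall w, 0 <= k w <= 1)%R ->
    (forall w, h w - k w <= D x w)%R -> forall e : R,
    (1 - e)%:E < \int[P]_w (1 - D x w)%:E ->
    (fine (\int[P]_w (h w)%:E) <= fine (\int[P]_w (k w)%:E) + e)%R.
  move=> mh h01 mk k01 hk e eD.
  have : \int[P]_w (1 - D x w)%:E + \int[P]_w (h w)%:E <= 1 + \int[P]_w (k w)%:E.
    rewrite -ge0_integralD//; last 3 first.
    - by move=> w _; rewrite lee_fin.
    - by move=> w _; rewrite lee_fin; have /andP[] := h01 w.
    - exact/measurable_EFinP.
    have <- : \int[P]_w cst 1 w = 1 by rewrite integral_cst//= mul1e probability_setT.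
    rewrite -ge0_integralD//; last 2 first.
    - by move=> w _; rewrite lee_fin; have /andP[] := k01 w.
    - exact/measurable_EFinP.
    apply: ge0_le_integral => //.
    - by move=> w _; rewrite adde_ge0// lee_fin; have /andP[] := h01 w.
    - by apply: emeasurable_funD => //; exact/measurable_EFinP.
    - by apply: emeasurable_funD => //; exact/measurable_EFinP.
    - by move=> w _; rewrite -!EFinD lee_fin; have := hk w; lra.
  rewrite (bound h)// (bound k)// => hh.
  have : ((1 - e) + fine (\int[P]_w (h w)%:E))%:E < (1 + fine (\int[P]_w (k w)%:E))%:E.
    by apply: lt_le_trans hh; rewrite EFinD lteD2rE.
  rewrite lte_fin; lra.
apply/cvgrPdist_le => e e0 /=.
have e1 : (1 - e)%:E < limn_einf (fun j => \int[P]_w V j w).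
  by apply: lt_le_trans le1; rewrite lte_fin; lra.
have := lt_limn_einf_near e1; apply: filterS => j ej.
have := lt_limn_einf_near (lt_le_trans ej (fatou P measurableT (fun n => mD (j, n))
   (fun n w _ => D01 (j, n) w))).
apply: filterS => n en; rewrite ler_distl; apply/andP; split.
- rewrite lerBlDr; apply: (key _ _ (j, n)) => // w; rewrite /D.
  exact: ler_norm.
- apply: (key _ _ (j, n)) => // w; rewrite /D distrC; exact: ler_norm.
Unshelve. all: by end_near.
Qed.

End iterated_limits.

(** * Independence tested on continuous functions *)

Section quadrants.
Context {R : realType}.

Definition quadrant (c : R * R) : set (R * R) := [set x | c.1 < x.1 /\ c.2 < x.2].

Lemma quadrant_setX c : quadrant c = `]c.1, +oo[%classic `*` `]c.2, +oo[%classic.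
Proof. by apply/seteqP; split => x /=; rewrite !in_itv/= !andbT. Qed.

Lemma setI_closed_quadrant : setI_closed (range quadrant).
Proof.
move=> _ _ [c _ <-] [c' _ <-].
exists (Num.max c.1 c'.1, Num.max c.2 c'.2) => //.
by apply/seteqP; split => x /=; rewrite /quadrant/= !gt_max;
  [move=> [/andP[? ?] /andP[? ?]]|move=> [[? ?] [? ?]]; split; apply/andP].
Qed.

(** The half-planes that generate the Borel sets of the plane are countable
unions of quadrants. *)
Lemma measurable_quadrant : @measurable _ (R * R)%type = <<s range quadrant >>.
Proof.
apply/seteqP; split; last first.
  apply: smallest_sub; first exact: sigma_algebra_measurable.
  move=> _ [c _ <-]; rewrite quadrant_setX; apply: measurableX;
  exact: measurable_itv.
pose Q := g_sigma_algebraType (range quadrant).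
have mQ c : @measurable _ Q (quadrant c) by apply: sub_sigma_algebra; exists c.
have m1 : @measurable_fun _ _ Q (measurableTypeR R) setT fst.
  apply: (measurability _ (RGenOInfty.measurableE R)) => //.
  move=> _ [_ [a ->] <-]; rewrite setTI.
  rewrite (_ : _ @^-1` _ = \bigcup_n quadrant (a, - n%:R)).
    by apply: bigcupT_measurable => n; exact: mQ.
  apply/seteqP; split => x /=; rewrite in_itv/= andbT; last by case=> n _ [].
  move=> ax; exists (Num.truncn `|x.2|).+1 => //; split => //=.
  rewrite ltrNl (le_lt_trans (ler_norm _))// normrN; exact: truncnS_gt.
have m2 : @measurable_fun _ _ Q (measurableTypeR R) setT snd.
  apply: (measurability _ (RGenOInfty.measurableE R)) => //.
  move=> _ [_ [a ->] <-]; rewrite setTI.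
  rewrite (_ : _ @^-1` _ = \bigcup_n quadrant (- n%:R, a)).
    by apply: bigcupT_measurable => n; exact: mQ.
  apply/seteqP; split => x /=; rewrite in_itv/= andbT; last by case=> n _ [].
  move=> ax; exists (Num.truncn `|x.1|).+1 => //; split => //=.
  rewrite ltrNl (le_lt_trans (ler_norm _))// normrN; exact: truncnS_gt.
have mid := measurable_fun_pair m1 m2.
move=> A mA; have := mid measurableT A mA; rewrite setTI.
by rewrite (_ : _ @^-1` A = A)//; apply/seteqP; split => -[].
Qed.

(** A continuous function that increases to the indicator of the quadrant with
corner c. *)
Definition ramp (n : nat) (c : R * R) (x : R * R) : R :=
  Num.min 1 (Num.max 0 (n%:R * (x.1 - c.1))) * Num.min 1 (Num.max 0 (n%:R * (x.2 - c.2))).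

Lemma ramp01 n c x : 0 <= ramp n c x <= 1.
Proof.
have h (u : R) : 0 <= Num.min 1 (Num.max 0 u) <= 1.
  by rewrite le_min ler01 le_max lexx /= ge_min lexx.
have /andP[a0 a1] := h (n%:R * (x.1 - c.1)).
have /andP[b0 b1] := h (n%:R * (x.2 - c.2)).
by rewrite /ramp mulr_ge0//= mulr_ile1.
Qed.

Lemma continuous_ramp n c : continuous (ramp n c).
Proof.
have h (p : R * R -> R) a : continuous p ->
    continuous (fun x => Num.min 1 (Num.max 0 (n%:R * (p x - a)))).
  move=> cp x.
  apply: (@continuous_min R _ (cst 1) (fun x => Num.max 0 (n%:R * (p x - a)))).
    exact: cvg_cst.
  apply: (@continuous_max R _ (cst 0) (fun x => n%:R * (p x - a))).
    exact: cvg_cst.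
  by apply: cvgM; [exact: cvg_cst|apply: cvgB; [exact: cp|exact: cvg_cst]].
move=> x; apply: cvgM; [apply: h => y; exact: cvg_fst|apply: h => y; exact: cvg_snd].
Qed.

Lemma ramp_cvg c x : ramp n c x @[n --> \oo] --> (\1_(quadrant c) x : R).
Proof.
have h (u : R) : Num.min 1 (Num.max 0 (n%:R * u)) @[n --> \oo] --> ((0 < u)%R%:R : R).
  have [u0|u0] := ltP 0 u.
    apply: cvg_near_cst; exists (Num.truncn u^-1).+1 => // n /= nu.
    have nu1 : 1 <= n%:R * u.
      rewrite -ler_pdivrMr// div1r (le_trans (ltW (truncnS_gt _)))// ler_nat.
      exact: nu.
    by rewrite min_l// le_max nu1 orbT.
  apply: cvg_near_cst; apply: nearW => n.
  rewrite max_l; last by rewrite mulr_ge0_le0.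
  by rewrite min_r.
rewrite (_ : \1__ _ = (0 < x.1 - c.1)%R%:R * (0 < x.2 - c.2)%R%:R).
  by apply: cvgM; exact: h.
rewrite !subr_gt0 indicE -natrM mulnb.
have -> // : (x \in quadrant c) = (c.1 < x.1) && (c.2 < x.2).
by apply/idP/idP; [move/set_mem => [-> ->]|move/andP => ?; apply/mem_set].
Qed.

End quadrants.

Section indep_continuous.
Local Open Scope ereal_scope.
Context {R : realType} d (T : measurableType d) (P : probability T R).

Lemma iter_oo_cst (u : nat -> R) (l : R) : u @ \oo --> l ->
  (fun x : nat * nat => u x.2) @ iter_oo --> l.
Proof. by move=> ul A Al; apply: nearW => j; exact: (ul A Al). Qed.

(** Indicators of quadrants are limits of [ramp]s, and quadrants form a
pi-system that generates the Borel sets of the plane. *)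
Lemma indep_rv_continuous (X Z : T -> R * R) :
  measurable_fun setT X -> measurable_fun setT Z ->
  (forall f g : R * R -> R, continuous f -> continuous g ->
    measurable_fun setT f -> measurable_fun setT g ->
    (forall x, 0 <= f x <= 1)%R -> (forall x, 0 <= g x <= 1)%R ->
    fine (\int[P]_w (f (X w) * g (Z w))%:E) =
    (fine (\int[P]_w (f (X w))%:E) * fine (\int[P]_w (g (Z w))%:E))%R) ->
  indep_rv P X Z.
Proof.
move=> mX mZ H.
have mramp n c : measurable_fun setT (@ramp R n c).
  have h (u : R * R -> R) a : measurable_fun setT u ->
      measurable_fun setT (fun x => Num.min 1 (Num.max 0 (n%:R * (u x - a))))%R.
    move=> mu; apply: measurable_minr => //; apply: measurable_maxr => //.
    by apply: measurable_funM => //; exact: measurable_funB.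
  by apply: measurable_funM; apply: h.
have quad c c' : P (X @^-1` quadrant c `&` Z @^-1` quadrant c') =
    P (X @^-1` quadrant c) * P (Z @^-1` quadrant c').
  have mq (V : T -> R * R) e : measurable_fun setT V -> measurable (V @^-1` quadrant e).
    move=> mV; apply: preimage_measurable => //; rewrite measurable_quadrant.
    by apply: sub_sigma_algebra; exists e.
  have lim1 (V : T -> R * R) e : measurable_fun setT V ->
      fine (\int[P]_w (ramp x.2 e (V w))%:E) @[x --> iter_oo] --> fine (P (V @^-1` quadrant e)).
    move=> mV; rewrite -[V @^-1` _]setIT -integral_indic//; last exact: mq.
    apply: integral_iter_oo.
    - by move=> x; exact: measurableT_comp.
    - by move=> x w; exact: ramp01.
    - move=> w; apply: (@iter_oo_cst (fun n => ramp n e (V w))).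
      exact: ramp_cvg.
  have lim2 : fine (\int[P]_w (ramp x.2 c (X w) * ramp x.2 c' (Z w))%:E)
      @[x --> iter_oo] --> fine (P (X @^-1` quadrant c `&` Z @^-1` quadrant c')).
    rewrite -[_ `&` _]setIT -integral_indic//; last by apply: measurableI; exact: mq.
    apply: integral_iter_oo.
    - by move=> x; apply: measurable_funM; exact: measurableT_comp.
    - move=> x w; have /andP[? ?] := ramp01 x.2 c (X w).
      have /andP[? ?] := ramp01 x.2 c' (Z w).
      by rewrite mulr_ge0//= mulr_ile1.
    - move=> w; rewrite indicI; apply: cvgM.
        apply: (@iter_oo_cst (fun n => ramp n c (X w))); exact: ramp_cvg.
      apply: (@iter_oo_cst (fun n => ramp n c' (Z w))); exact: ramp_cvg.
  have e : fine (P (X @^-1` quadrant c `&` Z @^-1` quadrant c')) =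
    (fine (P (X @^-1` quadrant c)) * fine (P (Z @^-1` quadrant c')))%R.
    have Hn (x : nat * nat) := H (ramp x.2 c) (ramp x.2 c') (@continuous_ramp R _ _)
      (@continuous_ramp R _ _) (mramp _ _) (mramp _ _) (ramp01 _ _) (ramp01 _ _).
    have := cvgM (lim1 X c mX) (lim1 Z c' mZ).
    move: lim2; rewrite (eq_cvg _ _ Hn) => l2 l3.
    exact: (cvg_unique (@Rhausdorff R) l2 (l3 _)).
  rewrite -[LHS]fineK ?fin_num_measure//; last by apply: measurableI; exact: mq.
  rewrite e EFinM !fineK// fin_num_measure//; exact: mq.
apply: (indep_rv_pi_system measurable_quadrant setI_closed_quadrant
  measurable_quadrant setI_closed_quadrant) => // A B.
by move=> [c _ <-] [c' _ <-]; exact: quad.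
Qed.

End indep_continuous.

(** * The last maximum of a cadlag function *)

Section cadlag_paths.
Context {R : realType}.
Implicit Types (y : R -> R) (a b s t M G : R).

(** A cadlag function on a compact interval takes its values, near each point
x, close to y(x) on the right of x and close to the left limit on its left;
compactness makes a property that holds near all these values hold uniformly. *)
Lemma cadlag_cover (I : Type) (F : set_system I) (FF : Filter F)
    (Q : I -> R -> Prop) y a b : cadlag y -> 0 <= a ->
  (forall x, a <= x <= b -> \forall v \near y x & i \near F, Q i v) ->
  (forall x, a < x <= b -> \forall v \near left_limit y x & i \near F, Q i v) ->
  \forall i \near F, forall x, a <= x <= b -> Q i (y x).
Proof.
move=> [yr yl] a0 Qr Ql.
have /compact_near_coveringP/(_ I F (fun i x => a <= x <= b -> Q i (y x)) FF) :=
  @segment_compact R a b.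
move=> H; have {}H : \forall i \near F, `[a, b] `<=` [set x | a <= x <= b -> Q i (y x)].
  apply: H => x; rewrite /= in_itv/= => xab.
  have /andP[ax xb] := xab.
  have [[A B] /= [Ax BF] ABQ] := Qr x xab.
  have rx : \forall s \near x, x < s -> A (y s).
    exact: (yr x (le_trans a0 ax) A Ax).
  have xx : A (y x) by exact: nbhs_singleton.
  have [ltax|] := boolP (a < x); last first.
    rewrite -leNgt => lexa.
    exists ([set s | x < s -> A (y s)], B) => //= -[s i] [/= sA Bi] /andP[as_ sb].
    apply: (ABQ (y s, i)); split => //=.
    have := le_trans lexa as_; rewrite le_eqVlt => /predU1P[<-//|]; exact: sA.
  have xab' : a < x <= b by rewrite ltax.
  have [[A' B'] /= [A'x B'F] ABQ'] := Ql x xab'.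
  have x0 : 0 < x by exact: le_lt_trans ltax.
  have lx : \forall s \near x, s < x -> A' (y s).
    move: A'x; rewrite /left_limit leNgt x0/= => A'x.
    exact: (yl x x0 A' A'x).
  exists ([set s | x < s -> A (y s)] `&` [set s | s < x -> A' (y s)], B `&` B').
    by split; apply: filterI.
  move=> [s i] [/= [sA sA'] [Bi B'i]] _.
  have [sx|sx|->] := ltgtP s x.
  - by apply: (ABQ' (y s, i)); split => //=; exact: sA'.
  - by apply: (ABQ (y s, i)); split => //=; exact: sA.
  - by apply: (ABQ (y x, i)); split.
near=> i => x xab; apply: (near H i) => //=; by rewrite in_itv.
Unshelve. all: by end_near. Qed.

Lemma cadlag_bounded y a b : cadlag y -> 0 <= a ->
  exists r, forall x, a <= x <= b -> `|y x| <= r.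
Proof.
move=> cy a0.
have H : \forall r \near +oo, forall x, a <= x <= b -> `|y x| <= r.
  have nearQ (l : R) : \forall v \near l & r \near +oo, `|v| <= r.
    exists ([set v | `|v| < `|l| + 1], [set r | `|l| + 1 <= r]) => /=.
      split; last by exact: nbhs_pinfty_ge.
      have : (fun v : R => `|v|) @ l --> `|l| by exact: norm_continuous.
      by move=> /cvgr_lt; apply; rewrite ltrDl.
    by move=> [v r] [/= vl lr]; exact: le_trans (ltW vl) lr.
  apply: (cadlag_cover (Q := fun r v => `|v| <= r) _ cy a0) => x _; exact: nearQ.
by have [r rP] := filter_ex H; exists r.
Qed.

(** A cadlag function need not attain its supremum, but it stays away from M
as soon as its values and its left limits do. *)
Lemma cadlag_gap y a b M : cadlag y -> 0 <= a ->
  (forall x, a <= x <= b -> y x < M) -> (forall x, a < x <= b -> left_limit y x < M) ->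
  exists2 e, 0 < e & forall x, a <= x <= b -> y x <= M - e.
Proof.
move=> cy a0 yM lM.
have H : \forall e \near 0^'+, forall x, a <= x <= b -> y x <= M - e.
  have nearQ (l : R) : l < M -> \forall v \near l & e \near 0^'+, v <= M - e.
    move=> lM'; exists ([set v | v < (l + M) / 2], [set e | e < (M - l) / 2]) => /=.
      split; first by apply: lt_nbhsl; lra.
      by apply: nbhs_right_lt; lra.
    by move=> [v r] /= [/= ? ?]; lra.
  apply: (cadlag_cover (Q := fun r v => v <= M - r) _ cy a0) => x xab.
  - exact: nearQ (yM _ xab).
  - exact: nearQ (lM _ xab).
have [e [eP e0]] := filter_ex (filterI H (nbhs_right_gt (0 : R))).
by exists e.
Qed.

(** M is the supremum of y on [0, t] and G the last epoch at which it is
approached: values close to M occur near G, and after G + d the path stays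
below M by a margin. Left limits do not occur, so that estimates
along sampled values suffice to recognise M and G. *)
Definition max_epoch y t M G : Prop :=
  [/\ 0 <= G <= t, forall s, 0 <= s <= t -> y s <= M,
      forall d e, 0 < d -> 0 < e ->
        exists s, [/\ 0 <= s <= t, `|s - G| < d & M - e < y s] &
      forall d, 0 < d ->
        exists2 e, 0 < e & forall s, G + d <= s <= t -> y s <= M - e].

Lemma max_epoch_unique y t M G M' G' :
  max_epoch y t M G -> max_epoch y t M' G' -> M = M' /\ G = G'.
Proof.
suff H A B A' B' : max_epoch y t A B -> max_epoch y t A' B' -> A <= A' /\ (A = A' -> B' <= B).
  move=> h h'; have [l1 g1] := H _ _ _ _ h h'; have [l2 g2] := H _ _ _ _ h' h.
  have e : M = M' by apply/eqP; rewrite eq_le l1.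
  by split => //; apply/eqP; rewrite eq_le g1// g2.
move=> [_ _ near1 gap1] [_ ub2 near2 _]; split.
  rewrite leNgt; apply/negP => AA.
  have e0 : 0 < A - A' by lra.
  have [s [st _ ys]] := near1 1 _ ltr01 e0.
  by have := ub2 _ st; lra.
move=> AA'; rewrite leNgt; apply/negP => BB.
have d0 : 0 < (B' - B) / 2 by lra.
have [e e0 gap] := gap1 _ d0.
have [s [st sd ys]] := near2 _ _ d0 e0.
have : y s <= A - e.
  apply: gap; move: sd; rewrite ltr_distl => /andP[? ?].
  by move: st => /andP[? ?]; apply/andP; split => //; lra.
by rewrite AA'; lra.
Qed.

Lemma left_limit_cvg y s : cadlag y -> 0 < s -> y x @[x --> s^'-] --> left_limit y s.
Proof. by move=> [_ yl] s0; rewrite /left_limit leNgt s0/=; exact: yl. Qed.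

Lemma left_limit_le y s a c : cadlag y -> 0 <= a -> a < s ->
  (forall r, a <= r < s -> y r <= c) -> left_limit y s <= c.
Proof.
move=> cy a0 as_ H; have s0 : 0 < s by exact: le_lt_trans as_.
apply: (cvgr_to_le (left_limit_cvg cy s0)); near=> r; apply: H; apply/andP; split.
  by near: r; exact: nbhs_left_ge.
by near: r; exact: nbhs_left_lt.
Unshelve. all: by end_near. Qed.

Lemma running_max_ub y t s : cadlag y -> 0 <= s <= t -> y s <= running_max y t.
Proof.
move=> cy st; have [r yr] := cadlag_bounded t cy (lexx 0).
apply: ub_le_sup; last by exists s => //; rewrite /= in_itv.
exists r => _ [x + <-]; rewrite /= in_itv/= => /yr; apply: le_trans; exact: ler_norm.
Qed.

Lemma running_maxP y t : cadlag y -> 0 <= t ->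
  max_epoch y t (running_max y t) (last_max_epoch y t).
Proof.
move=> cy t0; set M := running_max y t.
have ub s : 0 <= s <= t -> y s <= M by exact: running_max_ub.
have lub s : 0 < s <= t -> left_limit y s <= M.
  move=> /andP[s0 st]; apply: (left_limit_le cy (lexx 0) s0) => r /andP[r0 rs].
  by apply: ub; rewrite r0 (le_trans (ltW rs)).
set S := [set s | s \in `[0, t] /\ (y s = M \/ left_limit y s = M)].
have gapS a : 0 <= a -> (forall s, a <= s <= t -> ~ S s) ->
    exists2 e, 0 < e & forall s, a <= s <= t -> y s <= M - e.
  move=> a0 NS; apply: cadlag_gap => // s /andP[as_ st].
    rewrite lt_neqAle ub ?(le_trans a0)// andbT; apply/eqP => ysM.
    by apply: (NS s); [rewrite as_|split; [rewrite in_itv/= (le_trans a0)|left]].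
  have s0 : 0 < s by exact: le_lt_trans as_.
  rewrite lt_neqAle lub ?s0// andbT; apply/eqP => ysM.
  by apply: (NS s); [rewrite ltW|split; [rewrite in_itv/= ltW|right]].
have S0 : S !=set0.
  apply: contrapT => /forallNP NS.
  have [e e0 gap] := gapS 0 (lexx 0) (fun s _ => NS s).
  have : M <= M - e.
    apply: ge_sup; first by exists (y 0), 0 => //; rewrite /= in_itv/= lexx.
    by move=> _ [x + <-]; rewrite /= in_itv/=; exact: gap.
  lra.
have Sub : ubound S t by move=> s [/=]; rewrite in_itv/= => /andP[].
have hS : has_sup S by split => //; exists t.
have -> : last_max_epoch y t = sup S by [].
have SG s : S s -> s <= sup S by move=> Ss; apply: ub_le_sup => //; exists t.
have G0 : 0 <= sup S.
  have [s Ss] := S0; apply: le_trans (SG _ Ss).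
  by case: Ss; rewrite in_itv/= => /andP[].
have Gt : sup S <= t by exact: ge_sup.
split => //.
- by rewrite G0.
- move=> d e d0 e0.
  have [s Ss sd] := sup_adherent d0 hS.
  have sG := SG _ Ss; have [+ sM] := Ss; rewrite in_itv/= => /andP[s0 st].
  have near0 u : y u = M -> 0 <= u <= s -> sup S - d < u ->
      exists s, [/\ 0 <= s <= t, `|s - sup S| < d & M - e < y s].
    move=> yu /andP[u0 us] ud; exists u; rewrite u0 (le_trans us)// yu.
    by split => //; [rewrite ltr_distl; apply/andP; split; lra|lra].
  have [ysM|lsM] := sM; first by apply: (near0 s) => //; rewrite s0 lexx.
  have [s00|s0'] := leP s 0.
    apply: (near0 s) => //; last by rewrite s0 lexx.
    have -> : s = 0 by apply/eqP; rewrite eq_le s00.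
    by rewrite -lsM /left_limit s00.
  have lt1 : M - e < left_limit y s by rewrite lsM; lra.
  have H1 : \forall u \near s^'-, M - e < y u.
    exact: (cvgr_gt _ (left_limit_cvg cy s0') _ lt1).
  have H2 := nbhs_left_gt s0'.
  have H3 := nbhs_left_gt sd.
  have H4 := nbhs_left_lt s.
  have [u [u1 u2 u3 u4]] : exists u, [/\ M - e < y u, 0 < u, sup S - d < u & u < s].
    have FF : ProperFilter s^'- by exact: at_left_proper_filter.
    apply: (@filter_ex _ _ FF); near=> u.
    by split; near: u.
  exists u; split => //; first by apply/andP; split; lra.
  by rewrite ltr_distl; apply/andP; split; lra.
- move=> d d0; apply: gapS; first lra.
  by move=> s /andP[Gs st] /SG; lra.
Unshelve. all: by end_near. Qed.

Lemma max_epochE y t M G : cadlag y -> max_epoch y t M G ->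
  running_max y t = M /\ last_max_epoch y t = G.
Proof.
move=> cy h; have t0 : 0 <= t by have [/andP[? ?] _ _ _] := h; lra.
exact: max_epoch_unique (running_maxP cy t0) h.
Qed.

End cadlag_paths.

(** * The measurable space of cadlag paths *)

Section path_operations.
Context {R : realType}.
Implicit Types (y : R -> R) (s t : R).

Lemma cadlag_shift y s : cadlag y -> 0 <= s -> cadlag (fun t => y (s + t) - y s).
Proof.
move=> [yr yl] s0.
have shiftr t : (s + x) @[x --> t^'+] --> (s + t)^'+.
  move=> A /= [e e0 eA]; exists e => // x /= xt tx.
  by apply: eA; rewrite /= ?ltrD2l// opprD addrACA subrr add0r.
have shiftl t : (s + x) @[x --> t^'-] --> (s + t)^'-.
  move=> A /= [e e0 eA]; exists e => // x /= xt tx.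
  by apply: eA; rewrite /= ?ltrD2l// opprD addrACA subrr add0r.
split=> t t0.
  apply: cvgB; last exact: cvg_cst.
  by apply: cvg_comp (shiftr t) _; apply: yr; lra.
apply: is_cvgB; last exact: is_cvg_cst.
have /cvg_ex[l yl'] := yl (s + t) (ltr_wpDl s0 t0).
by apply/cvg_ex; exists l; exact: cvg_comp (shiftl t) yl'.
Qed.

Lemma cadlag_stop y s : cadlag y -> 0 <= s -> cadlag (fun t => y (Num.min t s)).
Proof.
move=> [yr yl] s0; split=> t t0.
  have [ts|st] := ltP t s.
    apply: cvg_trans (yr t t0); apply: near_eq_cvg.
    apply: filterS (nbhs_right_lt ts) => x xs /=.
    by rewrite min_l// ltW.
  apply: (@cvg_trans _ (cst (y s) x @[x --> t^'+])).
    apply: near_eq_cvg; apply: filterS (nbhs_right_gt t) => x tx /=.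
    by rewrite min_r// (le_trans st)// ltW.
  exact: cvg_cst.
have [ts|st] := leP t s.
  have /cvg_ex[l yl'] := yl t t0; apply/cvg_ex; exists l.
  apply: cvg_trans yl'; apply: near_eq_cvg.
  apply: filterS (nbhs_left_lt t) => x xt /=.
  by rewrite min_l// (le_trans _ ts)// ltW.
apply/cvg_ex; exists (y s).
apply: (@cvg_trans _ (cst (y s) x @[x --> t^'-])); last exact: cvg_cst.
apply: near_eq_cvg; apply: filterS (nbhs_left_gt st) => x sx /=.
by rewrite min_r// ltW.
Qed.

(** Paths are bundled with their regularity, so that a process is a single
random variable with values in the space of paths. *)
Record cadlag_path := CadlagPath {
  path_fun :> R -> R ;
  path_cadlag : cadlag path_fun ;
  path_start : path_fun 0 = 0 }.

Lemma cadlag_zero : cadlag (fun _ : R => 0 : R).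
Proof. by split=> t _; [exact: cvg_cst|exact: is_cvg_cst]. Qed.

Definition zero_path : cadlag_path := CadlagPath cadlag_zero erefl.

Lemma max0_ge0 s : 0 <= Num.max s 0.
Proof. by rewrite le_max lexx orbT. Qed.

Lemma shift_path_start y s : y (Num.max s 0 + 0) - y (Num.max s 0) = 0.
Proof. by rewrite addr0 subrr. Qed.

(** The clipping of s at 0 makes the operation total. *)
Definition shift_path s (y : cadlag_path) : cadlag_path :=
  CadlagPath (cadlag_shift (path_cadlag y) (max0_ge0 s)) (shift_path_start y s).

Lemma stop_path_start (y : cadlag_path) s : y (Num.min 0 (Num.max s 0)) = 0.
Proof. by rewrite min_l ?max0_ge0// path_start. Qed.

Definition stop_path s (y : cadlag_path) : cadlag_path :=
  CadlagPath (cadlag_stop (path_cadlag y) (max0_ge0 s)) (stop_path_start y s).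

Lemma shift_pathE s (y : cadlag_path) t : 0 <= s -> shift_path s y t = y (s + t) - y s.
Proof. by move=> s0 /=; rewrite max_l. Qed.

Lemma stop_pathE s (y : cadlag_path) t : 0 <= s -> t <= s -> stop_path s y t = y t.
Proof. by move=> s0 ts /=; rewrite max_l// min_l. Qed.

End path_operations.

Section path_space.
Context {R : realType}.

HB.instance Definition _ := gen_eqMixin (@cadlag_path R).
HB.instance Definition _ := gen_choiceMixin (@cadlag_path R).
HB.instance Definition _ := isPointed.Build (@cadlag_path R) (@zero_path R).

Definition path_cylinders : set (set (@cadlag_path R)) :=
  [set A | exists (t : R) (B : set R),
    [/\ 0 <= t, measurable B & A = [set y : cadlag_path | B (y t)]]].

Let path_measurable0 : <<s path_cylinders >> set0.
Proof. exact: sigma_algebra0. Qed.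
Let path_measurableC (A : set cadlag_path) :
  <<s path_cylinders >> A -> <<s path_cylinders >> (~` A).
Proof. exact: sigma_algebraC. Qed.
Let path_measurable_bigcup (F : (set cadlag_path)^nat) :
  (forall i, <<s path_cylinders >> (F i)) -> <<s path_cylinders >> (\bigcup_i F i).
Proof. exact: sigma_algebra_bigcup. Qed.

HB.instance Definition _ := @isMeasurable.Build (sigma_display path_cylinders)
  (@cadlag_path R) <<s path_cylinders >>
  path_measurable0 path_measurableC path_measurable_bigcup.

Lemma measurable_path_eval t : 0 <= t ->
  measurable_fun setT (fun y : @cadlag_path R => y t).
Proof.
move=> t0 _ B mB; rewrite setTI; apply: sub_sigma_algebra.
by exists t, B.
Qed.

Lemma measurable_fun_path d (T : measurableType d) (f : T -> @cadlag_path R) :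
  (forall t, 0 <= t -> measurable_fun setT (fun w => f w t)) -> measurable_fun setT f.
Proof.
move=> mf; apply: (@measurability _ _ _ _ _ _ path_cylinders) => //.
by move=> _ [_ [t [B [t0 mB ->]]] <-]; exact: mf.
Qed.

End path_space.

Section nat_index.
Context d d' (T : measurableType d) (E : measurableType d').

Lemma measurable_fun_nat_index (k : T -> nat) (f : nat -> T -> E) :
  (forall n, measurable [set w | k w = n]) ->
  (forall n, measurable_fun setT (f n)) -> measurable_fun setT (fun w => f (k w) w).
Proof.
move=> mk mf _ B mB; rewrite setTI.
rewrite (_ : _ @^-1` _ = \bigcup_n ([set w | k w = n] `&` f n @^-1` B)).
  apply: bigcupT_measurable => n; apply: measurableI => //.
  exact: preimage_measurable.
by apply/seteqP; split => [w wB|w [n _ [/= <-]]] //; exists (k w).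
Qed.

End nat_index.

Section joint_measurability.
Context {R : realType}.

Lemma measurable_truncn_eq d (T : measurableType d) (f : T -> R) n :
  measurable_fun setT f -> measurable [set w | Num.truncn (f w) = n].
Proof.
move=> mf; rewrite (_ : [set w | _] = f @^-1` [set x | Num.truncn x = n])//.
apply: preimage_measurable => //.
rewrite (_ : [set x | _] = (fun x : R => (Num.truncn x)%:R : R) @^-1` [set n%:R]).
  apply: preimage_measurable => //.
  apply: nondecreasing_measurable => // x y xy.
  by rewrite ler_nat; exact: le_truncn.
apply/seteqP; split => x /= => [->//|/eqP].
by rewrite eqr_nat => /eqP.
Qed.

Definition mesh (n : nat) : R := n.+1%:R^-1.

Lemma mesh_gt0 n : 0 < mesh n.
Proof. by rewrite invr_gt0. Qed.

Lemma mesh_lt_near (e : R) : 0 < e -> \forall n \near \oo, mesh n < e.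
Proof. by move=> e0; apply: (near_infty_natSinv_lt (PosNum e0)). Qed.

Lemma truncn_grid (h t : R) : 0 < h -> 0 <= t ->
  (Num.truncn (t / h))%:R * h <= t < (Num.truncn (t / h)).+1%:R * h.
Proof.
move=> h0 t0; have /truncn_itv/andP[? ?] : 0 <= t / h by rewrite divr_ge0// ltW.
by rewrite -ler_pdivlMr// -ltr_pdivrMr//; apply/andP.
Qed.

(** The grid point strictly on the right of t is chosen, as right limits are
taken along s > t. *)
Lemma grid_right_cvg (t : R) : 0 <= t ->
  (Num.truncn (t / mesh n)).+1%:R * mesh n @[n --> \oo] --> t^'+.
Proof.
move=> t0 A /= [e /= e0 eA]; apply: filterS (mesh_lt_near e0) => n he /=.
have /andP[g1 g2] := truncn_grid (mesh_gt0 n) t0.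
apply: eA => //=; rewrite ltr_distlC; apply/andP; split; first lra.
by move: g1; rewrite -[_.+1]addn1 natrD mulrDl mul1r; lra.
Qed.

(** Right-continuity makes evaluation the limit of evaluations at the next
grid point on the right, which takes countably many values. *)
Lemma measurable_path_eval_time :
  measurable_fun setT (fun p : R * @cadlag_path R => p.2 (Num.max p.1 0)).
Proof.
pose g n (p : R * @cadlag_path R) := (Num.truncn (Num.max p.1 0 / mesh n)).+1%:R * mesh n : R.
apply: (measurable_fun_cvg (h := fun n (p : R * @cadlag_path R) => p.2 (g n p))).
  move=> n.
  have mk k : measurable [set p : R * @cadlag_path R |
      Num.truncn (Num.max p.1 0 / mesh n) = k].
    apply: measurable_truncn_eq; apply: measurable_funM => //.
    exact: measurable_maxr.
  have mf k : measurable_fun setT (fun p : R * @cadlag_path R => p.2 (k.+1%:R * mesh n)).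
    have t0 : 0 <= k.+1%:R * mesh n by rewrite mulr_ge0// ltW// mesh_gt0.
    exact: (measurableT_comp (measurable_path_eval t0) measurable_snd).
  exact: (measurable_fun_nat_index mk mf).
move=> [t y] _ /=; have t0 := max0_ge0 t.
have [yr _] := path_cadlag y.
exact: cvg_comp (grid_right_cvg t0) (yr _ t0).
Qed.

Lemma measurable_path_time d (T : measurableType d) (t : T -> R) (Y : T -> @cadlag_path R) :
  measurable_fun setT t -> measurable_fun setT Y -> (forall w, 0 <= t w) ->
  measurable_fun setT (fun w => Y w (t w)).
Proof.
move=> mt mY t0.
have := measurableT_comp measurable_path_eval_time (measurable_fun_pair mt mY).
by apply: eq_measurable_fun => w _ /=; rewrite max_l.
Qed.

Lemma measurable_shift_path d (T : measurableType d) (s : T -> R) (Y : T -> @cadlag_path R) :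
  measurable_fun setT s -> measurable_fun setT Y ->
  measurable_fun setT (fun w => shift_path (s w) (Y w)).
Proof.
move=> ms mY; apply: measurable_fun_path => t t0 /=.
have mm : measurable_fun setT (fun w => Num.max (s w) 0) by exact: measurable_maxr.
apply: measurable_funB; apply: measurable_path_time => //.
- exact: measurable_funD.
- by move=> w; rewrite addr_ge0// max0_ge0.
- by move=> w; exact: max0_ge0.
Qed.

Lemma measurable_stop_path s : measurable_fun setT (@stop_path R s).
Proof.
apply: measurable_fun_path => t t0 /=; apply: measurable_path_eval.
by rewrite le_min t0 max0_ge0.
Qed.

End joint_measurability.

(** * The last maximum of a path and of the walks sampled from it *)

Section max_pair.
Context {R : realType}.
Implicit Types (y : @cadlag_path R) (s t : R).

Definition max_pair t y : R * R := (running_max y t, last_max_epoch y t).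

(** What the path and the clock still have to add to the last maximum before t
in order to reach their values at t. *)
Definition gap_pair t y : R * R := (y t - running_max y t, t - last_max_epoch y t).

Definition keep_nonneg (x : R * R) : R * R := if 0 <= x.1 then x else 0.

Lemma max_pairP t y : 0 <= t -> max_epoch y t (max_pair t y).1 (max_pair t y).2.
Proof. by move=> t0; exact: running_maxP (path_cadlag y) t0. Qed.

Lemma max_pairE t y M G : max_epoch y t M G -> max_pair t y = (M, G).
Proof. by move=> /(max_epochE (path_cadlag y))[e1 e2]; rewrite /max_pair e1 e2. Qed.

Lemma max_pair_ext t y y' : 0 <= t -> (forall s, 0 <= s <= t -> y s = y' s) ->
  max_pair t y = max_pair t y'.
Proof.
move=> t0 yy'; apply/esym.
have [Gt ub near gap] := max_pairP y t0.
rewrite (surjective_pairing (max_pair t y)); apply: max_pairE; split => //.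
- by move=> s st; rewrite -yy'//; exact: ub.
- move=> d e d0 e0; have [s [st sd ys]] := near d e d0 e0; exists s.
  by rewrite -yy'.
- move=> d d0; have [e e0 h] := gap d d0; exists e => // s /andP[Gs st].
  rewrite -yy'; first by apply: h; rewrite Gs.
  by rewrite st andbT; move: Gt => /andP[? ?]; lra.
Qed.

Lemma max_pair_stop t y : 0 <= t -> max_pair t (stop_path t y) = max_pair t y.
Proof.
by move=> t0; apply: max_pair_ext => // s /andP[_ st]; rewrite stop_pathE.
Qed.

Lemma gap_pair_stop t y : 0 <= t -> gap_pair t (stop_path t y) = gap_pair t y.
Proof.
move=> t0; have [e1 e2] := max_pair_stop y t0.
by rewrite /gap_pair e1 e2 stop_pathE.
Qed.

(** After time s the path sees the old maximum at height minus the first entry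
of [gap_pair]. A later maximum replaces it when it is at least as high, ties
included because the last epoch is recorded: hence the weak inequality in
[keep_nonneg]. *)
Lemma max_pair_add s t y : 0 <= s -> 0 <= t ->
  max_pair (s + t) y =
  max_pair s y + keep_nonneg (gap_pair s y + max_pair t (shift_path s y)).
Proof.
move=> s0 t0; have [Gs ubs nears gaps] := max_pairP y s0.
have [Gt ubt neart gapt] := max_pairP (shift_path s y) t0.
rewrite /keep_nonneg/=.
have [MG1 MG2] : (max_pair s y).1 = running_max y s /\ (max_pair s y).2 = last_max_epoch y s by [].
have [NG1 NG2] : (max_pair t (shift_path s y)).1 = running_max (shift_path s y) t /\
  (max_pair t (shift_path s y)).2 = last_max_epoch (shift_path s y) t by [].
rewrite {}MG1 {}MG2 in Gs ubs nears gaps; rewrite {}NG1 {}NG2 in Gt ubt neart gapt.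
set M := running_max y s in Gs ubs nears gaps *.
set G := last_max_epoch y s in Gs nears gaps *.
set M' := running_max (shift_path s y) t in ubt neart gapt *.
set G' := last_max_epoch (shift_path s y) t in Gt neart gapt *.
have shiftE u : shift_path s y u = y (s + u) - y s by exact: shift_pathE.
move: Gs Gt => /andP[G0 Gs] /andP[G'0 G't].
have ubt' r : s <= r <= s + t -> y r <= y s + M'.
  move=> /andP[sr rt]; have /ubt : 0 <= r - s <= t by apply/andP; split; lra.
  by rewrite shiftE subrKC; lra.
have [pos|neg] := leP 0 (y s - M + M').
- have -> : max_pair s y + (gap_pair s y + max_pair t (shift_path s y)) =
      (y s + M', s + G') :> R * R.
    rewrite /max_pair /gap_pair -/M -/G -/M' -/G'.
    by congr (_, _) => /=; ring.
  apply: max_pairE; split.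
  + by apply/andP; split; lra.
  + move=> r /andP[r0 rt]; have [rs|sr] := leP r s.
      have : y r <= M by apply: ubs; rewrite r0.
      lra.
    by apply: ubt'; rewrite ltW.
  + move=> d e d0 e0; have [u [/andP[u0 ut] ud]] := neart d e d0 e0.
    rewrite shiftE => yu; exists (s + u); split.
    * by apply/andP; split; lra.
    * by rewrite opprD addrACA subrr add0r.
    * lra.
  + move=> d d0; have [e e0 h] := gapt d d0; exists e => // r /andP[Gr rt].
    have : shift_path s y (r - s) <= M' - e by apply: h; apply/andP; split; lra.
    by rewrite shiftE subrKC; lra.
- rewrite addr0 /max_pair -/M -/G; apply: max_pairE; split.
  + by apply/andP; split; lra.
  + move=> r /andP[r0 rt]; have [rs|sr] := leP r s.
      by apply: ubs; rewrite r0.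
    have : y r <= y s + M' by apply: ubt'; rewrite ltW.
    lra.
  + move=> d e d0 e0; have [u [/andP[u0 ut] ud yu]] := nears d e d0 e0.
    by exists u; split => //; apply/andP; split; lra.
  + move=> d d0; have [e e0 h] := gaps d d0.
    exists (Num.min e (M - (y s + M'))); first by rewrite lt_min e0 /=; lra.
    move=> r /andP[Gr rt]; have [rs|sr] := leP r s.
      have : y r <= M - e by apply: h; rewrite Gr.
      have : Num.min e (M - (y s + M')) <= e by rewrite ge_min lexx.
      lra.
    have : y r <= y s + M' by apply: ubt'; rewrite ltW.
    have : Num.min e (M - (y s + M')) <= M - (y s + M') by rewrite ge_min lexx orbT.
    lra.
Qed.

End max_pair.

Section last_argmax.
Context {R : realType}.
Implicit Types x : nat -> R.

Fixpoint last_argmax x n : nat :=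
  if n is n'.+1 then if x (last_argmax x n') <= x n then n else last_argmax x n'
  else 0%N.

Definition is_last_argmax x n k : Prop :=
  [/\ (k <= n)%N, forall j, (j <= n)%N -> x j <= x k &
      forall j, (k < j <= n)%N -> x j < x k].

Lemma last_argmaxP x n : is_last_argmax x n (last_argmax x n).
Proof.
elim: n => [|n [kn ub lt]] /=.
  split=> // j; first by rewrite leqn0 => /eqP->.
  by case: j.
case: leP => [le|gt]; split => //.
- move=> j; rewrite leq_eqVlt => /predU1P[->//|]; rewrite ltnS => /ub h.
  exact: le_trans h le.
- by move=> j /andP[nj jn]; have := leq_trans nj jn; rewrite ltnn.
- exact: leqW.
- by move=> j; rewrite leq_eqVlt => /predU1P[->|]; [exact: ltW|exact: ub].
- move=> j /andP[kj]; rewrite leq_eqVlt => /predU1P[->//|]; rewrite ltnS => jn.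
  by apply: lt; rewrite kj.
Qed.

Lemma is_last_argmax_unique x n k : is_last_argmax x n k -> last_argmax x n = k.
Proof.
move=> [kn ub lt]; have [kn' ub' lt'] := last_argmaxP x n.
apply/eqP; rewrite eqn_leq; apply/andP; split; rewrite leqNgt; apply/negP => h.
- by have := lt (last_argmax x n); rewrite h kn' => /(_ erefl); rewrite ltNge ub'.
- by have := lt' k; rewrite h kn => /(_ erefl); rewrite ltNge ub.
Qed.

End last_argmax.

Section discretisation.
Context {R : realType}.
Implicit Types (y : @cadlag_path R) (t h eps : R).

(** The slope eps breaks near-ties between sampled values in favour of the
latest one. *)
Definition tilted_walk eps h y (k : nat) : R := y (k%:R * h) + eps * (k%:R * h).

Definition walk_max_pair eps h y (n : nat) : R * R :=
  let k := last_argmax (tilted_walk eps h y) n in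
  (tilted_walk eps h y k, k%:R * h).

Definition walk_gap_pair eps h y (n : nat) : R * R :=
  let k := last_argmax (tilted_walk eps h y) n in
  (tilted_walk eps h y n - tilted_walk eps h y k, n%:R * h - k%:R * h).

Lemma right_nbhsP y t (e : R) : 0 <= t -> 0 < e ->
  exists2 r : R, 0 < r & forall s, t < s < t + r -> `|y s - y t| < e.
Proof.
move=> t0 e0; have [yr _] := path_cadlag y.
have /cvgrPdist_lt/(_ _ e0)[r /= r0 rP] := yr t t0.
exists r => // s /andP[ts st]; rewrite distrC; apply: rP => //=.
by rewrite ltr_distlC; apply/andP; split; lra.
Qed.

(** Here u and u0 are times of the sampled walk, whose values are
y(u + h) - y(h) + eps u. The sample at u0 is taken close to the last
maximum (M, G), within kp in height. If u were the argmax and lay before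
G - d, the slope would give u0 an advantage of more than eps d / 4, which
exceeds kp. If it lay after G + d, its height would be below M by the margin e,
which the total tilt, at most e / 4, cannot compensate. *)
Lemma tilted_argmax_estimate (M G t d e kp eps h yh yt y0 yK u0 u : R) :
  0 < h < d / 2 -> 0 <= eps -> e <= d -> 0 <= u <= t -> 0 <= u0 -> G <= t ->
  eps * u <= e / 4 -> `|yh| < e / 8 -> kp <= e / 8 -> kp <= eps * d / 4 ->
  M - kp < y0 -> G - d / 4 < u0 + h -> y0 - yh + eps * u0 <= yK - yh + eps * u ->
  yt <= M -> (G + d <= t -> yt <= M - e) ->
  (u + h <= t -> yK <= M) -> (t < u + h -> yK < yt + e / 4) ->
  (G + d <= u + h <= t -> yK <= M - e) ->
  `|M - (yK - yh + eps * u)| <= d /\ `|G - u| <= d.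
Proof.
move=> /andP[h0 hd] eps0 ed /andP[u_ge0 ut] u00 Gt epsu; rewrite ltr_norml => /andP[yh1 yh2].
move=> kpe kpd yk0 Gu0 argmax ytM ytG yKM yKt yKG.
have epsu0 : 0 <= eps * u by rewrite mulr_ge0.
have epsu00 : 0 <= eps * u0 by rewrite mulr_ge0.
have yK4 : yK <= M + e / 4.
  have [le|lt] := leP (u + h) t; first by move: (yKM le) yh1 yh2; clear; lra.
  by move: (yKt lt) ytM; clear; lra.
split; rewrite ler_distlC; apply/andP; split.
- by move: argmax epsu00 yk0 kpe yh1 yh2 ed; clear; lra.
- by move: yK4 epsu yh1 yh2 ed; clear; lra.
- rewrite leNgt; apply/negP => uG.
  have {}yKM : yK <= M by apply: yKM; move: uG hd Gt h0; clear; lra.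
  have : eps * (d / 4) <= eps * (u0 - u).
    by apply: ler_wpM2l => //; move: uG Gu0 hd; clear; lra.
  by rewrite mulrBr mulrA; move: yKM argmax yk0 kpd; clear; lra.
- rewrite leNgt; apply/negP => Gu.
  have : yK <= M - e / 2 - e / 4.
    have [le|lt] := leP (u + h) t.
      have : yK <= M - e by apply: yKG; apply/andP; split; move: Gu h0 le; clear; lra.
      by move: yh1 yh2; clear; lra.
    have : yt <= M - e by apply: ytG; move: Gu ut; clear; lra.
    by move: (yKt lt); clear; lra.
  by move: argmax epsu epsu00 yk0 kpe yh1 yh2; clear; lra.
Qed.

(** The slope is chosen first, small with respect to the margin after the
last maximum, and the step afterwards, small with respect to the slope. The
walk starts at time h, so that its points k h + h reach beyond t: a maximum
approached only at t is then still seen from its right side. *)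
Lemma walk_max_near t y (d : R) : 0 <= t -> 0 < d ->
  \forall j \near \oo, \forall n \near \oo,
    let p := walk_max_pair (mesh j) (mesh n) (shift_path (mesh n) y) (Num.truncn (t / mesh n)) in
    `|running_max y t - p.1| <= d /\ `|last_max_epoch y t - p.2| <= d.
Proof.
move=> t0 d0; have := max_pairP y t0.
rewrite /max_pair /=; set M := running_max y t; set G := last_max_epoch y t.
move=> [/andP[G0 Gt] ub near gap].
have [e' e'0 gape'] := gap d d0.
pose e := Num.min e' d.
have e0 : 0 < e by rewrite lt_min e'0.
have ed : e <= d by rewrite ge_min lexx orbT.
have gape s : G + d <= s <= t -> y s <= M - e.
  have : e <= e' by rewrite ge_min lexx.
  by move=> ee' /gape'; move: ee'; clear; lra.
have t1 : 0 < t + 1 by rewrite ltr_wpDl.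
have e4 : 0 < e / (4 * (t + 1)) by rewrite divr_gt0// mulr_gt0.
apply: filterS (mesh_lt_near e4) => j; rewrite ltr_pdivlMr ?mulr_gt0//.
have := @mesh_gt0 R j; move: (mesh j) => eps eps0 epst.
pose kp := Num.min (eps * d / 4) (e / 8).
have kp0 : 0 < kp by rewrite lt_min !divr_gt0// mulr_gt0.
have kpd : kp <= eps * d / 4 by rewrite ge_min lexx.
have kpe : kp <= e / 8 by rewrite ge_min lexx orbT.
have [d4 kp2 e8 e4' d2] : [/\ 0 < d / 4, 0 < kp / 2, 0 < e / 8, 0 < e / 4 & 0 < d / 2].
  by rewrite !divr_gt0.
(* s0 is close to the last maximum; the sample just on its right is compared with the argmax *)
have [s0 [/andP[s00 s0t] sG ys0]] := near (d / 4) (kp / 2) d4 kp2.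
have [r1 r10 r1P] := right_nbhsP y s00 kp2.
have [r2 r20 r2P] := right_nbhsP y t0 e4'.
have [r3 r30 r3P] := right_nbhsP y (lexx 0) e8.
apply: filterS (filterI (filterI (mesh_lt_near r10) (mesh_lt_near r20))
  (filterI (mesh_lt_near r30) (mesh_lt_near d2))) => n /= [].
have := @mesh_gt0 R n; move: (mesh n) => h h0 [hr1 hr2] [hr3 hd].
set x := tilted_walk eps h (shift_path h y); set N := Num.truncn (t / h) => /=.
have [KN ubK _] := last_argmaxP x N; move: ubK KN; set K := last_argmax x N => ubK KN.
have xE k : x k = y (k%:R * h + h) - y h + eps * (k%:R * h).
  by rewrite /x /tilted_walk shift_pathE 1?ltW// [h + _]addrC.
have grid0 k : 0 <= k%:R * h by rewrite mulr_ge0// ltW.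
have /andP[gN1] := truncn_grid h0 t0; rewrite -/N -[N.+1]addn1 natrD mulrDl mul1r => gN2.
have grid_le k : (k <= N)%N -> k%:R * h <= t.
  by move=> kN; apply: le_trans gN1; rewrite ler_wpM2r ?ler_nat// ltW.
have /andP[gk1] := truncn_grid h0 s00; set k0 := Num.truncn (s0 / h) in gk1 *.
rewrite -[k0.+1]addn1 natrD mulrDl mul1r => gk2.
have k0N : (k0 <= N)%N.
  by apply: le_truncn; rewrite ler_wpM2r// invr_ge0 ltW.
have Kt := grid_le K KN; have K0 := grid0 K.
rewrite !xE; apply: (@tilted_argmax_estimate M G t d e kp eps h (y h) (y t)
  (y (k0%:R * h + h)) (y (K%:R * h + h)) (k0%:R * h)) => //.
- by rewrite h0.
- exact: ltW.
- by rewrite K0.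
- have : eps * (K%:R * h) <= eps * (t + 1).
    by rewrite ler_pM2l//; move: Kt; clear; lra.
  by move: epst; rewrite mulrCA; clear; lra.
- by have := r3P h; rewrite path_start subr0; apply; rewrite add0r h0.
- have : `|y (k0%:R * h + h) - y s0| < kp / 2.
    by apply: r1P; rewrite gk2/=; move: gk1 hr1; clear; lra.
  by move: ys0; rewrite ltr_distl => ys0 /andP[+ _]; move: ys0; clear; lra.
- by move: sG gk2; rewrite ltr_distl => /andP[+ _]; clear; lra.
- by have := ubK k0 k0N; rewrite !xE.
- by apply: ub; rewrite t0 lexx.
- by move=> Gdt; apply: gape; rewrite Gdt lexx.
- by move=> le; apply: ub; rewrite le addr_ge0// ltW.
- move=> lt; have : `|y (K%:R * h + h) - y t| < e / 4.
    by apply: r2P; rewrite lt/=; move: Kt hr2; clear; lra.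
  by rewrite ltr_distl => /andP[].
- exact: gape.
Qed.

End discretisation.

Section discretisation_limits.
Context {R : realType}.
Implicit Types (y : @cadlag_path R) (t : R) (p : nat * nat).

Definition disc_max p t y : R * R :=
  walk_max_pair (mesh p.1) (mesh p.2) (shift_path (mesh p.2) y) (Num.truncn (t / mesh p.2)).

Definition disc_gap p t y : R * R :=
  walk_gap_pair (mesh p.1) (mesh p.2) (shift_path (mesh p.2) y) (Num.truncn (t / mesh p.2)).

Lemma disc_max_cvg t y : 0 <= t ->
  ((disc_max p t y).1 @[p --> iter_oo] --> running_max y t) /\
  ((disc_max p t y).2 @[p --> iter_oo] --> last_max_epoch y t).
Proof.
by move=> t0; split; apply/cvgrPdist_le => e e0; have := walk_max_near y t0 e0;
  apply: filterS => j; apply: filterS => n [].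
Qed.

(** The tilt contributes at most eps (t + 1), and the sample at the end is
taken less than h on the right of t. *)
Lemma disc_last_cvg t y : 0 <= t ->
  (tilted_walk (mesh p.1) (mesh p.2) (shift_path (mesh p.2) y)
    (Num.truncn (t / mesh p.2)) @[p --> iter_oo] --> y t) /\
  ((Num.truncn (t / mesh p.2))%:R * mesh p.2 @[p --> iter_oo] --> t).
Proof.
move=> t0; split; apply/cvgrPdist_le => e e0.
  have e3 : 0 < e / 3 by rewrite divr_gt0.
  have et : 0 < e / (3 * (t + 1)) by rewrite divr_gt0// mulr_gt0//; lra.
  apply: filterS (mesh_lt_near et) => j; rewrite ltr_pdivlMr; last by rewrite mulr_gt0//; lra.
  have := @mesh_gt0 R j; move: (mesh j) => eps eps0 epst.
  have [r1 r10 r1P] := right_nbhsP y t0 e3.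
  have [r2 r20 r2P] := right_nbhsP y (lexx 0) e3.
  apply: filterS (filterI (mesh_lt_near r10) (mesh_lt_near r20)) => n /= [].
  have := @mesh_gt0 R n; move: (mesh n) => h h0 hr1 hr2.
  have /andP[] := truncn_grid h0 t0.
  set N := Num.truncn _; rewrite -[N.+1]addn1 natrD mulrDl mul1r => N1 N2.
  have : `|y h| < e / 3.
    by have := r2P h; rewrite path_start subr0; apply; rewrite add0r h0.
  have : `|y (N%:R * h + h) - y t| < e / 3.
    by apply: r1P; rewrite N2/=; lra.
  rewrite /tilted_walk (shift_pathE _ _ (ltW h0)) [h + _]addrC.
  have : 0 <= eps * (N%:R * h) by rewrite !mulr_ge0// ltW.
  have : eps * (N%:R * h) <= eps * (t + 1) by rewrite ler_pM2l//; lra.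
  have : eps * (t + 1) * 3 < e by rewrite -mulrA [_ * 3]mulrC.
  rewrite !ltr_norml ler_norml => ? ? ? /andP[? ?] /andP[? ?].
  by apply/andP; split; lra.
suff H : \forall n \near \oo, `|t - (Num.truncn (t / mesh n))%:R * mesh n| <= e.
  have H2 : \forall j \near (\oo : set_system nat), \forall n \near \oo,
    `|t - (Num.truncn (t / mesh n))%:R * mesh n| <= e by exact: nearW.
  exact: H2.
apply: filterS (mesh_lt_near e0) => n /=.
have := @mesh_gt0 R n; move: (mesh n) => h h0 he.
have /andP[] := truncn_grid h0 t0.
set N := Num.truncn _; rewrite -[N.+1]addn1 natrD mulrDl mul1r => N1 N2.
by rewrite ler_norml; apply/andP; split; lra.
Qed.

Lemma continuous_disc_max (f : R * R -> R) t y : continuous f -> 0 <= t ->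
  f (disc_max p t y) @[p --> iter_oo] --> f (max_pair t y).
Proof.
move=> cf t0; have [c1 c2] := disc_max_cvg y t0.
have c : disc_max p t y @[p --> iter_oo] --> max_pair t y by exact: cvg_pair c1 c2.
by apply: (cvg_comp (fun p => disc_max p t y) f c); exact: cf.
Qed.

Lemma continuous_disc_gap (f : R * R -> R) t y : continuous f -> 0 <= t ->
  f (disc_gap p t y) @[p --> iter_oo] --> f (gap_pair t y).
Proof.
move=> cf t0; have [c1 c2] := disc_max_cvg y t0.
have [l1 l2] := disc_last_cvg y t0.
have d1 : (disc_gap p t y).1 @[p --> iter_oo] --> y t - running_max y t.
  exact: cvgB l1 c1.
have d2 : (disc_gap p t y).2 @[p --> iter_oo] --> t - last_max_epoch y t.
  exact: cvgB l2 c2.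
have c : disc_gap p t y @[p --> iter_oo] --> gap_pair t y by exact: cvg_pair d1 d2.
by apply: (cvg_comp (fun p => disc_gap p t y) f c); exact: cf.
Qed.

End discretisation_limits.

Section measurability.
Context {R : realType} d (T : measurableType d).
Implicit Types (Z : T -> @cadlag_path R) (t : T -> R).

Lemma measurable_tilted_walk eps h Z k : 0 < h -> measurable_fun setT Z ->
  measurable_fun setT (fun w => tilted_walk eps h (Z w) k).
Proof.
move=> h0 mZ; apply: measurable_funD => //; apply: measurable_path_time => //.
by move=> w; rewrite mulr_ge0// ltW.
Qed.

Lemma measurable_last_argmax (x : T -> nat -> R) n k :
  (forall j, measurable_fun setT (fun w => x w j)) ->
  measurable [set w | last_argmax (x w) n = k].
Proof.
move=> mx; elim: n k => [|n ih] k /=.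
  have [->|k0] := eqVneq k 0%N; first by rewrite (_ : [set w | _] = setT)//; apply/seteqP.
  rewrite (_ : [set w | _] = set0)//; apply/seteqP; split => // w /= e.
  by rewrite -e eqxx in k0.
pose C := [set w | x w (last_argmax (x w) n) <= x w n.+1].
have mC : measurable C.
  have mf : measurable_fun setT (fun w => x w (last_argmax (x w) n)).
    exact: (measurable_fun_nat_index (k := fun w => last_argmax (x w) n)
      (f := fun j w => x w j)).
  have := measurable_fun_ler mf (mx n.+1).
  move=> /(_ measurableT [set true]); rewrite setTI; exact.
rewrite (_ : [set w | _] = (C `&` [set w | n.+1 = k]) `|`
    (~` C `&` [set w | last_argmax (x w) n = k])).
  apply: measurableU; apply: measurableI => //; last exact: measurableC.
  have [e|ne] := pselect (n.+1 = k).
    have -> : [set w : T | n.+1 = k] = setT by apply/seteqP; split.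
    exact: measurableT.
  have -> : [set w : T | n.+1 = k] = set0 by apply/seteqP; split.
  exact: measurable0.
apply/seteqP; split => w; rewrite /C /=.
  by case: ifPn => [le e|/negP nle e]; [left|right].
by case=> [[-> //]|[/negP/negbTE -> //]].
Qed.

Lemma measurable_walk_max_pair eps h Z n : 0 < h -> measurable_fun setT Z ->
  measurable_fun setT (fun w => walk_max_pair eps h (Z w) n).
Proof.
move=> h0 mZ; have mx j := measurable_tilted_walk eps j h0 mZ.
apply: (measurable_fun_nat_index (k := fun w => last_argmax (tilted_walk eps h (Z w)) n)
  (f := fun k w => (tilted_walk eps h (Z w) k, k%:R * h))).
- by move=> k; exact: (measurable_last_argmax _ _ mx).
- by move=> k; apply: measurable_fun_pair.
Qed.

Lemma measurable_walk_gap_pair eps h Z n : 0 < h -> measurable_fun setT Z ->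
  measurable_fun setT (fun w => walk_gap_pair eps h (Z w) n).
Proof.
move=> h0 mZ; have mx j := measurable_tilted_walk eps j h0 mZ.
apply: (measurable_fun_nat_index (k := fun w => last_argmax (tilted_walk eps h (Z w)) n)
  (f := fun k w => (tilted_walk eps h (Z w) n - tilted_walk eps h (Z w) k,
     n%:R * h - k%:R * h))).
- by move=> k; exact: (measurable_last_argmax _ _ mx).
- by move=> k; apply: measurable_fun_pair => //; exact: measurable_funB.
Qed.

Lemma measurable_truncn_grid t h n : measurable_fun setT t ->
  measurable [set w | Num.truncn (t w / h) = n].
Proof. by move=> mt; apply: measurable_truncn_eq; exact: measurable_funM. Qed.

Lemma measurable_disc_max p t Z : measurable_fun setT t -> measurable_fun setT Z ->
  measurable_fun setT (fun w => disc_max p (t w) (Z w)).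
Proof.
move=> mt mZ; have h0 := @mesh_gt0 R p.2.
have ms : measurable_fun setT (fun w => shift_path (mesh p.2) (Z w)).
  exact: measurable_shift_path.
exact: (measurable_fun_nat_index (fun n => measurable_truncn_grid (mesh p.2) n mt)
  (fun n => measurable_walk_max_pair (mesh p.1) n h0 ms)).
Qed.

Lemma measurable_disc_gap p t Z : measurable_fun setT t -> measurable_fun setT Z ->
  measurable_fun setT (fun w => disc_gap p (t w) (Z w)).
Proof.
move=> mt mZ; have h0 := @mesh_gt0 R p.2.
have ms : measurable_fun setT (fun w => shift_path (mesh p.2) (Z w)).
  exact: measurable_shift_path.
exact: (measurable_fun_nat_index (fun n => measurable_truncn_grid (mesh p.2) n mt)
  (fun n => measurable_walk_gap_pair (mesh p.1) n h0 ms)).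
Qed.

(** The last epoch of the maximum is not a supremum over countably many times;
its measurability is inherited from the discretisations that converge to
it. *)
Lemma measurable_max_pair t Z : measurable_fun setT t -> measurable_fun setT Z ->
  (forall w, 0 <= t w) -> measurable_fun setT (fun w => max_pair (t w) (Z w)).
Proof.
move=> mt mZ t0; apply: measurable_fun_pair.
  apply: (measurable_fun_iter_oo (f := fun p w => (disc_max p (t w) (Z w)).1)).
    by move=> p; exact: (measurableT_comp measurable_fst (measurable_disc_max p mt mZ)).
  by move=> w; have [] := disc_max_cvg (Z w) (t0 w).
apply: (measurable_fun_iter_oo (f := fun p w => (disc_max p (t w) (Z w)).2)).
  by move=> p; exact: (measurableT_comp measurable_snd (measurable_disc_max p mt mZ)).
by move=> w; have [] := disc_max_cvg (Z w) (t0 w).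
Qed.

Lemma measurable_gap_pair t Z : measurable_fun setT t -> measurable_fun setT Z ->
  (forall w, 0 <= t w) -> measurable_fun setT (fun w => gap_pair (t w) (Z w)).
Proof.
move=> mt mZ t0; have mm := measurable_max_pair mt mZ t0.
apply: measurable_fun_pair; apply: measurable_funB.
- exact: measurable_path_time.
- exact: (measurableT_comp measurable_fst mm).
- by [].
- exact: (measurableT_comp measurable_snd mm).
Qed.

End measurability.

(** * Independent sequences of real random variables *)

Section real_sequences.
Context {R : realType}.

Definition rseq := nat -> R.

HB.instance Definition _ := Pointed.on rseq.

Definition seq_cylinder n (A : nat -> set R) : set rseq :=
  [set x | forall k, (k < n)%N -> A k (x k)].

Definition seq_cylinders : set (set rseq) :=
  [set C | exists n A, (forall k, measurable (A k)) /\ C = seq_cylinder n A].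

Let seq_measurable0 : <<s seq_cylinders >> set0.
Proof. exact: sigma_algebra0. Qed.
Let seq_measurableC (A : set rseq) : <<s seq_cylinders >> A -> <<s seq_cylinders >> (~` A).
Proof. exact: sigma_algebraC. Qed.
Let seq_measurable_bigcup (F : (set rseq)^nat) :
  (forall i, <<s seq_cylinders >> (F i)) -> <<s seq_cylinders >> (\bigcup_i F i).
Proof. exact: sigma_algebra_bigcup. Qed.

HB.instance Definition _ := @isMeasurable.Build (sigma_display seq_cylinders)
  rseq <<s seq_cylinders >> seq_measurable0 seq_measurableC seq_measurable_bigcup.

Lemma setI_closed_seq_cylinders : setI_closed seq_cylinders.
Proof.
move=> _ _ [n [A [mA ->]]] [m [B [mB ->]]].
exists (maxn n m), (fun k => (if (k < n)%N then A k else setT) `&`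
  (if (k < m)%N then B k else setT)); split.
  by move=> k; apply: measurableI; case: ifP.
apply/seteqP; split => x /=.
  by move=> [xA xB] k _; split; case: ifP => // ?; [exact: xA|exact: xB].
move=> H; split=> k kn.
- by have [+ _] := H k (leq_trans kn (leq_maxl _ _)); rewrite kn.
- by have [_ +] := H k (leq_trans kn (leq_maxr _ _)); rewrite kn.
Qed.

Lemma measurable_fun_rseq d (T : measurableType d) (f : T -> rseq) :
  (forall k, measurable_fun setT (fun w => f w k)) -> measurable_fun setT f.
Proof.
move=> mf; apply: (@measurability _ _ _ _ _ _ seq_cylinders) => //.
move=> _ [_ [n [A [mA ->]]] <-]; rewrite setTI.
rewrite (_ : _ @^-1` _ = \bigcap_(k in setT)
  (if (k < n)%N then (fun w => f w k) @^-1` A k else setT)).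
  apply: bigcapT_measurable => k; case: ifP => // _.
  exact: preimage_measurable.
apply/seteqP; split => w /= H k.
- by move=> _; case: ifP => // kn; exact: H.
- by move=> kn; have := H k I; rewrite kn.
Qed.

Lemma measurable_rseq_eval k : measurable_fun setT (fun x : rseq => x k).
Proof.
move=> _ B mB; rewrite setTI; apply: sub_sigma_algebra.
exists k.+1, (fun j => if j == k then B else setT); split.
  by move=> j; case: ifP.
apply/seteqP; split => x /=.
- by move=> xB j _; case: eqP => // ->.
- by move=> /(_ k (ltnSn k)); rewrite eqxx.
Qed.

Definition partial_sums (x : rseq) : rseq := fun k => \sum_(j < k) x j.

Lemma measurable_partial_sums : measurable_fun setT partial_sums.
Proof.
apply: measurable_fun_rseq => k; rewrite /partial_sums.
elim: k => [|k ih]; first by under eq_fun do rewrite big_ord0; exact: measurable_cst.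
under eq_fun do rewrite big_ord_recr; apply: measurable_funD => //.
exact: measurable_rseq_eval.
Qed.

Definition head_rseq m (x : rseq) : rseq := fun k => if (k < m)%N then x k else 0.
Definition tail_rseq m (x : rseq) : rseq := fun k => x (m + k)%N.

End real_sequences.
Arguments rseq : clear implicits.

Section independent_sequences.
Local Open Scope ereal_scope.
Context {R : realType} d (T : measurableType d) (P : probability T R).
Implicit Types (X : nat -> T -> R).

(** Finitely many initial terms are enough, because unconstrained terms can be
given the whole line. *)
Definition indep_seq X : Prop :=
  forall n (A : nat -> set R), (forall k, measurable (A k)) ->
    P [set w | forall k, (k < n)%N -> A k (X k w)] =
    (\prod_(k < n) fine (P (X k @^-1` A k)))%:E.

Definition rseq_of X (w : T) : rseq R := fun k => X k w.

Lemma indep_seq_eq_law X X' : (forall k, measurable_fun setT (X k)) ->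
  (forall k, measurable_fun setT (X' k)) -> indep_seq X -> indep_seq X' ->
  (forall k A, measurable A -> P (X k @^-1` A) = P (X' k @^-1` A)) ->
  eq_law P (rseq_of X) P (rseq_of X').
Proof.
move=> mX mX' iX iX' e.
apply: (@eq_law_pi_system _ _ _ _ _ _ _ seq_cylinders) => //.
- exact: setI_closed_seq_cylinders.
- exact: measurable_fun_rseq.
- exact: measurable_fun_rseq.
- move=> _ [n [A [mA ->]]].
  apply: (etrans (iX n A mA)); apply/esym; apply: (etrans (iX' n A mA)).
  by congr EFin; apply: eq_bigr => k _; rewrite e.
Qed.

Lemma indep_seq_shift X m : indep_seq X -> indep_seq (fun k => X (m + k)%N).
Proof.
move=> iX n A mA.
have := iX (m + n)%N (fun j => if (j < m)%N then setT else A (j - m)%N).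
rewrite big_split_ord/= big1 ?mul1r => [h|j _]; last first.
  by rewrite ltn_ord preimage_setT probability_setT.
have -> : [set w | forall k, (k < n)%N -> A k (X (m + k)%N w)] =
    [set w | forall k, (k < m + n)%N ->
      (if (k < m)%N then setT else A (k - m)%N) (X k w)].
  apply/seteqP; split => w /= H k kn.
    case: ltnP => // mk; have := H (k - m)%N; rewrite subnKC//; apply.
    by rewrite ltn_subLR.
  by have := H (m + k)%N; rewrite ltn_add2l [(m + k < m)%N]ltnNge leq_addr/= addKn; apply.
rewrite h => [|k]; last by case: ifP.
by congr EFin; apply: eq_bigr => k _; rewrite [(m + k < m)%N]ltnNge leq_addr/= addKn.
Qed.

(** The zeros that fill the head only matter when the cylinder constrains
them: if one of these constraints excludes 0, both sides are null. *)
Lemma indep_seq_split X m : (forall k, measurable_fun setT (X k)) -> indep_seq X ->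
  indep_rv P (fun w => head_rseq m (rseq_of X w)) (fun w => tail_rseq m (rseq_of X w)).
Proof.
move=> mX iX.
apply: (@indep_rv_pi_system _ _ _ _ _ _ _ _ seq_cylinders seq_cylinders) => //.
- exact: setI_closed_seq_cylinders.
- exact: setI_closed_seq_cylinders.
- apply: measurable_fun_rseq => k; rewrite /head_rseq.
  by case: (k < m)%N; [exact: mX|exact: measurable_cst].
- by apply: measurable_fun_rseq => k; exact: mX.
move=> _ _ [n [A [mA ->]]] [n' [B [mB ->]]].
(* the constraints on the entries of the head that have been set to 0 *)
have [H|H] := pselect (forall k, (m <= k < n)%N -> A k 0%R); last first.
  rewrite (_ : _ @^-1` seq_cylinder n A = set0) ?set0I ?measure0 ?mul0e//.
  apply/seteqP; split => // w HA; apply: H => k /andP[mk kn].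
  by have := HA k kn; rewrite /head_rseq ltnNge mk.
pose C k := if (k < m)%N then (if (k < n)%N then A k else setT) else B (k - m)%N.
have mC k : measurable (C k) by rewrite /C; case: ifP => // _; case: ifP.
have mid : P ((fun w => head_rseq m (rseq_of X w)) @^-1` seq_cylinder n A) =
    (\prod_(k < m) fine (P (X k @^-1` C k)))%:E.
  rewrite -iX//; congr (P _); apply/seteqP; split => w /= HA k.
  - move=> km; rewrite /C km; case: ifP => // kn.
    by have := HA k kn; rewrite /head_rseq km.
  - move=> kn; rewrite /head_rseq; case: ifP => km.
      by have := HA k km; rewrite /C km kn.
    by apply: H; rewrite leqNgt km.
have right : P ((fun w => tail_rseq m (rseq_of X w)) @^-1` seq_cylinder n' B) =
    (\prod_(k < n') fine (P (X (m + k)%N @^-1` B k)))%:E.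
  exact: (indep_seq_shift m iX n' mB).
rewrite mid right -EFinM.
have := iX (m + n')%N C mC; rewrite big_split_ord/=.
have -> : (\prod_(k < n') fine (P (X (m + k)%N @^-1` C (m + k)%N)) =
    \prod_(k < n') fine (P (X (m + k)%N @^-1` B k)))%R.
  by apply: eq_bigr => k _; rewrite /C ltnNge leq_addr/= addKn.
move=> <-; congr (P _); apply/seteqP; split => w /=.
- move=> [HA HB] k kmn; rewrite /C; case: ifP => km.
    by case: ifP => // kn; have := HA k kn; rewrite /head_rseq km.
  move/negbT : km; rewrite -leqNgt => mk.
  have := HB (k - m)%N; rewrite /tail_rseq subnKC//; apply.
  by rewrite ltn_subLR.
- move=> HC; split=> k kn.
  + rewrite /head_rseq; case: ifP => km; last by apply: H; rewrite leqNgt km.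
    by have := HC k (ltn_addr _ km); rewrite /C km kn.
  + have := HC (m + k)%N; rewrite ltn_add2l kn => /(_ erefl).
    by rewrite /C ltnNge leq_addr/= addKn.
Qed.

Lemma independent_systems_indep_seq X : (forall n,
    independent_systems P (fun k : 'I_n => sigma_rv (X k))) -> indep_seq X.
Proof.
move=> iX n A mA.
have := iX n [fset k | k in 'I_n]%fset (fun k : 'I_n => X k @^-1` A k).
rewrite big_imfset//=.
rewrite big_enum/= => <-; last first.
  by move=> k _; exists (A k) => //; rewrite setTI.
congr (P _); apply/seteqP; split => w /= HA.
- by move=> k _; exact: HA.
- by move=> k kn; have := HA (Ordinal kn); apply; apply/imfsetP; exists (Ordinal kn).
Qed.

Lemma independent_systems_nat_indep_seq X :
  independent_systems P (fun k => sigma_rv (X k)) -> indep_seq X.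
Proof.
move=> iX n A mA.
have := iX [fset nat_of_ord k | k in 'I_n]%fset (fun k => X k @^-1` A k).
rewrite big_imfset/=; last by move=> i j _ _; exact: val_inj.
rewrite big_enum/= => <-; last first.
  by move=> k _; exists (A k) => //; rewrite setTI.
congr (P _); apply/seteqP; split => w /= HA k.
- by move=> /imfsetP[j _ ->]; exact: HA.
- by move=> kn; have := HA k; apply; apply/imfsetP; exists (Ordinal kn).
Qed.

End independent_sequences.

(** * Observation of a path on a grid *)

Section path_grid.
Context {R : realType}.

Definition grid (h : R) (y : @cadlag_path R) : rseq R := fun k => y (k%:R * h).

Definition path_increment (h : R) (y : @cadlag_path R) : rseq R :=
  fun k => y (k.+1%:R * h) - y (k%:R * h).

Lemma measurable_grid h : 0 < h -> measurable_fun setT (grid h).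
Proof.
move=> h0; apply: measurable_fun_rseq => k; apply: measurable_path_eval.
by rewrite mulr_ge0// ltW.
Qed.

Lemma gridE h y : grid h y = partial_sums (path_increment h y).
Proof.
apply/funext => k; rewrite /partial_sums /path_increment.
elim: k => [|k ih]; first by rewrite big_ord0 /grid mul0r path_start.
by rewrite big_ord_recr/= -ih /grid addrC subrK.
Qed.

(** On a grid, stopping a path and shifting it keep, respectively, the head and
the tail of its sequence of increments. This reduces the Markov property to
the independence of increments. *)
Lemma grid_stopE h m y : 0 < h ->
  grid h (stop_path (m%:R * h) y) = partial_sums (head_rseq m (path_increment h y)).
Proof.
move=> h0; have mh : 0 <= m%:R * h by rewrite mulr_ge0// ltW.
rewrite gridE; congr partial_sums; apply/funext => k.
rewrite /head_rseq /path_increment /=; rewrite (max_l mh).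
case: ltnP => km; last first.
  by rewrite !min_r ?subrr// ler_pM2r// ler_nat// leqW.
by rewrite !min_l// ler_pM2r// ler_nat// ltnW.
Qed.

Lemma grid_shiftE h m y : 0 < h ->
  grid h (shift_path (m%:R * h) y) = partial_sums (tail_rseq m (path_increment h y)).
Proof.
move=> h0; have mh : 0 <= m%:R * h by rewrite mulr_ge0// ltW.
rewrite gridE; congr partial_sums; apply/funext => k.
rewrite /tail_rseq /path_increment !shift_pathE// -!mulrDl -!natrD addnS.
by rewrite opprB addrA subrK.
Qed.

Definition grid_sets (c : R) : set (set (@cadlag_path R)) :=
  [set A | exists n B, measurable B /\ A = grid (c * mesh n) @^-1` B].

Definition subsequence_rseq m (x : rseq R) : rseq R := fun k => x (k * m)%N.

Lemma measurable_subsequence_rseq m : measurable_fun setT (subsequence_rseq m).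
Proof. by apply: measurable_fun_rseq => k; exact: measurable_rseq_eval. Qed.

Lemma grid_refine c n m : grid (c * mesh n) =
  subsequence_rseq m.+1 \o grid (c * mesh (n.+1 * m.+1).-1).
Proof.
have e : (n.+1 * m.+1).-1.+1 = (n.+1 * m.+1)%N by rewrite prednK.
apply/funext => y; apply/funext => k.
rewrite /comp /subsequence_rseq /grid /mesh e !natrM; congr (y _).
have n0 : n.+1%:R != 0 :> R by rewrite pnatr_eq0.
have m0 : m.+1%:R != 0 :> R by rewrite pnatr_eq0.
by move: (n.+1%:R) (m.+1%:R) n0 m0 => a b a0 b0; field; rewrite a0 b0.
Qed.

(** Two meshes of c have a common refinement; this is why the meshes are
c / (n + 1) and not arbitrary. *)
Lemma setI_closed_grid_sets c : setI_closed (grid_sets c).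
Proof.
move=> _ _ [n [A [mA ->]]] [m [B [mB ->]]].
exists (n.+1 * m.+1).-1, (subsequence_rseq m.+1 @^-1` A `&` subsequence_rseq n.+1 @^-1` B).
split.
  by apply: measurableI; apply: preimage_measurable => //;
    exact: measurable_subsequence_rseq.
by rewrite {1}(grid_refine c n m) (grid_refine c m n) [(m.+1 * _)%N]mulnC.
Qed.

(** A right-continuous path is determined by its values on the meshes c / (n + 1),
each real time being a limit from the right of mesh points. *)
Lemma measurable_grid_sets c : 0 < c -> @measurable _ (@cadlag_path R) = <<s grid_sets c >>.
Proof.
move=> c0; have cm n : 0 < c * mesh n by rewrite mulr_gt0 ?mesh_gt0.
apply/seteqP; split; last first.
  apply: smallest_sub; first exact: sigma_algebra_measurable.
  move=> _ [n [B [mB ->]]]; apply: preimage_measurable => //; exact: measurable_grid.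
pose Q := g_sigma_algebraType (grid_sets c).
have mgrid n : @measurable_fun _ _ Q (rseq R) setT (grid (c * mesh n)).
  by move=> _ B mB; rewrite setTI; apply: sub_sigma_algebra; exists n, B.
have meval t : 0 <= t ->
    @measurable_fun _ _ Q (measurableTypeR R) setT (fun y : Q => (y : cadlag_path) t).
  move=> t0.
  have t'0 : 0 <= t / c by rewrite divr_ge0// ltW.
  apply: (@measurable_fun_cvg _ Q R setT (fun n (y : Q) =>
    (y : cadlag_path) ((Num.truncn (t / c / mesh n)).+1%:R * (c * mesh n)))).
    move=> n; exact: (measurableT_comp (measurable_rseq_eval _) (mgrid n)).
  move=> y _; have [yr _] := path_cadlag (y : cadlag_path).
  have ct : (Num.truncn (t / c / mesh n)).+1%:R * (c * mesh n) @[n --> \oo] --> t^'+.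
    move=> A /= [e /= e0 eA].
    have ec : 0 < e / c by rewrite divr_gt0.
    have tB : (t / c)^'+ [set u | A (u * c)].
      exists (e / c) => // u /= uc tu; apply: eA; last by rewrite /= -ltr_pdivrMr.
      have -> : t = t / c * c by rewrite divfK// gt_eqF.
      by rewrite /= -mulrBl normrM (gtr0_norm c0) -ltr_pdivlMr.
    have H : \forall n \near \oo, A ((Num.truncn (t / c / mesh n)).+1%:R * mesh n * c).
      exact: (grid_right_cvg t'0 tB).
    suff : \forall n \near \oo, A ((Num.truncn (t / c / mesh n)).+1%:R * (c * mesh n)) by [].
    by apply: filterS H => n; rewrite -mulrA [c * _]mulrC.
  exact: cvg_comp ct (yr _ t0).
apply: smallest_sub; first exact: smallest_sigma_algebra.
move=> _ [t [B [t0 mB ->]]].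
by have := meval t t0 measurableT B mB; rewrite setTI.
Qed.

End path_grid.

(** * The Markov property of a Levy process *)

Section markov.
Local Open Scope ereal_scope.
Context {R : realType} d (T : measurableType d) (P : probability T R).

(** The only features of a Levy process used from here on: the path before a
deterministic time is independent of the path after it, which is a copy of the
whole path. *)
Record levy_path (Z : T -> @cadlag_path R) : Prop := LevyPath {
  levy_path_measurable : measurable_fun setT Z ;
  levy_path_indep : forall s, (0 <= s)%R ->
    indep_rv P (fun w => stop_path s (Z w)) (fun w => shift_path s (Z w)) ;
  levy_path_shift : forall s, (0 <= s)%R ->
    eq_law P (fun w => shift_path s (Z w)) P Z }.

Lemma levy_path_integral Z s (F : cadlag_path * cadlag_path -> \bar R) :
  levy_path Z -> (0 <= s)%R -> measurable_fun setT F -> (forall x, 0 <= F x) ->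
  \int[P]_w F (stop_path s (Z w), shift_path s (Z w)) =
  \int[P]_w \int[P]_v F (stop_path s (Z w), Z v).
Proof.
move=> [mZ iZ sZ] s0 mF F0.
have mstop := measurableT_comp (measurable_stop_path s) mZ.
have mshift : measurable_fun setT (fun w => shift_path s (Z w)).
  exact: measurable_shift_path.
rewrite (indep_integral mstop mshift (iZ s s0) mF F0).
apply: eq_integral => w _.
apply: (eq_law_integral (f := fun y => F (stop_path s (Z w), y)) (sZ s s0)) => //.
exact: (measurableT_comp mF (pair1_measurable _)).
Qed.

Lemma levy_path_shift_integral Z s (F : cadlag_path -> \bar R) :
  levy_path Z -> (0 <= s)%R -> measurable_fun setT F -> (forall x, 0 <= F x) ->
  \int[P]_w F (shift_path s (Z w)) = \int[P]_w F (Z w).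
Proof. by move=> [_ _ sZ] s0 mF F0; exact: eq_law_integral (sZ s s0) mF F0. Qed.

Variable Y : R -> T -> R.
Hypothesis levyY : levy_process P Y.

Definition path_of (w : T) : @cadlag_path R :=
  CadlagPath (levy_cadlag levyY w) (levy_start levyY w).

Lemma measurable_path_of : measurable_fun setT path_of.
Proof. by apply: measurable_fun_path => t t0; exact: (levy_measurable levyY). Qed.

Let incr (s h : R) k w : R := (Y (s + k.+1%:R * h) w - Y (s + k%:R * h) w)%R.

Let measurable_incr s h k : (0 <= s)%R -> (0 < h)%R -> measurable_fun setT (incr s h k).
Proof.
move=> s0 h0; apply: measurable_funB; apply: (levy_measurable levyY);
  by rewrite addr_ge0// mulr_ge0// ltW.
Qed.

Let indep_incr s h : (0 <= s)%R -> (0 < h)%R -> indep_seq P (incr s h).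
Proof.
move=> s0 h0; apply: independent_systems_indep_seq => n.
have t0 : (0 <= s + 0%:R * h)%R by rewrite mul0r addr0.
have tS k : (k < n)%N -> (s + k%:R * h <= s + k.+1%:R * h)%R.
  by move=> _; rewrite lerD2l ler_pM2r// ler_nat.
exact: (@levy_indep _ _ _ _ _ levyY n (fun k => s + k%:R * h)%R t0 tS).
Qed.

Let incr_law s h k A : (0 <= s)%R -> (0 < h)%R -> measurable A ->
  P (incr s h k @^-1` A) = P (Y h @^-1` A).
Proof.
move=> s0 h0 mA; have s1 : (0 <= s + k%:R * h)%R by rewrite addr_ge0// mulr_ge0// ltW.
have [_ _ /(_ A mA) <-] := levy_stationary levyY s1 (ltW h0).
suff -> : incr s h k = (fun w => Y (s + k%:R * h + h) w - Y (s + k%:R * h) w)%R by [].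
by apply/funext => w; rewrite /incr -addrA -[k.+1]addn1 natrD mulrDl mul1r.
Qed.

Let path_increment_shift s h w : (0 <= s)%R ->
  path_increment h (shift_path s (path_of w)) = rseq_of (incr s h) w.
Proof.
move=> s0; apply/funext => k; rewrite /path_increment !shift_pathE//.
by rewrite /rseq_of /incr/=; lra.
Qed.

Let path_increment_path_of h w : path_increment h (path_of w) = rseq_of (incr 0 h) w.
Proof.
by apply/funext => k; rewrite /path_increment /rseq_of /incr !add0r.
Qed.

(** Fix s and choose c such that s is a multiple of c / (n + 1) for every n.
On the sets that depend on one of these grids, the claims are statements about
the head and the tail of the sequence of increments of the process; such
sets form a pi-system that generates the events of paths. *)
Lemma levy_path_of : levy_path path_of.
Proof.
have mY := measurable_path_of.
have mesh0 c n : (0 < c)%R -> (0 < c * @mesh R n)%R by move=> c0; rewrite mulr_gt0// mesh_gt0.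
have mstop s := measurableT_comp (measurable_stop_path s) mY.
have mshift s : measurable_fun setT (fun w => shift_path s (path_of w)).
  exact: measurable_shift_path.
split => // s s0.
(* b is 0 or 1; any mesh serves when s = 0 *)
- have [c [b [c0 sE]]] : exists c : R, exists b : nat, (0 < c)%R /\ (s = b%:R * c)%R.
    have [s00|s00] := eqVneq s 0%R; first by exists 1%R, 0%N; rewrite s00 mul0r.
    by exists s, 1%N; rewrite mul1r lt_neqAle eq_sym s00.
  apply: (indep_rv_pi_system (measurable_grid_sets c0) (@setI_closed_grid_sets _ c)
    (measurable_grid_sets c0) (@setI_closed_grid_sets _ c)); [exact: mstop|exact: mshift|].
  move=> _ _ [n [A [mA ->]]] [m [B [mB ->]]].
  rewrite (grid_refine c n m) (grid_refine c m n) [(m.+1 * _)%N]mulnC.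
  set k := (n.+1 * m.+1).-1; set h := (c * mesh k)%R.
  have h0 : (0 < h)%R by exact: mesh0.
  have sh : (s = (b * k.+1)%:R * h)%R.
    rewrite sE /h /mesh natrM -mulrA; congr (_ * _)%R.
    by rewrite mulrCA divff ?mulr1// pnatr_eq0.
  have i1 := indep_rv_comp (@measurable_partial_sums R) (@measurable_partial_sums R)
    (indep_seq_split (b * k.+1) (fun j => measurable_incr j (lexx 0%R) h0)
      (indep_incr (lexx 0%R) h0)).
  have e1 : (fun w => partial_sums (head_rseq (b * k.+1) (rseq_of (incr 0 h) w))) =
      (fun w => grid h (stop_path s (path_of w))).
    by apply/funext => w; rewrite sh grid_stopE// path_increment_path_of.
  have e2 : (fun w => partial_sums (tail_rseq (b * k.+1) (rseq_of (incr 0 h) w))) =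
      (fun w => grid h (shift_path s (path_of w))).
    by apply/funext => w; rewrite sh grid_shiftE// path_increment_path_of.
  rewrite e1 e2 in i1.
  exact: (i1 (subsequence_rseq m.+1 @^-1` A) (subsequence_rseq n.+1 @^-1` B)
    (preimage_measurable (@measurable_subsequence_rseq R _) mA)
    (preimage_measurable (@measurable_subsequence_rseq R _) mB)).
- apply: (eq_law_pi_system (measurable_grid_sets ltr01) (@setI_closed_grid_sets _ 1%R)) => //.
  move=> _ [n [A [mA ->]]]; have h0 := mesh0 1%R n ltr01; move: h0; set h := (1 * _)%R => h0.
  have l1 := indep_seq_eq_law (fun j => measurable_incr j s0 h0)
    (fun j => measurable_incr j (lexx 0%R) h0) (indep_incr s0 h0) (indep_incr (lexx 0%R) h0)
    (fun j B mB => etrans (incr_law j s0 h0 mB) (esym (incr_law j (lexx 0%R) h0 mB))).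
  have e1 w : partial_sums (rseq_of (incr s h) w) = grid h (shift_path s (path_of w)).
    by rewrite gridE path_increment_shift.
  have e2 w : partial_sums (rseq_of (incr 0 h) w) = grid h (path_of w).
    by rewrite gridE path_increment_path_of.
  have [_ _ l2] := l1.
  have := l2 _ (preimage_measurable (@measurable_partial_sums R) mA).
  rewrite (_ : _ @^-1` _ = (fun w => shift_path s (path_of w)) @^-1` (grid h @^-1` A)).
    rewrite (_ : rseq_of (incr 0 h) @^-1` _ = path_of @^-1` (grid h @^-1` A)) => [//|].
    by apply/seteqP; split => w /=; rewrite e2.
  by apply/seteqP; split => w /=; rewrite e1.
Qed.

End markov.

(** * The Wiener-Hopf factorisation at an exponential time *)

Section argmax_split.
Context {R : realType}.
Implicit Types x : nat -> R.

Lemma last_argmax_ext x x' n : (forall j, (j <= n)%N -> x j = x' j) ->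
  last_argmax x n = last_argmax x' n.
Proof.
move=> e; apply: is_last_argmax_unique; have [kn ub lt] := last_argmaxP x' n.
split => // j; first by move=> jn; rewrite !e//; exact: ub.
by move=> /andP[kj jn]; rewrite !e//; apply: lt; rewrite kj.
Qed.

(** The walk has its last maximum at k when no earlier value exceeds the value
at k and all later ones are strictly below it. The first condition involves
only the increments before k, the second only those after k. *)
Lemma last_argmax_split x n k : (k <= n)%N ->
  (last_argmax x n == k) = (last_argmax x k == k) &&
    (last_argmax (fun j => x (k + j)%N - x k) (n - k) == 0%N).
Proof.
move=> kn; apply/eqP/andP => [nk|[/eqP ek /eqP e0]].
  have [_ ub lt] := last_argmaxP x n; rewrite nk in ub lt.
  split; apply/eqP; apply: is_last_argmax_unique; split => //.
  - by move=> j jk; apply: ub; exact: leq_trans kn.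
  - by move=> j /andP[kj jk]; have := leq_trans kj jk; rewrite ltnn.
  - move=> j; rewrite leq_subRL// => jn; rewrite lerD2r addn0; exact: ub.
  - move=> j /andP[j0]; rewrite leq_subRL// => jn; rewrite ltrD2r addn0; apply: lt.
    by rewrite jn andbT -[X in (X < _)%N]addn0 ltn_add2l.
have [_ ubk _] := last_argmaxP x k; rewrite ek in ubk.
have [_ ub0 lt0] := last_argmaxP (fun j => x (k + j)%N - x k) (n - k).
rewrite e0 in ub0 lt0.
apply: is_last_argmax_unique; split => // j.
- move=> jn; have [jk|kj] := leqP j k; first exact: ubk.
  have e : (k + (j - k))%N = j by rewrite subnKC// ltnW.
  have h := ub0 (j - k)%N (leq_sub2r k jn); rewrite /= e addn0 in h.
  by move: h; rewrite lerD2r.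
- move=> /andP[kj jn]; have e : (k + (j - k))%N = j by rewrite subnKC// ltnW.
  have h : (0 < j - k <= n - k)%N by rewrite subn_gt0 kj leq_sub2r.
  have {}h := lt0 (j - k)%N h; rewrite /= e addn0 in h.
  by move: h; rewrite ltrD2r.
Qed.

Lemma tilted_walk_shift eps h (y : @cadlag_path R) k j : 0 < h ->
  tilted_walk eps h (shift_path (k%:R * h) y) j =
  tilted_walk eps h y (k + j)%N - tilted_walk eps h y k.
Proof.
move=> h0; have kh : 0 <= k%:R * h by rewrite mulr_ge0// ltW.
by rewrite /tilted_walk shift_pathE// natrD mulrDl; ring.
Qed.

Lemma tilted_walk_stop eps h (y : @cadlag_path R) k j : 0 < h -> (j <= k)%N ->
  tilted_walk eps h (stop_path (k%:R * h) y) j = tilted_walk eps h y j.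
Proof.
move=> h0 jk; have kh : 0 <= k%:R * h by rewrite mulr_ge0// ltW.
by rewrite /tilted_walk stop_pathE// ler_pM2r// ler_nat.
Qed.

End argmax_split.

Section series_single.
Local Open Scope ereal_scope.
Context {R : realType}.

Lemma nneseries_single (f : nat -> \bar R) n : (forall k, 0 <= f k) ->
  (forall k, k != n -> f k = 0) -> \sum_(k <oo) f k = f n.
Proof.
move=> f0 fn; rewrite (@nneseriesD1 _ f n xpredT)//.
by rewrite eseries0 ?adde0// => k _; exact: fn.
Qed.

End series_single.

Section discrete_wiener_hopf.
Local Open Scope ereal_scope.
Context {R : realType} d (T : measurableType d) (P : probability T R).
Variables (Z : T -> @cadlag_path R) (S : T -> R) (zeta eps h : R).
Hypotheses (levyZ : levy_path P Z) (zeta0 : (0 < zeta)%R) (h0 : (0 < h)%R).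
Hypotheses (expS : exponential_rv P zeta S) (S0 : forall w, (0 <= S w)%R).
Hypothesis indepSZ : indep_rv P S Z.

Let mZ := levy_path_measurable levyZ.
Let mS : measurable_fun setT S. Proof. by case: expS. Qed.
Let tw y := tilted_walk eps h y.

Let site (y : @cadlag_path R) k : R * R := (tw y k, k%:R * h)%R.

Let max_here k (f : R * R -> R) (y : @cadlag_path R) : \bar R :=
  ((last_argmax (tw y) k == k)%:R * f (site y k))%:E.
Let max_at_start m (g : R * R -> R) (y : @cadlag_path R) : \bar R :=
  ((last_argmax (tw y) m == 0)%:R * g (site y m))%:E.

Let measurable_site k : measurable_fun setT (fun y => site y k).
Proof.
apply: measurable_fun_pair => //.
exact: (measurable_tilted_walk eps k h0 (@measurable_id _ _ setT)).
Qed.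

Let measurable_argmax_ind n k :
  measurable_fun setT (fun y => (last_argmax (tw y) n == k)%:R : R).
Proof.
rewrite (_ : (fun _ => _) = \1_[set y | last_argmax (tw y) n = k]).
  apply: measurable_indic; apply: measurable_last_argmax => j.
  exact: (measurable_tilted_walk eps j h0 (@measurable_id _ _ setT)).
apply/funext => y; rewrite indicE; congr (_%:R); congr nat_of_bool.
by apply/eqP/idP; rewrite inE.
Qed.

Let measurable_max_here k f : measurable_fun setT f -> measurable_fun setT (max_here k f).
Proof.
move=> mf; apply/measurable_EFinP/measurable_funM => //.
exact: (measurableT_comp mf (measurable_site k)).
Qed.

Let measurable_max_at_start m g : measurable_fun setT g -> measurable_fun setT (max_at_start m g).
Proof.
move=> mg; apply/measurable_EFinP/measurable_funM => //.
exact: (measurableT_comp mg (measurable_site m)).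
Qed.

Variables (f g : R * R -> R).
Hypotheses (mf : measurable_fun setT f) (mg : measurable_fun setT g).
Hypotheses (f01 : forall x, (0 <= f x <= 1)%R) (g01 : forall x, (0 <= g x <= 1)%R).

Let max_here_ge0 k y : 0 <= max_here k f y.
Proof. by rewrite lee_fin mulr_ge0//; have /andP[] := f01 (site y k). Qed.

Let max_at_start_ge0 m y : 0 <= max_at_start m g y.
Proof. by rewrite lee_fin mulr_ge0//; have /andP[] := g01 (site y m). Qed.

Let A k := \int[P]_w max_here k f (Z w).
Let B m := \int[P]_w max_at_start m g (Z w).

Let B0 m : 0 <= B m. Proof. exact: integral_ge0. Qed.
Let A0 k : 0 <= A k. Proof. exact: integral_ge0. Qed.

Let B1 m : B m <= 1.
Proof.
have h01 w : 0 <= max_at_start m g (Z w) <= 1.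
  rewrite max_at_start_ge0 lee_fin; have /andP[? ?] := g01 (site (Z w) m).
  by rewrite mulr_ile1//; case: eqP.
have mh := measurableT_comp (measurable_max_at_start m mg) mZ.
by have /andP[] := integral_le1 P mh h01.
Qed.

Let factor k m :
  \int[P]_w (max_here k f (Z w) * max_at_start m g (shift_path (k%:R * h) (Z w))) = A k * B m.
Proof.
have kh : (0 <= k%:R * h)%R by rewrite mulr_ge0// ltW.
have stopE y : max_here k f y = max_here k f (stop_path (k%:R * h) y).
  rewrite /max_here /site /tw tilted_walk_stop//; congr (((_ == _)%:R * _)%:E).
  by apply: last_argmax_ext => j jk; rewrite tilted_walk_stop.
have mstop : measurable_fun setT (fun w => stop_path (k%:R * h) (Z w)).
  exact: (measurableT_comp (measurable_stop_path _) mZ).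
under eq_integral do rewrite stopE.
rewrite (levy_path_integral (F := fun p => max_here k f p.1 * max_at_start m g p.2) levyZ kh).
- rewrite /A -ge0_integralZr//.
  + apply: eq_integral => w _; rewrite /= -stopE ge0_integralZl//.
    exact: (measurableT_comp (measurable_max_at_start m mg) mZ).
  + exact: (measurableT_comp (measurable_max_here k mf) mZ).
- apply: emeasurable_funM.
  + exact: (measurableT_comp (measurable_max_here k mf) measurable_fst).
  + exact: (measurableT_comp (measurable_max_at_start m mg) measurable_snd).
- by move=> p; exact: mule_ge0.
Qed.

Let walk_integral n :
  \int[P]_w (f (walk_max_pair eps h (Z w) n) * g (walk_gap_pair eps h (Z w) n))%:E =
  \sum_(k <oo) ((k <= n)%N%:R%:E * (A k * B (n - k))).
Proof.
transitivity (\int[P]_w (\sum_(k <oo) ((k <= n)%N%:R%:E *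
    (max_here k f (Z w) * max_at_start (n - k) g (shift_path (k%:R * h) (Z w)))))).
  apply: eq_integral => w _; set y := Z w.
  have [kn _ _] := last_argmaxP (tw y) n; set k := last_argmax (tw y) n in kn.
  have spl j : (j <= n)%N -> (k == j) = (last_argmax (tw y) j == j) &&
      (last_argmax (tw (shift_path (j%:R * h) y)) (n - j) == 0)%N.
    move=> jn; rewrite /k last_argmax_split//; congr (_ && (_ == _)).
    by apply: last_argmax_ext => i _; rewrite /tw tilted_walk_shift.
  rewrite (@nneseries_single _ _ k).
  - have := spl k kn; rewrite eqxx => /esym/andP[e1 e2].
    rewrite kn mul1e /max_here /max_at_start e1 e2 !mul1r -EFinM; congr (_ * g _)%:E.
    rewrite /walk_gap_pair /site -/tw -/(tw y) -/k /tw tilted_walk_shift// subnKC//.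
    by rewrite natrB// mulrBl.
  - by move=> j; apply: mule_ge0; [by rewrite lee_fin|exact: mule_ge0].
  - move=> j jk; have [jn|] := boolP (j <= n)%N; last by rewrite mul0e.
    rewrite mul1e /max_here /max_at_start -EFinM mulrACA -natrM mulnb -spl// eq_sym.
    by rewrite (negbTE jk) mul0r.
have kh k : (0 <= k%:R * h)%R by rewrite mulr_ge0// ltW.
have m1 k : measurable_fun setT (fun w => max_here k f (Z w)).
  exact: (measurableT_comp (measurable_max_here k mf) mZ).
have m2 k m : measurable_fun setT (fun w => max_at_start m g (shift_path (k%:R * h) (Z w))).
  apply: (measurableT_comp (measurable_max_at_start m mg)).
  exact: measurable_shift_path.
rewrite integral_nneseries//.
- apply: eq_eseriesr => k _; rewrite ge0_integralZl_EFin ?factor//.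
  + by move=> w _; exact: mule_ge0.
  + exact: emeasurable_funM.
- by move=> k; apply: emeasurable_funM => //; exact: emeasurable_funM.
- by move=> k w _; apply: mule_ge0; [by rewrite lee_fin|exact: mule_ge0].
Qed.

Let N (t : R) := Num.truncn (t / h).

Let N_ge t k : (0 <= t)%R -> (k <= N t)%N = (k%:R * h <= t)%R.
Proof.
move=> t0; have th : (0 <= t / h)%R by rewrite divr_ge0// ltW.
by rewrite /N (truncn_ge_nat _ th) ler_pdivlMr.
Qed.

Let N_add t k : (0 <= t)%R -> N (k%:R * h + t) = (k + N t)%N.
Proof.
move=> t0; rewrite /N mulrDl mulfK ?gt_eqF// truncnD ?natrK//.
by rewrite qualifE/= divr_ge0// ltW.
Qed.

Let measurable_B k : measurable_fun [set: R] (fun t => B (N t - k)).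
Proof.
apply: (measurable_fun_nat_index (k := N) (f := fun n (_ : R) => B (n - k))) => n //.
by apply: measurable_truncn_eq; exact: mulrr_measurable.
Qed.

Let B_fin : \int[P]_v B (N (S v)) \is a fin_num.
Proof.
have mBS : measurable_fun setT (fun v => B (N (S v))).
  have := measurableT_comp (measurable_B 0) mS.
  by apply: eq_measurable_fun => v _ /=; rewrite subn0.
have /andP[i0 i1] := integral_le1 P mBS (fun w => introT andP (conj (B0 _) (B1 _))).
by rewrite ge0_fin_numE// (le_lt_trans i1)// ltry.
Qed.

(** Splitting at the argmax k gives the sum over k <= N(S) of A k * B (N(S) - k).
By lack of memory, restricting to k h <= S and removing k from N(S) costs the
factor exp (- zeta k h) and leaves the law of N(S) unchanged, so the sum is a
product. *)
Lemma discrete_wiener_hopf_factor :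
  \int[P]_w (f (walk_max_pair eps h (Z w) (N (S w))) *
             g (walk_gap_pair eps h (Z w) (N (S w))))%:E =
  (\sum_(k <oo) ((expR (- zeta * (k%:R * h)))%:E * A k)) * \int[P]_v B (N (S v)).
Proof.
pose G (p : R * @cadlag_path R) : \bar R := (f (walk_max_pair eps h p.2 (N p.1)) *
  g (walk_gap_pair eps h p.2 (N p.1)))%:E.
have msnd := @measurable_snd _ _ (measurableTypeR R) (@cadlag_path R).
have mG : measurable_fun setT G.
  apply/measurable_EFinP/measurable_funM.
  - apply: (measurableT_comp mf); apply: (measurable_fun_nat_index
      (f := fun n (p : R * @cadlag_path R) => walk_max_pair eps h p.2 n)) => n.
      exact: (measurable_truncn_grid h n measurable_fst).
    exact: measurable_walk_max_pair.
  - apply: (measurableT_comp mg); apply: (measurable_fun_nat_index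
      (f := fun n (p : R * @cadlag_path R) => walk_gap_pair eps h p.2 n)) => n.
      exact: (measurable_truncn_grid h n measurable_fst).
    exact: measurable_walk_gap_pair.
have G0 p : 0 <= G p.
  rewrite lee_fin mulr_ge0//; first by have /andP[] := f01 (walk_max_pair eps h p.2 (N p.1)).
  by have /andP[] := g01 (walk_gap_pair eps h p.2 (N p.1)).
rewrite (indep_integral (f := G) mS mZ indepSZ mG G0).
under eq_integral do rewrite /G /= walk_integral.
have mkS k : measurable_fun [set: R] (fun t : R => ((k%:R * h <= t)%R%:R : R)%:E).
  by apply: measurable_natr_bool; apply: measurable_fun_ler => //; exact: measurable_cst.
transitivity (\sum_(k <oo) (A k * \int[P]_v
    ((k%:R * h <= S v)%R%:R%:E * B (N (S v) - k)))).
  rewrite integral_nneseries//.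
  - apply: eq_eseriesr => k _; rewrite -ge0_integralZl//.
    + by apply: eq_integral => v _; rewrite N_ge// muleCA.
    + apply: emeasurable_funM; first exact: (measurableT_comp (mkS k) mS).
      exact: (measurableT_comp (measurable_B k) mS).
    + by move=> v _; apply: mule_ge0; rewrite ?lee_fin.
  - move=> k; apply: (eq_measurable_fun
      (fun v => (k%:R * h <= S v)%R%:R%:E * (A k * B (N (S v) - k)))).
      by move=> v _; rewrite N_ge.
    apply: emeasurable_funM; first exact: (measurableT_comp (mkS k) mS).
    apply: emeasurable_funM => //; exact: (measurableT_comp (measurable_B k) mS).
  - by move=> k v _; apply: mule_ge0; [rewrite lee_fin|exact: mule_ge0].
rewrite -(fineK B_fin) muleC -nneseriesZl; last first.
  by move=> k _; apply: mule_ge0; rewrite ?lee_fin ?expR_ge0.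
apply: eq_eseriesr => k _.
have kh : (0 <= k%:R * h)%R by rewrite mulr_ge0// ltW.
rewrite (exponential_rv_memoryless (f := fun t => B (N t - k)) zeta0 kh expS)//.
have -> : \int[P]_w B (N (k%:R * h + S w) - k) = \int[P]_w B (N (S w)).
  by apply: eq_integral => v _; rewrite N_add// addKn.
by rewrite fineK// muleCA muleA muleC.
Qed.

End discrete_wiener_hopf.

Section wiener_hopf.
Local Open Scope ereal_scope.
Context {R : realType} d (T : measurableType d) (P : probability T R).
Implicit Types (Z : T -> @cadlag_path R) (S : T -> R).

(** Only the product form matters afterwards: taking f = 1 and g = 1
identifies both factors up to a constant. *)
Lemma discrete_wiener_hopf_product Z S (zeta eps h : R) :
  levy_path P Z -> (0 < zeta)%R -> (0 < h)%R -> exponential_rv P zeta S ->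
  (forall w, (0 <= S w)%R) -> indep_rv P S Z ->
  exists a b : (R * R -> R) -> \bar R, forall f g : R * R -> R,
    measurable_fun setT f -> measurable_fun setT g ->
    (forall x, (0 <= f x <= 1)%R) -> (forall x, (0 <= g x <= 1)%R) ->
    \int[P]_w (f (walk_max_pair eps h (Z w) (Num.truncn (S w / h))) *
               g (walk_gap_pair eps h (Z w) (Num.truncn (S w / h))))%:E = a f * b g.
Proof.
move=> lZ z0 h0 eS S0 iSZ.
exists (fun f => \sum_(k <oo) ((expR (- zeta * (k%:R * h)))%:E *
    \int[P]_w ((last_argmax (tilted_walk eps h (Z w)) k == k)%:R *
       f (tilted_walk eps h (Z w) k, k%:R * h)%R)%:E)),
  (fun g => \int[P]_v \int[P]_w
    ((last_argmax (tilted_walk eps h (Z w)) (Num.truncn (S v / h)) == 0)%:R *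
       g (tilted_walk eps h (Z w) (Num.truncn (S v / h)), (Num.truncn (S v / h))%:R * h)%R)%:E).
by move=> f g mf mg f01 g01; exact: discrete_wiener_hopf_factor.
Qed.

(** The product form for (f, g), (f, 1), (1, g) and (1, 1), the last one
having integral 1, gives the product rule. *)
Lemma disc_wiener_hopf Z S (zeta : R) p (f g : R * R -> R) :
  levy_path P Z -> (0 < zeta)%R -> exponential_rv P zeta S ->
  (forall w, (0 <= S w)%R) -> indep_rv P S Z ->
  measurable_fun setT f -> measurable_fun setT g ->
  (forall x, (0 <= f x <= 1)%R) -> (forall x, (0 <= g x <= 1)%R) ->
  \int[P]_w (f (disc_max p (S w) (Z w)) * g (disc_gap p (S w) (Z w)))%:E =
  \int[P]_w (f (disc_max p (S w) (Z w)))%:E * \int[P]_w (g (disc_gap p (S w) (Z w)))%:E.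
Proof.
move=> lZ z0 eS S0 iSZ mf mg f01 g01.
have [mS _] := eS; have mZ := levy_path_measurable lZ.
set h := @mesh R p.2; have h0 : (0 < h)%R by exact: mesh_gt0.
have [a [b ab]] := discrete_wiener_hopf_product (mesh p.1) lZ z0 h0 eS S0 iSZ.
have one01 (x : R * R) : (0 <= (cst 1 : R * R -> R) x <= 1)%R by rewrite ler01 lexx.
have mone : measurable_fun setT (cst 1%R : R * R -> R) by exact: measurable_cst.
(* the walk sampled by the discretisation starts at time h, which does not change its law *)
have shift (f' g' : R * R -> R) : measurable_fun setT f' -> measurable_fun setT g' ->
    (forall x, (0 <= f' x <= 1)%R) -> (forall x, (0 <= g' x <= 1)%R) ->
    \int[P]_w (f' (disc_max p (S w) (Z w)) * g' (disc_gap p (S w) (Z w)))%:E = a f' * b g'.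
  move=> mf' mg' f'01 g'01; rewrite -ab//.
  pose G (x : R * @cadlag_path R) : \bar R :=
    (f' (walk_max_pair (mesh p.1) h x.2 (Num.truncn (x.1 / h))) *
     g' (walk_gap_pair (mesh p.1) h x.2 (Num.truncn (x.1 / h))))%:E.
  have msnd := @measurable_snd _ _ (measurableTypeR R) (@cadlag_path R).
  have mG : measurable_fun setT G.
    apply/measurable_EFinP/measurable_funM.
    - apply: (measurableT_comp mf'); apply: (measurable_fun_nat_index
        (f := fun n (x : R * @cadlag_path R) => walk_max_pair (mesh p.1) h x.2 n)) => n.
        exact: (measurable_truncn_grid h n measurable_fst).
      exact: measurable_walk_max_pair.
    - apply: (measurableT_comp mg'); apply: (measurable_fun_nat_index
        (f := fun n (x : R * @cadlag_path R) => walk_gap_pair (mesh p.1) h x.2 n)) => n.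
        exact: (measurable_truncn_grid h n measurable_fst).
      exact: measurable_walk_gap_pair.
  have G0 x : 0 <= G x.
    rewrite lee_fin mulr_ge0//.
      by have /andP[] := f'01 (walk_max_pair (mesh p.1) h x.2 (Num.truncn (x.1 / h))).
    by have /andP[] := g'01 (walk_gap_pair (mesh p.1) h x.2 (Num.truncn (x.1 / h))).
  have ms : measurable_fun setT (shift_path h).
    exact: (measurable_shift_path (measurable_cst h) (@measurable_id _ (@cadlag_path R) setT)).
  have mshift : measurable_fun setT (fun w => shift_path h (Z w)).
    exact: (measurableT_comp ms mZ).
  have iS : indep_rv P S (fun w => shift_path h (Z w)).
    exact: (indep_rv_comp (@measurable_id _ _ setT) ms iSZ).
  transitivity (\int[P]_w G (S w, shift_path h (Z w))) => //.
  rewrite (indep_integral mS mshift iS mG G0).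
  transitivity (\int[P]_w G (S w, Z w)) => //.
  rewrite (indep_integral mS mZ iSZ mG G0); apply: eq_integral => w _.
  apply: (levy_path_shift_integral (F := fun y => G (S w, y)) lZ (ltW h0)) => //.
  exact: (measurableT_comp mG (pair1_measurable _)).
have ef : \int[P]_w (f (disc_max p (S w) (Z w)))%:E = a f * b (cst 1%R).
  by rewrite -shift//; apply: eq_integral => w _; rewrite mulr1.
have eg : \int[P]_w (g (disc_gap p (S w) (Z w)))%:E = a (cst 1%R) * b g.
  by rewrite -shift//; apply: eq_integral => w _; rewrite mul1r.
have e1 : a (cst 1%R) * b (cst 1%R) = 1.
  rewrite -shift//; transitivity (\int[P]_w (cst 1 w)).
    by apply: eq_integral => w _; rewrite mulr1.
  by rewrite integral_cst//= mul1e probability_setT.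
by rewrite shift// ef eg -[RHS]muleA [b (cst 1%R) * _]muleA [b (cst 1%R) * _]muleC e1 mul1e.
Qed.

(** The product rule of the discretisations passes to the iterated limit for
continuous test functions, which are enough for independence. *)
Theorem wiener_hopf Z S (zeta : R) :
  levy_path P Z -> (0 < zeta)%R -> exponential_rv P zeta S ->
  (forall w, (0 <= S w)%R) -> indep_rv P S Z ->
  indep_rv P (fun w => max_pair (S w) (Z w)) (fun w => gap_pair (S w) (Z w)).
Proof.
move=> lZ z0 eS S0 iSZ; have [mS _] := eS; have mZ := levy_path_measurable lZ.
apply: indep_rv_continuous.
- exact: measurable_max_pair.
- exact: measurable_gap_pair.
move=> f g cf cg mf mg f01 g01.
have mdm p : measurable_fun setT (fun w => f (disc_max p (S w) (Z w))).
  exact: (measurableT_comp mf (measurable_disc_max p mS mZ)).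
have mdg p : measurable_fun setT (fun w => g (disc_gap p (S w) (Z w))).
  exact: (measurableT_comp mg (measurable_disc_gap p mS mZ)).
have lf := integral_iter_oo (P := P) mdm (fun p w => f01 _)
  (fun w => @continuous_disc_max _ f (S w) (Z w) cf (S0 w)).
have lg := integral_iter_oo (P := P) mdg (fun p w => g01 _)
  (fun w => @continuous_disc_gap _ g (S w) (Z w) cg (S0 w)).
have lfg : fine (\int[P]_w (f (disc_max p (S w) (Z w)) * g (disc_gap p (S w) (Z w)))%:E)
    @[p --> iter_oo] --> fine (\int[P]_w (f (max_pair (S w) (Z w)) * g (gap_pair (S w) (Z w)))%:E).
  apply: integral_iter_oo.
  - by move=> p; exact: measurable_funM.
  - move=> p w; have /andP[? ?] := f01 (disc_max p (S w) (Z w)).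
    have /andP[? ?] := g01 (disc_gap p (S w) (Z w)).
    by rewrite mulr_ge0//= mulr_ile1.
  - move=> w; apply: cvgM; first exact: continuous_disc_max.
    exact: continuous_disc_gap.
have fin (k : T -> R) : measurable_fun setT k -> (forall w, (0 <= k w <= 1)%R) ->
    \int[P]_w (k w)%:E \is a fin_num.
  exact: integral_fin_num01.
have H p : fine (\int[P]_w (f (disc_max p (S w) (Z w)) * g (disc_gap p (S w) (Z w)))%:E) =
    (fine (\int[P]_w (f (disc_max p (S w) (Z w)))%:E) *
     fine (\int[P]_w (g (disc_gap p (S w) (Z w)))%:E))%R.
  by rewrite (disc_wiener_hopf p lZ z0 eS S0 iSZ mf mg f01 g01) fineM//; exact: fin.
move: lfg; rewrite (eq_cvg _ _ H) => l1.
have l2 := cvgM lf lg.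
exact: (cvg_unique (@Rhausdorff R) l1 (l2 _)).
Qed.

End wiener_hopf.

(** * Uniqueness in the renewal equation *)

Section pair_measurability.
Context {R : realType}.

Lemma measurable_pair_add d (T : measurableType d) (f g : T -> R * R) :
  measurable_fun setT f -> measurable_fun setT g ->
  measurable_fun setT (fun w => f w + g w).
Proof.
move=> mf mg; apply: measurable_fun_pair; apply: measurable_funD.
- exact: (measurableT_comp measurable_fst mf).
- exact: (measurableT_comp measurable_fst mg).
- exact: (measurableT_comp measurable_snd mf).
- exact: (measurableT_comp measurable_snd mg).
Qed.

Lemma measurable_keep_nonneg : measurable_fun setT (@keep_nonneg R).
Proof.
apply: measurable_fun_ifT; [|exact: measurable_id|exact: measurable_cst].
by apply: measurable_fun_ler => //; exact: measurable_cst.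
Qed.

End pair_measurability.

Section integral_sections.
Local Open Scope ereal_scope.
Context {R : realType} d1 d2 (T1 : measurableType d1) (T2 : measurableType d2)
  (P : probability T2 R).

Lemma measurable_integral_section (f : T1 * T2 -> \bar R) :
  measurable_fun setT f -> (forall x, 0 <= f x) ->
  measurable_fun setT (fun x => \int[P]_y f (x, y)).
Proof. by move=> mf f0; exact: (measurable_fun_fubini_tonelli_F (m2 := P) f). Qed.

End integral_sections.

Section renewal_fixed_point.
Local Open Scope ereal_scope.
Context {R : realType} d (T : measurableType d) (P : probability T R).
Variables (a b X C : T -> R * R) (q p : R).
Hypotheses (ma : measurable_fun setT a) (mb : measurable_fun setT b).
Hypotheses (mX : measurable_fun setT X) (mC : measurable_fun setT C).
Hypotheses (q0 : (0 <= q)%R) (p0 : (0 <= p)%R) (p1 : (p < 1)%R).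
Hypothesis eqX : forall f : R * R -> \bar R, measurable_fun setT f ->
  (forall x, 0 <= f x) -> \int[P]_w f (X w) = q%:E * \int[P]_w f (a w) +
    p%:E * \int[P]_w \int[P]_v \int[P]_u f (a w + keep_nonneg (b v + X u))%R.
Hypothesis eqC : forall f : R * R -> \bar R, measurable_fun setT f ->
  (forall x, 0 <= f x) -> \int[P]_w f (C w) = q%:E * f 0%R +
    p%:E * \int[P]_w \int[P]_v \int[P]_u f (keep_nonneg (a w + b v + C u))%R.

Let mshift (x y : R * R) :
  measurable_fun setT (fun z => x + keep_nonneg (y + z) : R * R)%R.
Proof.
apply: measurable_pair_add; first exact: measurable_cst.
apply: (measurableT_comp measurable_keep_nonneg).
by apply: measurable_pair_add; [exact: measurable_cst|exact: measurable_id].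
Qed.

(* the expectation over the sample point of C, as a function of the three others *)
Let F (f : R * R -> \bar R) (z : (T * T) * T) :=
  \int[P]_u f (a z.1.1 + keep_nonneg (b z.1.2 + (a z.2 + C u)))%R.

Let mF f : measurable_fun setT f -> (forall x, 0 <= f x) -> measurable_fun setT (F f).
Proof.
move=> mf f0; apply: (@measurable_integral_section _ _ _ _ _ P (fun z : ((T * T) * T) * T =>
    f (a z.1.1.1 + keep_nonneg (b z.1.1.2 + (a z.1.2 + C z.2)))%R)); last by [].
apply: (measurableT_comp mf).
have m11 : measurable_fun setT (fun z : ((T * T) * T) * T => z.1.1).
  exact: (measurableT_comp measurable_fst measurable_fst).
apply: measurable_pair_add.
  exact: (measurableT_comp ma (measurableT_comp measurable_fst m11)).
apply: (measurableT_comp measurable_keep_nonneg); apply: measurable_pair_add.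
  exact: (measurableT_comp mb (measurableT_comp measurable_snd m11)).
apply: measurable_pair_add; last exact: (measurableT_comp mC measurable_snd).
exact: (measurableT_comp ma (measurableT_comp measurable_snd measurable_fst)).
Qed.

Let F0 f z : (forall x, 0 <= f x) -> 0 <= F f z.
Proof. by move=> f0; exact: integral_ge0. Qed.

Let mF2 f : measurable_fun setT f -> (forall x, 0 <= f x) ->
  measurable_fun setT (fun z : T * T => \int[P]_w' F f (z, w')).
Proof.
move=> mf f0; apply: measurable_integral_section; first exact: mF.
by move=> z; exact: F0.
Qed.

Let eqaC (f : R * R -> \bar R) : measurable_fun setT f -> (forall x, 0 <= f x) ->
  \int[P]_w \int[P]_u f (a w + C u)%R = q%:E * \int[P]_w f (a w) +
    p%:E * \int[P]_w \int[P]_v \int[P]_w' F f ((w, v), w').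
Proof.
move=> mf f0.
have mF3 : measurable_fun setT (fun w => \int[P]_v \int[P]_w' F f ((w, v), w')).
  apply: (@measurable_integral_section _ _ _ _ _ P (fun z => \int[P]_w' F f (z, w'))).
    exact: mF2.
  by move=> z; apply: integral_ge0 => u _; exact: F0.
transitivity (\int[P]_w (q%:E * f (a w) + p%:E * \int[P]_v \int[P]_w' F f ((w, v), w'))).
  apply: eq_integral => w _.
  have mfa : measurable_fun setT (fun x => f (a w + x)%R).
    apply: (measurableT_comp mf); apply: measurable_pair_add.
      exact: measurable_cst.
    exact: measurable_id.
  have mFw : measurable_fun setT (fun z : T * T => F f ((w, z.1), z.2)).
    apply: (measurableT_comp (mF mf f0)); apply: measurable_fun_pair => //.
    by apply: measurable_fun_pair => //; exact: measurable_cst.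
  have e : \int[P]_w1 \int[P]_v \int[P]_u f (a w + keep_nonneg (a w1 + b v + C u))%R =
      \int[P]_v \int[P]_w' F f ((w, v), w').
    apply: etrans (esym (fubini_tonelli (m1 := P) (m2 := P) _ mFw (fun z => F0 _ f0))).
    apply: eq_integral => w1 _; apply: eq_integral => v _.
    by rewrite /F/=; apply: eq_integral => u _; rewrite addrA [(b v + _)%R]addrC.
  apply: (etrans (eqC mfa (fun x => f0 (a w + x)%R))); rewrite -e.
  by congr (q%:E * f _ + _); exact: addr0.
have mfa : measurable_fun setT (fun w => f (a w)) by exact: (measurableT_comp mf ma).
have I0 w : 0 <= \int[P]_v \int[P]_w' F f (w, v, w').
  by apply: integral_ge0 => v _; apply: integral_ge0 => u _; exact: F0.
rewrite ge0_integralD//.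
- by rewrite !ge0_integralZl_EFin.
- by move=> w _; rewrite mule_ge0.
- exact: emeasurable_funM.
- by move=> w _; rewrite mule_ge0.
- exact: emeasurable_funM.
Qed.

Let bound n (f : R * R -> \bar R) : measurable_fun setT f ->
  (forall x, 0 <= f x <= 1) ->
  \int[P]_w f (X w) <= \int[P]_w \int[P]_u f (a w + C u)%R + (p ^+ n)%:E.
Proof.
elim: n f => [|n ih] f mf f01; have f0 x : 0 <= f x by have /andP[] := f01 x.
  rewrite expr0; apply: (@le_trans _ _ 1).
    have /andP[//] := @integral_le1 _ _ _ P _ (measurableT_comp mf mX) (fun w => f01 (X w)).
  by rewrite leeDr//; apply: integral_ge0 => w _; exact: integral_ge0.
rewrite eqX// eqaC// -addeA leeD2l// exprS EFinM.
have pn0 : (0 <= p ^+ n)%R by exact: exprn_ge0.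
rewrite -ge0_muleDr//; last first.
- by do 3 (apply: integral_ge0 => ? _); exact: F0.
apply: lee_wpmul2l => //.
pose H (z : T * T) := \int[P]_u f (a z.1 + keep_nonneg (b z.2 + X u))%R.
have mH : measurable_fun setT H.
  apply: (@measurable_integral_section _ _ _ _ _ P (fun z : (T * T) * T =>
    f (a z.1.1 + keep_nonneg (b z.1.2 + X z.2))%R)); last by [].
  apply: (measurableT_comp mf); apply: measurable_pair_add.
    exact: (measurableT_comp ma (measurableT_comp measurable_fst measurable_fst)).
  apply: (measurableT_comp measurable_keep_nonneg); apply: measurable_pair_add.
    exact: (measurableT_comp mb (measurableT_comp measurable_snd measurable_fst)).
  exact: (measurableT_comp mX measurable_snd).
have H0 z : 0 <= H z by exact: integral_ge0.
have mG := mF2 mf f0; have G0 z : 0 <= \int[P]_w' F f (z, w').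
  by apply: integral_ge0 => u _; exact: F0.
set c := (p ^+ n)%R; pose G z := \int[P]_w' F f (z, w').
have HG z : H z <= G z + c%:E.
  have := ih (fun x => f (a z.1 + keep_nonneg (b z.2 + x))%R).
  by apply => //; exact: (measurableT_comp mf (mshift _ _)).
have mG1 w : measurable_fun setT (fun v => G (w, v)).
  exact: (measurableT_comp mG (pair1_measurable _)).
have GD : \int[P]_w \int[P]_v (G (w, v) + c%:E) = \int[P]_w \int[P]_v G (w, v) + c%:E.
  transitivity (\int[P]_w (\int[P]_v G (w, v) + c%:E)).
    apply: eq_integral => w _.
    rewrite (@ge0_integralD _ _ _ P _ measurableT (fun v => G (w, v)) (cst c%:E))//; last first.
      by move=> v _; exact: G0.
    by rewrite integral_cst//= probability_setT mule1.
  rewrite (@ge0_integralD _ _ _ P _ measurableT (fun w => \int[P]_v G (w, v)) (cst c%:E))//.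
  - by rewrite integral_cst//= probability_setT mule1.
  - by move=> w _; apply: integral_ge0 => v _; exact: G0.
  - by apply: (@measurable_integral_section _ _ _ _ _ P G).
rewrite -GD; change (\int[P]_w \int[P]_v H (w, v) <= \int[P]_w \int[P]_v (G (w, v) + c%:E)).
apply: ge0_le_integral => //.
- by move=> w _; apply: integral_ge0 => v _; exact: H0.
- by apply: (@measurable_integral_section _ _ _ _ _ P H).
- apply: (@measurable_integral_section _ _ _ _ _ P (fun z => G z + c%:E)) => [|z].
    by apply: emeasurable_funD => //; exact: measurable_cst.
  exact: (le_trans (H0 _) (HG _)).
- move=> w _; apply: ge0_le_integral => //.
  + exact: (measurableT_comp mH (pair1_measurable _)).
  + by apply: emeasurable_funD => //; exact: measurable_cst.
Qed.

Let mass (A : set (R * R)) := \int[P]_w \int[P]_u (\1_A (a w + C u)%R)%:E.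

Let mindic (A : set (R * R)) : measurable A ->
  measurable_fun setT (fun x => (\1_A x)%:E : \bar R).
Proof. by move=> mA; apply/measurable_EFinP; exact: measurable_indic. Qed.

Let le_mass A : measurable A -> P (X @^-1` A) <= mass A.
Proof.
move=> mA; have -> : P (X @^-1` A) = \int[P]_w (\1_A (X w))%:E.
  have := integral_indic P measurableT (preimage_measurable mX mA).
  by rewrite setIT => <-; apply: eq_integral => w _; rewrite !indicE.
have f01 x : (0 : \bar R) <= (\1_A x : R)%:E <= 1.
  rewrite !lee_fin; change ((0 : R) <= (x \in A)%:R <= (1 : R))%R.
  by case: (x \in A); rewrite ?lexx ?ler01.
have h n := bound n (mindic mA) f01.
apply/lee_addgt0Pr => e e0.
have pe : (p ^+ n)%R @[n --> \oo] --> (0 : R)%R.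
  by apply: cvg_expr; rewrite ger0_norm.
have /filter_ex [n ne] : \forall n \near \oo, (p ^+ n < e)%R.
  exact: (cvgr_lt _ pe).
apply: (le_trans (h n)); rewrite leeD2l// lee_fin; exact: ltW.
Qed.

(** Each use of the two equations reduces the gap between the laws of X and
of a + C by the factor p < 1, so one is dominated by the other. Two probability
measures of which one dominates the other are equal: apply the inequality to A
and to its complement. *)
Lemma renewal_unique A : measurable A -> P (X @^-1` A) = mass A.
Proof.
move=> mA; apply/eqP; rewrite eq_le le_mass//=.
have mAC : measurable (~` A) by exact: measurableC.
have msec B (mB : measurable B) :
    measurable_fun setT (fun z : T * T => (\1_B (a z.1 + C z.2)%R)%:E : \bar R).
  apply: (measurableT_comp (mindic mB)); apply: measurable_pair_add.
    exact: (measurableT_comp ma measurable_fst).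
  exact: (measurableT_comp mC measurable_snd).
have i0 B (z : R * R) : (0 : \bar R) <= (\1_B z : R)%:E by rewrite lee_fin.
have msecI B (mB : measurable B) w :
    measurable_fun setT (fun u => (\1_B (a w + C u)%R)%:E : \bar R).
  exact: (measurableT_comp (msec B mB) (pair1_measurable w)).
have mmass B (mB : measurable B) :
    measurable_fun setT (fun w => \int[P]_u (\1_B (a w + C u)%R)%:E).
  apply: (@measurable_integral_section _ _ _ _ _ P
    (fun z : T * T => (\1_B (a z.1 + C z.2)%R)%:E)) => //; exact: msec.
have massD : mass A + mass (~` A) = 1.
  rewrite /mass -ge0_integralD//.
  - transitivity (\int[P]_w (cst 1 w)); last by rewrite integral_cst//= mul1e probability_setT.
    apply: eq_integral => w _; rewrite -ge0_integralD//; [|exact: msecI..].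
    transitivity (\int[P]_w (cst 1 w)); last by rewrite integral_cst//= mul1e probability_setT.
    apply: eq_integral => u _; rewrite !indicE in_setC.
    by case: (_ \in A); rewrite /= ?adde0 ?add0e.
  - by move=> w _; exact: integral_ge0.
  - exact: mmass.
  - by move=> w _; exact: integral_ge0.
  - exact: mmass.
have PD : P (X @^-1` A) + P (X @^-1` (~` A)) = 1.
  have := probability_setC P (preimage_measurable mX mA) => e.
  rewrite (_ : X @^-1` (~` A) = ~` (X @^-1` A))// e addeC subeK//.
  exact: fin_num_measure (preimage_measurable mX mA).
have := le_mass mAC.
have mA0 : 0 <= mass A by apply: integral_ge0 => w _; exact: integral_ge0.
have mC0 : 0 <= mass (~` A) by apply: integral_ge0 => w _; exact: integral_ge0.
have PA0 : 0 <= P (X @^-1` A) by [].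
have PC0 : 0 <= P (X @^-1` (~` A)) by [].
move: massD PD mA0 mC0 PA0 PC0.
case: (mass A) => [x||]; case: (mass (~` A)) => [y||] //.
case: (P (X @^-1` A)) => [z||]; case: (P (X @^-1` (~` A))) => [t||] //.
by rewrite -!EFinD => -[e1] [e2]; rewrite !lee_fin => *; lra.
Qed.

End renewal_fixed_point.

(** * The renewal equation of the running maximum *)

Section renewal.
Local Open Scope ereal_scope.
Context {R : realType} d (T : measurableType d) (P : probability T R).

(** E is a clock of rate omega that competes with U. Before it rings, U is
seen with weight exp (- omega U); after it has rung, U starts afresh, with
weight exp (- beta E). Either weight tilts an exponential law to the rate
beta + omega. *)
Lemma renewal_exponential (beta omega : R) (U E S : T -> R) (m : R -> \bar R) :
  (0 < beta)%R -> (0 < omega)%R -> exponential_rv P beta U ->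
  exponential_rv P omega E -> exponential_rv P (beta + omega) S ->
  (forall w, (0 <= U w)%R) -> (forall w, (0 <= E w)%R) ->
  measurable_fun setT m -> (forall t, 0 <= m t) ->
  \int[P]_w m (U w) = (beta / (beta + omega))%:E * \int[P]_w m (S w) +
    (omega / (beta + omega))%:E * \int[P]_w \int[P]_v m (S w + U v)%R.
Proof.
move=> b0 o0 eU eE eS U0 E0 mm m0; have [mU _] := eU; have [mE _] := eE; have [mS _] := eS.
have mltE : measurable_fun setT (fun z : T * T => ((U z.1 < E z.2)%R%:R : R)%:E).
  apply: measurable_natr_bool.
  apply: measurable_fun_ltr; [exact: (measurableT_comp mU measurable_fst)|].
  exact: (measurableT_comp mE measurable_snd).
have mleE : measurable_fun setT (fun z : T * T => ((E z.2 <= U z.1)%R%:R : R)%:E).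
  apply: measurable_natr_bool.
  apply: measurable_fun_ler; [exact: (measurableT_comp mE measurable_snd)|].
  exact: (measurableT_comp mU measurable_fst).
have mmU : measurable_fun setT (fun z : T * T => m (U z.1)).
  by apply: (measurableT_comp mm); exact: (measurableT_comp mU measurable_fst).
have b01 b : (0 : \bar R) <= ((b%:R : R)%:E) by rewrite lee_fin ler0n.
pose F (z : T * T) := ((E z.2 <= U z.1)%R%:R : R)%:E * m (U z.1).
have mF : measurable_fun setT F by exact: emeasurable_funM.
have F0 z : 0 <= F z by rewrite mule_ge0.
pose G (z : T * T) := ((U z.1 < E z.2)%R%:R : R)%:E * m (U z.1).
have mG : measurable_fun setT G by exact: emeasurable_funM.
have G0 z : 0 <= G z by rewrite mule_ge0.
have GF z : m (U z.1) = G z + F z.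
  by rewrite /G /F; have [h|h] := ltP; rewrite /= ?mul0e ?mul1e ?adde0 ?add0e.
have e1 : \int[P]_w m (U w) = \int[P]_w \int[P]_v (G (w, v) + F (w, v)).
  apply: eq_integral => w _; transitivity (\int[P]_v (cst (m (U w)) v)).
    by rewrite integral_cst//= probability_setT mule1.
  by apply: eq_integral => v _; rewrite -GF.
have mGs w : measurable_fun setT (fun v => G (w, v)).
  exact: (measurableT_comp mG (pair1_measurable _)).
have mFs w : measurable_fun setT (fun v => F (w, v)).
  exact: (measurableT_comp mF (pair1_measurable _)).
have mIG : measurable_fun setT (fun w => \int[P]_v G (w, v)).
  exact: measurable_integral_section.
have mIF : measurable_fun setT (fun w => \int[P]_v F (w, v)).
  exact: measurable_integral_section.
have -> : \int[P]_w m (U w) =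
    \int[P]_w \int[P]_v G (w, v) + \int[P]_w \int[P]_v F (w, v).
  rewrite e1 -ge0_integralD//; last 2 first.
  - by move=> w _; apply: integral_ge0.
  - by move=> w _; apply: integral_ge0.
  by apply: eq_integral => w _; rewrite ge0_integralD.
congr (_ + _).
  transitivity (\int[P]_w ((expR (- omega * U w))%:E * m (U w))).
    apply: eq_integral => w _; rewrite /G/= ge0_integralZr//.
    - by rewrite (exponential_rv_gt o0 (U0 w) eE).
    - exact: (measurableT_comp mltE (pair1_measurable w)).
  exact: exponential_rv_tilt.
have mmS : measurable_fun setT (fun s : R => \int[P]_v m (s + U v)%R).
  apply: (@measurable_integral_section _ _ _ _ _ P (fun z : R * T => m (z.1 + U z.2)%R)) => //.
  apply: (measurableT_comp mm); apply: measurable_funD => //.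
  exact: (measurableT_comp mU measurable_snd).
transitivity (\int[P]_v ((expR (- beta * E v))%:E * \int[P]_w m (E v + U w)%R)).
  rewrite (fubini_tonelli (m1 := P) (m2 := P) F)//.
  by apply: eq_integral => v _; rewrite /F/= (exponential_rv_memoryless b0 (E0 v) eU mm m0).
rewrite [X in (omega / X)%R](addrC beta omega); rewrite addrC in eS.
have g0 s : 0 <= \int[P]_v m (s + U v)%R by exact: integral_ge0.
exact: (exponential_rv_tilt o0 b0 eE eS mmS g0).
Qed.

End renewal.

Section maximum_renewal.
Local Open Scope ereal_scope.
Context {R : realType} d (T : measurableType d) (P : probability T R).
Variables (Z : T -> @cadlag_path R) (beta omega : R) (U E S : T -> R).
Hypotheses (beta0 : (0 < beta)%R) (omega0 : (0 < omega)%R).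
Hypotheses (levyZ : levy_path P Z) (expU : exponential_rv P beta U)
  (expE : exponential_rv P omega E) (expS : exponential_rv P (beta + omega) S).
Hypotheses (U0 : forall w, (0 <= U w)%R) (E0 : forall w, (0 <= E w)%R)
  (S0 : forall w, (0 <= S w)%R).
Hypotheses (indepUZ : indep_rv P U Z) (indepSZ : indep_rv P S Z).

Let a w := max_pair (S w) (Z w).
Let b w := gap_pair (S w) (Z w).

Let mU : measurable_fun setT U := expU.1.
Let mS : measurable_fun setT S := expS.1.
Let mZ := levy_path_measurable levyZ.

Let mmax0 : measurable_fun setT (fun z : R * @cadlag_path R => Num.max z.1 0%R).
Proof. by apply: measurable_maxr; [exact: measurable_fst|exact: measurable_cst]. Qed.

(* the time is clipped to make the map jointly measurable on all of R * paths *)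
Let mp (z : R * @cadlag_path R) := max_pair (Num.max z.1 0%R) z.2.
Let gp (z : R * @cadlag_path R) := gap_pair (Num.max z.1 0%R) z.2.

Let mmp : measurable_fun setT mp.
Proof.
exact: (measurable_max_pair mmax0 measurable_snd (fun z => max0_ge0 z.1)).
Qed.

Let mgp : measurable_fun setT gp.
Proof.
exact: (measurable_gap_pair mmax0 measurable_snd (fun z => max0_ge0 z.1)).
Qed.

Let mpE t y : (0 <= t)%R -> mp (t, y) = max_pair t y.
Proof. by move=> t0; rewrite /mp/= max_l. Qed.

Let gpE t y : (0 <= t)%R -> gp (t, y) = gap_pair t y.
Proof. by move=> t0; rewrite /gp/= max_l. Qed.

(** The pairs before and after the maximum, taken from one path, are
independent by [wiener_hopf], so they can be taken from two copies. *)
Lemma independent_sum_at_exponential (H : (R * R) * (R * R) -> \bar R) :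
  measurable_fun setT H -> (forall x, 0 <= H x) ->
  \int[P]_w \int[P]_v H (max_pair (S w) (Z v), gap_pair (S w) (Z v)) =
  \int[P]_w \int[P]_v H (a w, b v).
Proof.
move=> mH H0.
have mab : measurable_fun setT (fun z => (mp z, gp z)) by exact: measurable_fun_pair.
transitivity (\int[P]_w \int[P]_v H (mp (S w, Z v), gp (S w, Z v))).
  by apply: eq_integral => w _; apply: eq_integral => v _; rewrite mpE// gpE.
transitivity (\int[P]_w H (mp (S w, Z w), gp (S w, Z w))).
  exact: (esym (indep_integral mS mZ indepSZ (measurableT_comp mH mab) (fun z => H0 _))).
transitivity (\int[P]_w H (a w, b w)).
  by apply: eq_integral => w _; rewrite mpE// gpE.
have z0 : (0 < beta + omega)%R by exact: addr_gt0.
by apply: (indep_integral _ _ (wiener_hopf levyZ z0 expS S0 indepSZ) mH H0);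
  [exact: measurable_max_pair|exact: measurable_gap_pair].
Qed.

(** Given the time S + U, the path is split at S: the part before S gives a and
b, the part after S is an independent copy over the time U. *)
Lemma max_pair_renewal (f : R * R -> \bar R) : measurable_fun setT f ->
  (forall x, 0 <= f x) ->
  \int[P]_w f (max_pair (U w) (Z w)) =
  (beta / (beta + omega))%:E * \int[P]_w f (a w) +
  (omega / (beta + omega))%:E * \int[P]_w \int[P]_v \int[P]_u
    f (a w + keep_nonneg (b v + max_pair (U u) (Z u)))%R.
Proof.
move=> mf f0.
have mfm : measurable_fun setT (fun z => f (mp z)) by exact: (measurableT_comp mf mmp).
pose m (t : R) := \int[P]_v f (mp (t, Z v)).
have mfmZ : measurable_fun setT (fun z : R * T => f (mp (z.1, Z z.2))).
  apply: (measurableT_comp mfm); apply: measurable_fun_pair => //.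
  exact: (measurableT_comp mZ measurable_snd).
have mm : measurable_fun setT m.
  by apply: (@measurable_integral_section _ _ _ _ _ P (fun z : R * T => f (mp (z.1, Z z.2)))).
have m0 t : 0 <= m t by exact: integral_ge0.
have mE (V : T -> R) : measurable_fun setT V -> (forall w, (0 <= V w)%R) ->
    indep_rv P V Z -> \int[P]_w f (max_pair (V w) (Z w)) = \int[P]_w m (V w).
  move=> mV V0 iV; transitivity (\int[P]_w f (mp (V w, Z w))).
    by apply: eq_integral => w _; rewrite mpE.
  exact: (indep_integral mV mZ iV mfm).
rewrite (mE U)// (mE S)//.
apply: (etrans (renewal_exponential beta0 omega0 expU expE expS U0 E0 mm m0)).
apply: (congr1 (fun z => (beta / (beta + omega))%:E * \int[P]_w m (S w) +
  (omega / (beta + omega))%:E * z)).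
pose Phi (x : (R * R) * (R * R)) :=
  \int[P]_u f (x.1 + keep_nonneg (x.2 + max_pair (U u) (Z u)))%R.
have mPhi : measurable_fun setT Phi.
  apply: (@measurable_integral_section _ _ _ _ _ P (fun z : ((R * R) * (R * R)) * T =>
    f (z.1.1 + keep_nonneg (z.1.2 + max_pair (U z.2) (Z z.2)))%R)) => //.
  apply: (measurableT_comp mf); apply: measurable_pair_add.
    exact: (measurableT_comp measurable_fst measurable_fst).
  apply: (measurableT_comp measurable_keep_nonneg); apply: measurable_pair_add.
    exact: (measurableT_comp measurable_snd measurable_fst).
  apply: (measurableT_comp (f := fun w => max_pair (U w) (Z w)) _ measurable_snd).
  exact: measurable_max_pair.
have Phi0 x : 0 <= Phi x by exact: integral_ge0.
rewrite -(independent_sum_at_exponential mPhi Phi0).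
apply: eq_integral => w _.
(* split the path at S w, then average over the time after S w *)
pose H (z : T * (R * @cadlag_path R)) :=
  f (max_pair (S w) (Z z.1) + keep_nonneg (gap_pair (S w) (Z z.1) + mp z.2))%R.
have mSw : measurable_fun setT (fun y : @cadlag_path R => max_pair (S w) y).
  by apply: measurable_max_pair.
have mSw' : measurable_fun setT (fun y : @cadlag_path R => gap_pair (S w) y).
  by apply: measurable_gap_pair.
have mH : measurable_fun setT H.
  have mZ1 := measurableT_comp mZ (@measurable_fst _ _ T (R * @cadlag_path R)%type).
  apply: (measurableT_comp mf); apply: measurable_pair_add.
    exact: (measurableT_comp mSw mZ1).
  apply: (measurableT_comp measurable_keep_nonneg); apply: measurable_pair_add.
    exact: (measurableT_comp mSw' mZ1).
  exact: (measurableT_comp mmp measurable_snd).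
have H0 z : 0 <= H z by exact: f0.
transitivity (\int[P]_u \int[P]_v \int[P]_u' H (v, (U u, Z u'))).
  apply: eq_integral => u _; rewrite /m.
  pose K (z : @cadlag_path R * @cadlag_path R) :=
    f (max_pair (S w) z.1 + keep_nonneg (gap_pair (S w) z.1 + mp (U u, z.2)))%R.
  have mK : measurable_fun setT K.
    apply: (measurableT_comp mf); apply: measurable_pair_add.
      exact: (measurableT_comp mSw measurable_fst).
    apply: (measurableT_comp measurable_keep_nonneg); apply: measurable_pair_add.
      exact: (measurableT_comp mSw' measurable_fst).
    apply: (measurableT_comp mmp); apply: measurable_fun_pair.
      exact: measurable_cst.
    exact: measurable_snd.
  have K0 z : 0 <= K z by exact: f0.
  transitivity (\int[P]_v K (stop_path (S w) (Z v), shift_path (S w) (Z v))).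
    apply: eq_integral => v _; rewrite /K/= max_pair_stop// gap_pair_stop//.
    by rewrite !mpE ?addr_ge0// max_pair_add.
  rewrite (levy_path_integral levyZ (S0 w) mK K0).
  apply: eq_integral => v _; apply: eq_integral => u' _.
  by rewrite /K/= max_pair_stop// gap_pair_stop.
have mHv v : measurable_fun setT (fun z => H (v, z)).
  exact: (measurableT_comp mH (pair1_measurable v)).
have mHU : measurable_fun setT (fun z : T * T => \int[P]_u' H (z.2, (U z.1, Z u'))).
  apply: (@measurable_integral_section _ _ _ _ _ P
    (fun z : (T * T) * T => H (z.1.2, (U z.1.1, Z z.2)))) => //.
  apply: (measurableT_comp mH); apply: measurable_fun_pair.
    exact: (measurableT_comp measurable_snd measurable_fst).
  apply: measurable_fun_pair; last exact: (measurableT_comp mZ measurable_snd).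
  exact: (measurableT_comp mU (measurableT_comp measurable_fst measurable_fst)).
have HU0 (z : T * T) : 0 <= \int[P]_u' H (z.2, (U z.1, Z u')) by exact: integral_ge0.
apply: (etrans (fubini_tonelli (m1 := P) (m2 := P) _ mHU HU0)).
apply: eq_integral => v _.
apply: (etrans (esym (indep_integral mU mZ indepUZ (mHv v) (fun z => H0 _)))).
by apply: eq_integral => u _; rewrite /H/= mpE.
Qed.

End maximum_renewal.

(** * The maximum over the inspection epochs *)

Section inspection_sequence.
Context {R : realType}.
Implicit Types (y : @cadlag_path R) (e : rseq R).

(** The interarrival times are clipped at 0 so that the epochs of every
sequence are nondecreasing; this makes the recursion [inspected_maxS] hold
without hypotheses. *)
Definition epoch e k : R := \sum_(j < k) Num.max (e j) 0.

Definition inspected_max n (z : @cadlag_path R * rseq R) : R * R :=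
  let k := last_argmax (fun j => z.1 (epoch z.2 j)) n in
  (z.1 (epoch z.2 k), epoch z.2 k).

Lemma epoch_ge0 e k : 0 <= epoch e k.
Proof. by apply: sumr_ge0 => j _; exact: max0_ge0. Qed.

Lemma epoch0 e : epoch e 0 = 0.
Proof. by rewrite /epoch big_ord0. Qed.

Lemma epochS e k : epoch e k.+1 = epoch e k + Num.max (e k) 0.
Proof. by rewrite /epoch big_ord_recr. Qed.

Lemma epoch_tail e k : epoch e k.+1 = Num.max (e 0%N) 0 + epoch (tail_rseq 1 e) k.
Proof. by rewrite /epoch big_ord_recl. Qed.

Lemma epoch_head n e k : (k <= n)%N -> epoch (head_rseq n e) k = epoch e k.
Proof.
move=> kn; apply: eq_bigr => j _; rewrite /head_rseq (leq_trans (ltn_ord j) kn)//.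
Qed.

Lemma inspected_max0 z : inspected_max 0 z = 0.
Proof. by rewrite /inspected_max /= epoch0 path_start. Qed.

Lemma inspected_max_head n y e : inspected_max n (y, head_rseq n e) = inspected_max n (y, e).
Proof.
have [kn _ _] := last_argmaxP (fun j => y (epoch e j)) n.
rewrite /inspected_max/=.
rewrite (@last_argmax_ext _ _ (fun j => y (epoch e j))).
  by rewrite epoch_head.
by move=> j jn; rewrite epoch_head.
Qed.

(** The inspected maximum after n + 1 epochs is the one over 0 and the n + 1
values that follow; these are the first increment plus the walk inspected after
the first epoch, and the value 0 at the start wins exactly when they are all
negative. *)
Lemma inspected_maxS n y e : let s := Num.max (e 0%N) 0 in
  inspected_max n.+1 (y, e) =
  keep_nonneg ((y s, s) + inspected_max n (shift_path s y, tail_rseq 1 e)).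
Proof.
move=> s; have s0 : 0 <= s by exact: max0_ge0.
pose x j := y (epoch e j); pose x' j := shift_path s y (epoch (tail_rseq 1 e) j).
have xS j : x j.+1 = y s + x' j.
  by rewrite /x /x' shift_pathE// addrC subrK epoch_tail.
have x0 : x 0%N = 0 by rewrite /x epoch0 path_start.
have [kn ub lt] := last_argmaxP x' n.
set k := last_argmax x' n in kn ub lt.
have e1 : inspected_max n.+1 (y, e) =
  (x (last_argmax x n.+1), epoch e (last_argmax x n.+1)) by [].
have e2 : inspected_max n (shift_path s y, tail_rseq 1 e) =
  (x' k, epoch (tail_rseq 1 e) k) by [].
rewrite e1 e2 /keep_nonneg [(_ + _).1]/=.
have -> : last_argmax x n.+1 = if 0 <= y s + x' k then k.+1 else 0%N.
  apply: is_last_argmax_unique; case: ifPn => h; split => //.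
  - by move=> [|j] jn; rewrite ?x0 xS// xS lerD2l ub.
  - by move=> [|j]// jn; rewrite !xS ltrD2l; exact: (lt j jn).
  - move=> [|j] jn//; rewrite xS x0; move: h; rewrite -ltNge => /ltW; apply: le_trans.
    by rewrite lerD2l ub.
  - move=> [|j]// /andP[_ jn]; rewrite xS x0; move: h; rewrite -ltNge; apply: le_lt_trans.
    by rewrite lerD2l ub.
by case: ifP => h; rewrite ?xS ?x0 ?epoch_tail ?epoch0.
Qed.

Lemma measurable_epoch d (T : measurableType d) (e : T -> rseq R) k :
  measurable_fun setT e -> measurable_fun setT (fun w => epoch (e w) k).
Proof.
move=> me; elim: k => [|k ih].
  by under eq_fun do rewrite epoch0; exact: measurable_cst.
under eq_fun do rewrite epochS.
apply: measurable_funD => //; apply: measurable_maxr => //.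
exact: (measurableT_comp (measurable_rseq_eval k) me).
Qed.

Lemma measurable_inspected_max n : measurable_fun setT (inspected_max n).
Proof.
have me k : measurable_fun setT (fun z : @cadlag_path R * rseq R => epoch z.2 k).
  exact: (measurable_epoch _ measurable_snd).
have mx k : measurable_fun setT (fun z : @cadlag_path R * rseq R => z.1 (epoch z.2 k)).
  apply: (measurable_path_time (me k) measurable_fst) => z; exact: epoch_ge0.
apply: (measurable_fun_nat_index
  (k := fun z : @cadlag_path R * rseq R => last_argmax (fun j => z.1 (epoch z.2 j)) n)
  (f := fun k z => (z.1 (epoch z.2 k), epoch z.2 k))).
  by move=> k; exact: (measurable_last_argmax _ _ mx).
by move=> k; exact: measurable_fun_pair.
Qed.

Lemma observedE y (i : nat -> R) n : i 0%N = 0 -> observed y i n = y (i n).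
Proof.
move=> i0; rewrite /observed big_add1/= /observed_increment/=.
by rewrite telescope_sumr// i0 path_start subr0.
Qed.

Lemma observed_maxE y e n : let i := epoch e in
  (observed_max y i n, last_observed_max_epoch y i n) = inspected_max n (y, e).
Proof.
move=> i; have i0 : i 0%N = 0 by exact: epoch0.
pose x j := y (i j); have xE j : observed y i j = x j by exact: observedE.
have [kn ub lt] := last_argmaxP x n; rewrite /inspected_max/= -/i -/x.
set k := last_argmax x n in kn ub lt *.
have maxE : observed_max y i n = x k.
  apply/le_anti/andP; split.
    apply: bigmax_le => [|j _]; first by rewrite xE ub.
    by rewrite xE ub// -ltnS.
  rewrite -xE; apply: (le_bigmax_cond _ (fun j : 'I_n.+1 => observed y i j)
    (j := Ordinal (kn : (k < n.+1)%N))) => //.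
rewrite /last_observed_max_epoch maxE; congr (_, i _).
apply/eqP; rewrite eqn_leq; apply/andP; split.
  apply/bigmax_leqP => j /eqP; rewrite xE => xj; rewrite leqNgt; apply/negP => kj.
  by have := lt j; rewrite kj -ltnS ltn_ord xj ltxx => /(_ erefl).
by apply: (leq_bigmax_cond (F := fun j : 'I_n.+1 => nat_of_ord j) (Ordinal (kn : (k < n.+1)%N)));
  rewrite xE.
Qed.

End inspection_sequence.

Section inspected_renewal.
Local Open Scope ereal_scope.
Context {R : realType} d (T : measurableType d) (P : probability T R).
Variables (Z : T -> @cadlag_path R) (e : T -> rseq R) (beta omega : R) (U S : T -> R).
Hypotheses (beta0 : (0 < beta)%R) (omega0 : (0 < omega)%R).
Hypotheses (levyZ : levy_path P Z) (expU : exponential_rv P beta U)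
  (expS : exponential_rv P (beta + omega) S).
Hypotheses (expe : forall k, exponential_rv P omega (fun w => e w k))
  (indep_e : indep_seq P (fun k w => e w k)).
Hypotheses (e0 : forall w k, (0 <= e w k)%R)
  (S0 : forall w, (0 <= S w)%R).
Hypotheses (indepSZ : indep_rv P S Z) (indep_eZ : indep_rv P e Z)
  (indepU : indep_rv P U (fun w => (Z w, e w))).

Let a w := max_pair (S w) (Z w).
Let b w := gap_pair (S w) (Z w).
Let mZ := levy_path_measurable levyZ.
Let mS : measurable_fun setT S := expS.1.
Let mU : measurable_fun setT U := expU.1.
Let mek k : measurable_fun setT (fun w => e w k) := (expe k).1.
Let me : measurable_fun setT e.
Proof. exact: measurable_fun_rseq mek. Qed.

Let D := @cadlag_path R.

(** The conditional probability, given the epochs, that a clock of rate beta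
rings after the n-th epoch. *)
Definition survival_weight n (x : rseq R) : \bar R := (expR (- beta * epoch x n))%:E.

Let weight0 n x : 0 <= survival_weight n x.
Proof. by rewrite lee_fin expR_ge0. Qed.

Let mweight n : measurable_fun setT (survival_weight n).
Proof.
apply/measurable_EFinP; apply: (measurableT_comp (@measurable_expR R)).
by apply: measurable_funM => //; exact: (measurable_epoch n (@measurable_id _ _ setT)).
Qed.

Definition surviving_integral n (f : R * R -> \bar R) : \bar R :=
  \int[P]_w (survival_weight n (e w) * f (inspected_max n (Z w, e w))).

Lemma surviving_integral0 f : surviving_integral 0 f = f 0%R.
Proof.
rewrite /surviving_integral; transitivity (\int[P]_w (cst (f 0%R) w)).
  apply: eq_integral => w _.
  by rewrite inspected_max0 /survival_weight epoch0 mulr0 expR0 mul1e.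
by rewrite integral_cst//= probability_setT mule1.
Qed.

Section step.
Variables (n : nat) (f : R * R -> \bar R).
Hypotheses (mf : measurable_fun setT f) (f0 : forall x, 0 <= f x).

Let G (x : R * R) := surviving_integral n (fun z => f (keep_nonneg (x + z))%R).

Let Psi (z : (R * R) * (D * rseq R)) : \bar R :=
  survival_weight n z.2.2 * f (keep_nonneg (z.1 + inspected_max n z.2))%R.

Let mPsi : measurable_fun setT Psi.
Proof.
apply: emeasurable_funM.
  exact: (measurableT_comp (mweight n) (measurableT_comp measurable_snd measurable_snd)).
apply: (measurableT_comp mf); apply: (measurableT_comp measurable_keep_nonneg).
apply: measurable_pair_add; first exact: measurable_fst.
exact: (measurableT_comp (measurable_inspected_max n) measurable_snd).
Qed.

Let Psi0 z : 0 <= Psi z.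
Proof. by rewrite mule_ge0. Qed.

Let G0 x : 0 <= G x.
Proof. by apply: integral_ge0 => w _; rewrite mule_ge0. Qed.

Let mG : measurable_fun setT G.
Proof.
apply: (@measurable_integral_section _ _ _ _ _ P
  (fun z : (R * R) * T => Psi (z.1, (Z z.2, e z.2)))) => //.
apply: (measurableT_comp mPsi); apply: measurable_fun_pair; first exact: measurable_fst.
apply: measurable_fun_pair; first exact: (measurableT_comp mZ measurable_snd).
exact: (measurableT_comp me measurable_snd).
Qed.

Let indep_first : indep_rv P (fun w => e w 0%N) (fun w => (tail_rseq 1 (e w), Z w)).
Proof.
have mtail : measurable_fun setT (@tail_rseq R 1).
  by apply: measurable_fun_rseq => k; exact: measurable_rseq_eval.
apply: indep_rv_assoc => //; first exact: (measurableT_comp mtail me).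
  have := indep_seq_split 1 mek indep_e => i1.
  by have := indep_rv_comp (measurable_rseq_eval 0) (@measurable_id _ _ setT) i1.
have mpair : measurable_fun setT (fun x : rseq R => (x 0%N, tail_rseq 1 x)).
  by apply: measurable_fun_pair => //; exact: measurable_rseq_eval.
exact: (indep_rv_comp mpair (@measurable_id _ _ setT) indep_eZ).
Qed.

Let law_tail : eq_law P (fun w => (tail_rseq 1 (e w), Z w)) P (fun w => (e w, Z w)).
Proof.
have mtail : measurable_fun setT (@tail_rseq R 1).
  by apply: measurable_fun_rseq => k; exact: measurable_rseq_eval.
apply: eq_law_pair => //.
- apply: (@indep_seq_eq_law _ _ _ P (fun k w => e w (1 + k)%N)) => //.
  + exact: (indep_seq_shift 1 indep_e).
  + by move=> k A mA; rewrite (expe _).2// (expe _).2.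
- exact: (indep_rv_comp mtail (@measurable_id _ _ setT) indep_eZ).
Qed.

Let measurable_split t : (0 <= t)%R ->
  measurable_fun setT (fun v => Psi ((Z v t, t), (shift_path t (Z v), e v))).
Proof.
move=> t0; apply: (measurableT_comp mPsi); apply: measurable_fun_pair.
  apply: measurable_fun_pair => //.
  exact: (measurableT_comp (measurable_path_eval t0) mZ).
by apply: measurable_fun_pair => //; exact: measurable_shift_path.
Qed.

Let split_at t : (0 <= t)%R ->
  \int[P]_v Psi ((Z v t, t), (shift_path t (Z v), e v)) = \int[P]_v G (Z v t, t).
Proof.
move=> t0.
have mstop := measurableT_comp (measurable_stop_path t) mZ.
have mshift : measurable_fun setT (fun w => shift_path t (Z w)).
  exact: measurable_shift_path.
have [_ iZ sZ] := levyZ.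
have i1 : indep_rv P (fun v => stop_path t (Z v)) (fun v => (shift_path t (Z v), e v)).
  apply: indep_rv_assoc => //; first exact: iZ.
  have mss : measurable_fun setT (fun y : D => (stop_path t y, shift_path t y)).
    by apply: measurable_fun_pair; [exact: measurable_stop_path|exact: measurable_shift_path].
  exact: (indep_rv_comp mss (@measurable_id _ _ setT) (indep_rv_sym indep_eZ)).
have l1 : eq_law P (fun v => (shift_path t (Z v), e v)) P (fun v => (Z v, e v)).
  apply: eq_law_pair => //; first exact: sZ; last exact: indep_rv_sym.
  have msh : measurable_fun setT (shift_path t : D -> D) by exact: measurable_shift_path.
  exact: (indep_rv_comp msh (@measurable_id _ _ setT) (indep_rv_sym indep_eZ)).
pose F (z : D * (D * rseq R)) := Psi ((z.1 t, t), z.2).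
have mF : measurable_fun setT F.
  apply: (measurableT_comp mPsi); apply: measurable_fun_pair; last exact: measurable_snd.
  apply: measurable_fun_pair => //.
  exact: (measurableT_comp (measurable_path_eval t0) measurable_fst).
have stopE v : stop_path t (Z v) t = Z v t by rewrite stop_pathE.
transitivity (\int[P]_v F (stop_path t (Z v), (shift_path t (Z v), e v))).
  by apply: eq_integral => v _; rewrite -(stopE v).
apply: (etrans (indep_integral mstop (measurable_fun_pair mshift me) i1 mF (fun z => Psi0 _))).
apply: eq_integral => v _.
apply: (etrans (eq_law_integral (f := fun z => F (stop_path t (Z v), z)) l1 _ _)).
- exact: (measurableT_comp mF (pair1_measurable _)).
- by move=> z; exact: Psi0.
- by apply: eq_integral => u _; rewrite -(stopE v).
Qed.

(** The first interarrival time is independent of the later ones and of the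
path. Its weight exp (- beta e 0) tilts it to the rate beta + omega, which gives
the factor p; the path is then split at this time by the Markov property, and
the increment up to it is a + b with a and b independent. *)
Lemma surviving_integralS :
  surviving_integral n.+1 f = (omega / (beta + omega))%:E *
  \int[P]_w \int[P]_v surviving_integral n
    (fun x => f (keep_nonneg (a w + b v + x)))%R.
Proof.
pose H (z : R * (rseq R * D)) : \bar R := (expR (- beta * Num.max z.1 0%R))%:E *
  Psi ((z.2.2 (Num.max z.1 0%R), Num.max z.1 0%R),
       (shift_path (Num.max z.1 0%R) z.2.2, z.2.1)).
have mmax : measurable_fun setT (fun z : R * (rseq R * D) => Num.max z.1 0%R).
  by apply: measurable_maxr; [exact: measurable_fst|exact: measurable_cst].
have mpath : measurable_fun setT (fun z : R * (rseq R * D) => z.2.2).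
  exact: (measurableT_comp measurable_snd measurable_snd).
have mH : measurable_fun setT H.
  apply: emeasurable_funM.
    apply/measurable_EFinP; apply: (measurableT_comp (@measurable_expR R)).
    by apply: measurable_funM => //.
  apply: (measurableT_comp mPsi); apply: measurable_fun_pair.
    apply: measurable_fun_pair => //.
    by apply: (measurable_path_time mmax mpath) => z; exact: max0_ge0.
  apply: measurable_fun_pair; first exact: measurable_shift_path.
  exact: (measurableT_comp measurable_fst measurable_snd).
have H0 z : 0 <= H z by rewrite mule_ge0// lee_fin expR_ge0.
have [mtZ _ _] := law_tail.
transitivity (\int[P]_w H (e w 0%N, (tail_rseq 1 (e w), Z w))).
  apply: eq_integral => w _; rewrite inspected_maxS /H /Psi/= muleA; congr (_ * _).
  by rewrite /survival_weight epoch_tail mulrDr expRD.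
apply: (etrans (indep_integral (mek 0) mtZ indep_first mH H0)).
pose g (t : R) := \int[P]_v G (Z v (Num.max t 0%R), Num.max t 0%R).
have mg : measurable_fun setT g.
  apply: (@measurable_integral_section _ _ _ _ _ P
    (fun z : R * T => G (Z z.2 (Num.max z.1 0%R), Num.max z.1 0%R))) => //.
  have mm : measurable_fun setT (fun z : R * T => Num.max z.1 0%R).
    by apply: measurable_maxr; [exact: measurable_fst|exact: measurable_cst].
  apply: (measurableT_comp mG); apply: measurable_fun_pair => //.
  apply: (measurable_path_time mm (measurableT_comp mZ measurable_snd)) => z.
  exact: max0_ge0.
transitivity (\int[P]_w ((expR (- beta * e w 0%N))%:E * g (e w 0%N))).
  apply: eq_integral => w _.
  apply: (etrans (eq_law_integral (f := fun z => H (e w 0%N, z)) law_tail _ _)).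
  - exact: (measurableT_comp mH (pair1_measurable _)).
  - by move=> z; exact: H0.
  set t := e w 0%N; have t0 : (0 <= t)%R by exact: e0.
  have gE : g t = \int[P]_v Psi ((Z v t, t), (shift_path t (Z v), e v)).
    by apply: (etrans _ (esym (split_at t0))); rewrite /g max_l.
  rewrite gE; apply: (etrans _ (ge0_integralZl_EFin P measurableT
    (fun v _ => Psi0 _) (measurable_split t0) (expR_ge0 _))).
  by apply: eq_integral => v _; rewrite /H [(_, _).1]/= max_l.
have expS' := expS; rewrite addrC in expS'.
rewrite [X in (omega / X)%R](addrC beta omega).
apply: (etrans (exponential_rv_tilt omega0 beta0 (expe 0) expS' mg _)).
  by move=> t; exact: integral_ge0.
apply: (congr1 (fun z => _ * z)).
have mGD : measurable_fun setT (fun z : (R * R) * (R * R) => G (z.1 + z.2)%R).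
  apply: (measurableT_comp mG); apply: measurable_pair_add.
    exact: measurable_fst.
  exact: measurable_snd.
apply: (etrans _ (independent_sum_at_exponential
  beta0 omega0 levyZ expS S0 indepSZ mGD (fun z => G0 _))).
apply: eq_integral => w _; apply: eq_integral => v _; rewrite max_l//=.
by congr (G _); congr pair; rewrite /= addrC subrK.
Qed.

End step.

Lemma surviving_integral_cst1 n :
  surviving_integral n (cst 1) = ((omega / (beta + omega)) ^+ n)%:E.
Proof.
elim: n => [|n ih]; first by rewrite surviving_integral0.
rewrite surviving_integralS//.
rewrite exprS (EFinM _ (_ ^+ n)); apply: (congr1 (fun z => _ * z)).
transitivity (\int[P]_w (cst ((omega / (beta + omega)) ^+ n)%:E w)).
  apply: eq_integral => w _.
  transitivity (\int[P]_v (cst ((omega / (beta + omega)) ^+ n)%:E v)).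
    by apply: eq_integral => v _; exact: ih.
  by rewrite integral_cst//= probability_setT mule1.
by rewrite integral_cst//= probability_setT mule1.
Qed.

Definition in_window n w : bool := (epoch (e w) n < U w <= epoch (e w) n.+1)%R.

Let first_window (t : R) := \int[P]_v ((0 < U v <= t)%R%:R : R)%:E.

Let first_window0 t : 0 <= first_window t.
Proof. by apply: integral_ge0 => v _; rewrite lee_fin. Qed.

Let measurable_between d' (E : measurableType d') (x y z : E -> R) :
  measurable_fun setT x -> measurable_fun setT y -> measurable_fun setT z ->
  measurable_fun setT (fun w => ((x w < y w <= z w)%R%:R : R)%:E).
Proof.
move=> mx my mz; apply: measurable_natr_bool; apply: measurable_and.
  exact: measurable_fun_ltr.
exact: measurable_fun_ler.
Qed.

Let measurable_first_window : measurable_fun setT first_window.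
Proof.
apply: (@measurable_integral_section _ _ _ _ _ P
  (fun z : R * T => ((0 < U z.2 <= z.1)%R%:R : R)%:E)); last by move=> z; rewrite lee_fin.
apply: (@measurable_between _ _ (cst 0%R)) => //.
exact: (measurableT_comp mU measurable_snd).
Qed.

(** Given that the clock U has not rung at time s, the time it still takes is a
copy of U. *)
Let window_integral s t : (0 <= s)%R ->
  \int[P]_v ((s < U v <= s + t)%R%:R : R)%:E = (expR (- beta * s))%:E * first_window t.
Proof.
move=> s0.
have mg : measurable_fun setT (fun u : R => ((s < u <= s + t)%R%:R : R)%:E).
  exact: (@measurable_between _ _ (cst s) id (cst (s + t)%R)).
have g0 u : 0 <= ((s < u <= s + t)%R%:R : R)%:E by rewrite lee_fin.
transitivity (\int[P]_v (((s <= U v)%R%:R)%:E * ((s < U v <= s + t)%R%:R : R)%:E)).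
  apply: eq_integral => v _; have [h|h] := leP s (U v); first by rewrite mul1e.
  by rewrite (ltNge s) (ltW h) mul0e.
apply: (etrans (exponential_rv_memoryless beta0 s0 expU mg g0)).
by congr (_ * _); apply: eq_integral => v _; rewrite ltrDl lerD2l.
Qed.

(** The window is missed only when the interarrival time is shorter than U,
which has probability omega / (beta + omega). *)
Let mean_first_window n :
  \int[P]_w first_window (e w n) = (beta / (beta + omega))%:E.
Proof.
have mlt : measurable_fun setT (fun z : T * T => ((e z.1 n < U z.2)%R%:R : R)%:E).
  apply: measurable_natr_bool; apply: measurable_fun_ltr.
    exact: (measurableT_comp (mek n) measurable_fst).
  exact: (measurableT_comp mU measurable_snd).
have lt0 z : 0 <= ((e z.1 n < U z.2)%R%:R : R)%:E by rewrite lee_fin.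
have mItail : measurable_fun setT (fun w => \int[P]_v ((e w n < U v)%R%:R : R)%:E).
  apply: (@measurable_integral_section _ _ _ _ _ P
    (fun z : T * T => ((e z.1 n < U z.2)%R%:R : R)%:E)) => //.
have mean_tail : \int[P]_w \int[P]_v ((e w n < U v)%R%:R : R)%:E = (omega / (beta + omega))%:E.
  transitivity (\int[P]_w ((expR (- beta * e w n))%:E * cst 1 (e w n))).
    by apply: eq_integral => w _; rewrite mule1 (exponential_rv_gt beta0 (e0 w n) expU).
  have expS' := expS; rewrite addrC in expS'.
  apply: (etrans (exponential_rv_tilt omega0 beta0 (expe n) expS'
    (measurable_cst _) (fun=> lee01))).
  by rewrite integral_cst//= probability_setT !mule1 addrC.
have total : \int[P]_w first_window (e w n) +
    \int[P]_w \int[P]_v ((e w n < U v)%R%:R : R)%:E = 1.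
  rewrite -ge0_integralD//; last 2 first.
  - exact: (measurableT_comp measurable_first_window (mek n)).
  - by move=> w _; exact: integral_ge0.
  transitivity (\int[P]_w (cst 1 w)); last by rewrite integral_cst//= probability_setT mule1.
  apply: eq_integral => w _; rewrite /first_window -ge0_integralD//.
  - apply: (etrans _ (etrans (exponential_rv_gt beta0 (lexx 0%R) expU) _)); last first.
      by rewrite mulr0 expR0.
    apply: eq_integral => v _; rewrite -EFinD -natrD; congr ((_%:R)%:E).
    have := e0 w n; case: (ltP 0%R (U v)); case: (ltP (e w n) (U v)) => //=.
    by move=> h1 h2 h3; have := lt_le_trans h1 (le_trans h2 h3); rewrite ltxx.
  - exact: (@measurable_between _ _ (cst 0%R) U (cst (e w n))).
  - exact: (measurableT_comp mlt (pair1_measurable w)).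
move: total; rewrite mean_tail; have i0 : 0 <= \int[P]_w first_window (e w n).
  by apply: integral_ge0 => w _.
case: (\int[P]_w first_window (e w n)) i0 => [x||]// _; rewrite -EFinD => -[xE].
congr EFin; apply: (addIr (omega / (beta + omega))%R); rewrite xE.
by rewrite -mulrDl divff// gt_eqF// addr_gt0.
Qed.

(** Given the path and the epochs, U falls between epochs n and n + 1 with
probability [survival_weight] n times a function of the next interarrival time
alone, which is independent of the path up to epoch n; its mean is
beta / (beta + omega). *)
Lemma window_inspected_integral n (f : R * R -> \bar R) :
  measurable_fun setT f -> (forall x, 0 <= f x) ->
  \int[P]_w ((in_window n w)%:R%:E * f (inspected_max n (Z w, e w))) =
  (beta / (beta + omega))%:E * surviving_integral n f.
Proof.
move=> mf f0.
have mpair := measurable_fun_pair mZ me.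
have mfi : measurable_fun setT (fun z => f (inspected_max n z)).
  exact: (measurableT_comp mf (measurable_inspected_max n)).
pose H (z : (D * rseq R) * R) := ((epoch z.1.2 n < z.2 <= epoch z.1.2 n.+1)%R%:R : R)%:E *
  f (inspected_max n z.1).
have mep k : measurable_fun setT (fun z : (D * rseq R) * R => epoch z.1.2 k).
  by apply: measurable_epoch; exact: (measurableT_comp measurable_snd measurable_fst).
have mH : measurable_fun setT H.
  apply: emeasurable_funM; last exact: (measurableT_comp mfi measurable_fst).
  exact: (@measurable_between _ _ (fun z : (D * rseq R) * R => epoch z.1.2 n) snd).
have H0 z : 0 <= H z by rewrite mule_ge0// lee_fin.
apply: (etrans (indep_integral (f := H) mpair mU (indep_rv_sym indepU) mH H0)).
pose K (z : (rseq R * D) * R) := survival_weight n z.1.1 * f (inspected_max n (z.1.2, z.1.1)) *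
  first_window z.2.
have mhead : measurable_fun setT (@head_rseq R n).
  apply: measurable_fun_rseq => k; rewrite /head_rseq.
  by case: (k < n)%N; [exact: measurable_rseq_eval|exact: measurable_cst].
have mheade := measurableT_comp mhead me.
have mK1 : measurable_fun setT (fun z : rseq R * D => survival_weight n z.1 *
    f (inspected_max n (z.2, z.1))).
  apply: emeasurable_funM; first exact: (measurableT_comp (mweight n) measurable_fst).
  by apply: (measurableT_comp mfi); apply: measurable_fun_pair;
    [exact: measurable_snd|exact: measurable_fst].
have mK : measurable_fun setT K.
  apply: emeasurable_funM; first exact: (measurableT_comp mK1 measurable_fst).
  exact: (measurableT_comp measurable_first_window measurable_snd).
have K0 z : 0 <= K z by rewrite mule_ge0// mule_ge0.
have indep_next : indep_rv P (fun w => (head_rseq n (e w), Z w)) (fun w => e w n).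
  apply: indep_rv_sym; apply: indep_rv_assoc => //.
    have i1 := indep_rv_sym (indep_seq_split n mek indep_e).
    have := indep_rv_comp (measurable_rseq_eval 0) (@measurable_id _ _ setT) i1.
    by rewrite /tail_rseq addn0.
  have mm : measurable_fun setT (fun x : rseq R => (x n, head_rseq n x)).
    by apply: measurable_fun_pair => //; exact: measurable_rseq_eval.
  exact: (indep_rv_comp mm (@measurable_id _ _ setT) indep_eZ).
transitivity (\int[P]_w K ((head_rseq n (e w), Z w), e w n)).
  apply: eq_integral => w _; rewrite /H/=.
  have mw : measurable_fun setT
      (fun v => ((epoch (e w) n < U v <= epoch (e w) n.+1)%R%:R : R)%:E).
    exact: (@measurable_between _ _ (cst (epoch (e w) n)) U (cst (epoch (e w) n.+1))).
  rewrite ge0_integralZr//.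
  rewrite epochS (max_l (e0 w n)) window_integral ?epoch_ge0// /K/=.
  rewrite inspected_max_head /survival_weight epoch_head// -!muleA; congr (_ * _).
  exact: muleC.
apply: (etrans (indep_integral (measurable_fun_pair mheade mZ) (mek n) indep_next mK K0)).
have fwZ : measurable_fun setT (fun v => first_window (e v n)).
  exact: (measurableT_comp measurable_first_window (mek n)).
transitivity (\int[P]_w (survival_weight n (e w) * f (inspected_max n (Z w, e w)) *
    (beta / (beta + omega))%:E)).
  apply: eq_integral => w _; rewrite /K/= ge0_integralZl//; last first.
    by rewrite mule_ge0.
  by rewrite mean_first_window inspected_max_head /survival_weight epoch_head.
rewrite muleC /surviving_integral; apply: ge0_integralZr => //.
- apply: (measurableT_comp mK1 (measurable_fun_pair me mZ)).
- by move=> w _; rewrite mule_ge0.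
- by rewrite lee_fin divr_ge0// ?addr_ge0// ltW.
Qed.

Lemma in_window_unique n m w : in_window n w -> in_window m w -> n = m.
Proof.
have mono k j : (k <= j)%N -> (epoch (e w) k <= epoch (e w) j)%R.
  move=> /subnK <-; elim: (j - k)%N => // i ih; rewrite addSn epochS.
  by rewrite (le_trans ih)// lerDl max0_ge0.
have lt k j : (k < j)%N -> in_window k w -> in_window j w -> False.
  move=> kj /andP[_ h1] /andP[h2 _].
  by have := lt_le_trans h2 (le_trans h1 (mono _ _ kj)); rewrite ltxx.
by move=> hn hm; case: (ltngtP n m) => // h; [case: (lt _ _ h hn hm)|case: (lt _ _ h hm hn)].
Qed.

Lemma measurable_in_window n : measurable [set w | in_window n w].
Proof.
have mw : measurable_fun setT (in_window n).
  by apply: measurable_and; [apply: measurable_fun_ltr|apply: measurable_fun_ler] => //;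
    exact: measurable_epoch.
by have := mw measurableT [set true]; rewrite setTI; exact.
Qed.

Let measurable_in_window_fun n : measurable_fun setT (fun w => (in_window n w)%:R%:E : \bar R).
Proof.
apply: measurable_natr_bool.
by apply: measurable_and; [apply: measurable_fun_ltr|apply: measurable_fun_ler] => //;
  exact: measurable_epoch.
Qed.

Let prob_in_window n : P [set w | in_window n w] =
  (beta / (beta + omega) * (omega / (beta + omega)) ^+ n)%:E.
Proof.
rewrite EFinM -surviving_integral_cst1 -window_inspected_integral//.
have := integral_indic P measurableT (measurable_in_window n).
rewrite setIT => <-; apply: eq_integral => w _; rewrite indicE.
have -> : w \in [set w | in_window n w] = in_window n w by apply/idP/idP; rewrite inE.
by rewrite mule1.
Qed.

(** The windows are disjoint, and their probabilities q p ^ n add up to 1. In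
particular it is almost impossible that infinitely many epochs precede U. *)
Lemma in_window_ae : P (~` \bigcup_n [set w | in_window n w]) = 0.
Proof.
have bo : (0 < beta + omega)%R by exact: addr_gt0.
set B := \bigcup_n _; have mB : measurable B.
  by apply: bigcupT_measurable => n; exact: measurable_in_window.
have PB : P B = 1.
  rewrite /B measure_bigcup//; last 2 first.
  - by move=> n _; exact: measurable_in_window.
  - apply/trivIsetP => i j _ _ ij; apply/seteqP; split => // w.
    by move=> [/in_window_unique h /h /eqP]; rewrite (negbTE ij).
  apply: cvg_lim => //.
  pose q := (beta / (beta + omega))%R; pose p := (omega / (beta + omega))%R.
  have pq : (1 - p = q)%R by rewrite /p /q; field; rewrite gt_eqF.
  rewrite [X in X @ _ --> _](_ : _ = (fun n => (1 - p ^+ n)%:E)); last first.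
    apply/funext => n; transitivity (\sum_(0 <= k < n) (q * p ^+ k)%:E).
      by apply: eq_big => [k|k _]; [rewrite in_setT|exact: prob_in_window].
    rewrite sumEFin; congr EFin; rewrite big_mkord -mulr_sumr -pq.
    elim: n => [|n ih]; first by rewrite big_ord0 mulr0 expr0 subrr.
    by rewrite big_ord_recr/= mulrDr ih exprS; ring.
  have p1 : (`|p| < 1)%R.
    rewrite ger0_norm /p ?divr_ge0 ?(ltW omega0) ?(ltW bo)//.
    by rewrite ltr_pdivrMr// mul1r ltrDr.
  have lim1 : (1 - p ^+ n)%R @[n --> \oo] --> (1 : R)%R.
    have := @cvgB _ R^o nat \oo _ (fun=> 1%R) (fun n => p ^+ n)%R 1%R 0%R (cvg_cst _) (cvg_expr p1).
    by rewrite subr0 => h; exact: (h _ _).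
  by apply: cvg_EFin; [exact: nearW|exact: lim1].
have := probability_setC P mB => h; apply: (etrans h).
by rewrite PB subee.
Qed.

Section inspected_value.
Variable C : T -> R * R.
Hypothesis mC : measurable_fun setT C.
Hypothesis CE : forall n w, in_window n w -> C w = inspected_max n (Z w, e w).

(** C may take any value on the null event outside all windows. *)
Let inspected_integral (f : R * R -> \bar R) :
  measurable_fun setT f -> (forall x, 0 <= f x) ->
  \int[P]_w f (C w) = (beta / (beta + omega))%:E * \sum_(n <oo) surviving_integral n f.
Proof.
move=> mf f0.
have mZe := measurable_fun_pair mZ me.
have mi n : measurable_fun setT (fun w => (in_window n w)%:R%:E * f (inspected_max n (Z w, e w))).
  apply: emeasurable_funM => //; apply: (measurableT_comp mf).
  exact: (measurableT_comp (measurable_inspected_max n) mZe).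
have i0 n w : 0 <= (in_window n w)%:R%:E * f (inspected_max n (Z w, e w)).
  by rewrite mule_ge0// lee_fin.
have s0 n : 0 <= surviving_integral n f.
  by apply: integral_ge0 => w _; rewrite mule_ge0.
rewrite -nneseriesZl//.
under eq_eseriesr do rewrite -window_inspected_integral//.
rewrite -integral_nneseries//.
apply: ge0_ae_eq_integral => //.
- exact: (measurableT_comp mf mC).
- exact: ge0_emeasurable_sum.
- by move=> w _; exact: nneseries_ge0.
- exists (~` \bigcup_n [set w | in_window n w]); split => //.
  + by apply: measurableC; apply: bigcupT_measurable => n; exact: measurable_in_window.
  + exact: in_window_ae.
  + move=> w /= H [n _ nw]; apply: H => _.
    rewrite (@nneseries_single _ _ n)//.
      by rewrite nw mul1e (CE nw).
    move=> k kn; case: (boolP (in_window k w)) => [kw|_]; last by rewrite mul0e.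
    by rewrite (in_window_unique kw nw) eqxx in kn.
Qed.

(** Summing over the windows, the term n = 0 is q f(0), and the others are
rewritten by [surviving_integralS] and summed again under the integral. *)
Lemma inspected_renewal (f : R * R -> \bar R) :
  measurable_fun setT f -> (forall x, 0 <= f x) ->
  \int[P]_w f (C w) = (beta / (beta + omega))%:E * f 0%R +
    (omega / (beta + omega))%:E * \int[P]_w \int[P]_v \int[P]_u
      f (keep_nonneg (a w + b v + C u))%R.
Proof.
move=> mf f0.
pose q := (beta / (beta + omega))%R; pose p := (omega / (beta + omega))%R.
have q0 : (0 <= q)%R by rewrite divr_ge0// ?addr_ge0// ltW.
have p0 : (0 <= p)%R by rewrite divr_ge0// ?addr_ge0// ltW.
rewrite -/q -/p inspected_integral// -/q.
have ma : measurable_fun setT a by exact: measurable_max_pair.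
have mb : measurable_fun setT b by exact: measurable_gap_pair.
pose h (x z : R * R) := f (keep_nonneg (x + z))%R.
have mh2 : measurable_fun setT (fun z : (R * R) * (R * R) => h z.1 z.2).
  apply: (measurableT_comp mf); apply: (measurableT_comp measurable_keep_nonneg).
  by apply: measurable_pair_add; [exact: measurable_fst|exact: measurable_snd].
have mh x : measurable_fun setT (h x).
  exact: (measurableT_comp mh2 (pair1_measurable x)).
have h0 x z : 0 <= h x z by exact: f0.
have s0 n g : (forall x, 0 <= g x) -> 0 <= surviving_integral n g.
  by move=> g0; apply: integral_ge0 => w _; rewrite mule_ge0.
pose L n (x : R * R) := surviving_integral n (h x).
have mL n : measurable_fun setT (L n).
  apply: (@measurable_integral_section _ _ _ _ _ P (fun z : (R * R) * T =>
    survival_weight n (e z.2) * h z.1 (inspected_max n (Z z.2, e z.2)))).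
    apply: emeasurable_funM.
      exact: (measurableT_comp (mweight n) (measurableT_comp me measurable_snd)).
    have mg : measurable_fun setT (fun z : (R * R) * T =>
        (z.1, inspected_max n (Z z.2, e z.2))).
      apply: measurable_fun_pair; first exact: measurable_fst.
      apply: (measurableT_comp (measurable_inspected_max n)).
      apply: measurable_fun_pair; [exact: (measurableT_comp mZ measurable_snd)|].
      exact: (measurableT_comp me measurable_snd).
    exact: (measurableT_comp mh2 mg).
  by move=> z; rewrite mule_ge0.
have mLab n : measurable_fun setT (fun z : T * T => L n (a z.1 + b z.2)%R).
  apply: (measurableT_comp (mL n)); apply: measurable_pair_add.
    exact: (measurableT_comp ma measurable_fst).
  exact: (measurableT_comp mb measurable_snd).
have L0 n x : 0 <= L n x by exact: s0.
have mLw n w : measurable_fun setT (fun v => L n (a w + b v)%R).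
  exact: (measurableT_comp (mLab n) (pair1_measurable w)).
have mLi n : measurable_fun setT (fun w => \int[P]_v L n (a w + b v)%R).
  by apply: (@measurable_integral_section _ _ _ _ _ P (fun z : T * T => L n (a z.1 + b z.2)%R)).
have e1 : \int[P]_w \int[P]_v \int[P]_u f (keep_nonneg (a w + b v + C u))%R =
    q%:E * \sum_(n <oo) \int[P]_w \int[P]_v L n (a w + b v)%R.
  transitivity (\int[P]_w (q%:E * \sum_(n <oo) \int[P]_v L n (a w + b v)%R)).
    apply: eq_integral => w _.
    transitivity (\int[P]_v (q%:E * \sum_(n <oo) L n (a w + b v)%R)).
      by apply: eq_integral => v _; exact: (inspected_integral (mh _) (h0 _)).
    rewrite ge0_integralZl_EFin//.
    - by rewrite integral_nneseries.
    - by move=> v _; exact: nneseries_ge0.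
    - exact: ge0_emeasurable_sum.
  rewrite ge0_integralZl_EFin//.
  - by rewrite integral_nneseries// => n w _; exact: integral_ge0.
  - by move=> w _; apply: nneseries_ge0 => n _ _; exact: integral_ge0.
  - by apply: ge0_emeasurable_sum => // n w _ _; exact: integral_ge0.
have I0 n : 0 <= \int[P]_w \int[P]_v L n (a w + b v)%R.
  by do 2 (apply: integral_ge0 => ? _); exact: L0.
rewrite e1 muleCA -ge0_muleDr//; last by rewrite mule_ge0// nneseries_ge0.
congr (_ * _); rewrite nneseries_recl//; last by move=> n _; exact: s0.
rewrite surviving_integral0; congr (_ + _).
rewrite -nneseries_addn; last by move=> n; exact: s0.
rewrite -nneseriesZl//.
by apply: eq_eseriesr => n _; rewrite addn1 surviving_integralS.
Qed.

End inspected_value.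

End inspected_renewal.

(** * Independence of processes and generated sigma-algebras *)

Section independent_lists.
Local Open Scope ereal_scope.
Context {R : realType} d (T : measurableType d) (P : probability T R).

Lemma independent_systems_prod (J : finType) (F : J -> set (set T)) (A : J -> set T) :
  independent_systems P F -> (forall j, F j (A j)) ->
  P (\bigcap_j A j) = (\prod_(j : J) fine (P (A j)))%:E.
Proof.
move=> iF FA; have := iF [fset j | j in J]%fset A (fun j _ => FA j).
rewrite big_imfset//= big_enum/= => <-; congr (P _).
by apply/seteqP; split => w wA j /= jT; apply: wA => //; apply/imfsetP; exists j.
Qed.

Lemma independent_list2 (F1 F2 : set (set T)) A1 A2 :
  independent_list P [:: F1; F2] -> F1 A1 -> F2 A2 ->
  measurable A1 -> measurable A2 -> P (A1 `&` A2) = P A1 * P A2.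
Proof.
move=> iF FA1 FA2 m1 m2.
have := independent_systems_prod (A := fun i : 'I_2 => nth set0 [:: A1; A2] i) iF.
rewrite !big_ord_recl big_ord0 /= mulr1 EFinM !fineK ?fin_num_measure// => <-.
  congr (P _); apply/seteqP; split => w /=.
    by move=> [w1 w2] [[|[|]]].
  by move=> H; split; [exact: (H ord0)|exact: (H (lift ord0 ord0))].
by case=> [[|[|]]].
Qed.

Lemma independent_list3 (F1 F2 F3 : set (set T)) A1 A2 A3 :
  independent_list P [:: F1; F2; F3] -> F1 A1 -> F2 A2 -> F3 A3 ->
  measurable A1 -> measurable A2 -> measurable A3 ->
  P (A1 `&` A2 `&` A3) = P A1 * P A2 * P A3.
Proof.
move=> iF FA1 FA2 FA3 m1 m2 m3.
have := independent_systems_prod (A := fun i : 'I_3 => nth set0 [:: A1; A2; A3] i) iF.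
rewrite !big_ord_recl big_ord0 /= mulr1 !EFinM !fineK ?fin_num_measure// muleA => <-.
  congr (P _); apply/seteqP; split => w /=.
    by move=> [[w1 w2] w3] [[|[|[|]]]].
  move=> H; split; [split|].
  - exact: (H ord0).
  - exact: (H (lift ord0 ord0)).
  - exact: (H (lift ord0 (lift ord0 ord0))).
by case=> [[|[|[|]]]].
Qed.

(** The product rule for two events contains the rules for all subfamilies,
because the whole space is a preimage. *)
Lemma indep_rv_independent_list d1 d2 (E1 : measurableType d1) (E2 : measurableType d2)
    (X : T -> E1) (Y : T -> E2) : measurable_fun setT X -> measurable_fun setT Y ->
  indep_rv P X Y -> independent_list P [:: sigma_rv X; sigma_rv Y].
Proof.
move=> mX mY iXY K A FA.
(* indices outside K receive the whole space, so that K may be taken to be everything *)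
pose B (j : 'I_2) := if j \in K then A j else setT.
have [B1 mB1 B1E] : exists2 B1, measurable B1 & X @^-1` B1 = B ord0.
  rewrite /B; case: ifP => [h|_]; last by exists setT.
  by have [B1 mB1 <-] := FA _ h; exists B1; rewrite ?setTI.
have [B2 mB2 B2E] : exists2 B2, measurable B2 & Y @^-1` B2 = B (lift ord0 ord0).
  rewrite /B; case: ifP => [h|_]; last by exists setT.
  by have [B2 mB2 <-] := FA _ h; exists B2; rewrite ?setTI.
have -> : \bigcap_(j in [set` K]) A j = X @^-1` B1 `&` Y @^-1` B2.
  rewrite B1E B2E; apply/seteqP; split => w /=.
    by move=> H; rewrite /B; split; case: ifP => // jK; exact: H.
  move=> [H1 H2] j /= jK; suff : B j w by rewrite /B (_ : j \in K).
  by case: (unliftP ord0 j) {jK} => [k|] ->//; rewrite (ord1 k).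
rewrite iXY//.
have -> : (\prod_(j <- K) fine (P (A j)) = \prod_(j : 'I_2) fine (P (B j)))%R.
  rewrite big_uniq ?fset_uniq// big_mkcond/=; apply: eq_bigr => j _.
  by rewrite /B; case: ifP => // _; rewrite probability_setT.
rewrite !big_ord_recl big_ord0 mulr1 EFinM -B1E -B2E !fineK ?fin_num_measure//;
  exact: preimage_measurable.
Qed.

Lemma indep_rv_triple d1 d2 d3 (E1 : measurableType d1) (E2 : measurableType d2)
    (E3 : measurableType d3) (X : T -> E1) (Y : T -> E2) (W : T -> E3) :
  measurable_fun setT X -> measurable_fun setT Y -> measurable_fun setT W ->
  (forall A B C, measurable A -> measurable B -> measurable C ->
    P (X @^-1` A `&` Y @^-1` B `&` W @^-1` C) =
    P (X @^-1` A) * P (Y @^-1` B) * P (W @^-1` C)) ->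
  indep_rv P X Y /\ indep_rv P (fun w => (X w, Y w)) W.
Proof.
move=> mX mY mW H.
have iXY : indep_rv P X Y.
  move=> A B mA mB; have := H A B setT mA mB measurableT.
  by rewrite preimage_setT setIT probability_setT mule1.
split => // A C mA mC; move: A mA.
apply: (indep_event_pi_system (@measurable_rectangles _ _ E1 E2)
  (@setI_closed_rectangles _ _ E1 E2) (measurable_fun_pair mX mY) (preimage_measurable mW mC)).
move=> _ [A1 mA1 [A2 mA2 <-]].
have e1 : (fun w => (X w, Y w)) @^-1` (A1 `*` A2) = X @^-1` A1 `&` Y @^-1` A2 by [].
by rewrite e1 H// iXY.
Qed.

End independent_lists.

Section process_sigma_algebra.
Context {R : realType} d (T : measurableType d) (P : probability T R).

(** The coordinates are measurable for the sigma-algebra they generate on the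
sample space, hence so is the path. *)
Lemma sigma_process_path (Y : R -> T -> R) (levyY : levy_process P Y) A :
  measurable A ->
  sigma_process [set t : R | 0 <= t] Y (path_of levyY @^-1` A).
Proof.
move=> mA; pose T' := g_sigma_algebraType
  (\bigcup_(t in [set t : R | 0 <= t]) sigma_rv (Y t)).
have mY t : 0 <= t -> measurable_fun setT (Y t : T' -> R).
  move=> t0 _ B mB; apply: sub_sigma_algebra; exists t => //; by exists B.
have mp : measurable_fun setT (path_of levyY : T' -> _).
  by apply: measurable_fun_path => t t0; exact: mY.
by have := mp measurableT A mA; rewrite setTI.
Qed.

Lemma sigma_process_increments (I : nat -> T -> R) A : measurable A ->
  sigma_process setT I (rseq_of (fun k w => I k.+1 w - I k w) @^-1` A).
Proof.
move=> mA; pose T' := g_sigma_algebraType (\bigcup_(k in setT) sigma_rv (I k)).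
have mI k : measurable_fun setT (I k : T' -> R).
  move=> _ B mB; apply: sub_sigma_algebra; exists k => //; by exists B.
have mp : measurable_fun setT (rseq_of (fun k w => I k.+1 w - I k w) : T' -> rseq R).
  by apply: measurable_fun_rseq => k; exact: measurable_funB.
by have := mp measurableT A mA; rewrite setTI.
Qed.

End process_sigma_algebra.

Section clipped_time.
Context {R : realType}.

(** An exponential time is almost surely nonnegative, so that clipping it does
not change its law. *)
Lemma exponential_rv_max0 d (T : measurableType d) (P : probability T R) r X : 0 < r ->
  exponential_rv P r X -> exponential_rv P r (fun w => Num.max (X w) 0).
Proof.
move=> r0 eX; have [mX lX] := eX; split; first exact: measurable_maxr.
move=> A mA; rewrite -lX//.
have mm : measurable_fun [set: R] (fun t : R => Num.max t 0) by exact: measurable_maxr.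
have prob (Z : T -> R) : measurable_fun setT Z ->
    P (Z @^-1` A) = (\int[P]_w (\1_A (Z w))%:E)%E.
  move=> mZ; have := integral_indic P measurableT (preimage_measurable mZ mA).
  by rewrite setIT => <-; apply: eq_integral => w _; rewrite !indicE.
have m1 : measurable_fun [set: R] (fun t : R => (\1_A t : R)%:E).
  by apply/measurable_EFinP; exact: measurable_indic.
rewrite !prob//; last exact: measurable_maxr.
apply: (exponential_rv_integral_ge0 (f := fun t => (\1_A (Num.max t 0) : R)%:E)
  (g := fun t => (\1_A t : R)%:E) r0 eX) => //.
- exact: (measurableT_comp m1 mm).
- by move=> t t0; rewrite max_l.
Qed.

(** For negative t both entries are suprema of the empty set, which are 0 by
convention; at time 0 they are 0 as well. *)
Lemma max_pair_max0 t (y : @cadlag_path R) : max_pair t y = max_pair (Num.max t 0) y.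
Proof.
have [t0|t0] := leP 0 t; first by [].
rewrite (@max_pairE _ 0 y 0 0); last first.
  split; rewrite ?lexx//.
  - by move=> s /le_anti <-; rewrite path_start.
  - move=> c e c0 ee0; exists 0; rewrite !lexx subrr normr0 path_start; split => //.
    by rewrite sub0r oppr_lt0.
  - move=> c c0; exists 1 => // s /andP[a b].
    by have := le_trans a b; rewrite add0r leNgt c0.
rewrite /max_pair /running_max /last_max_epoch.
have e : forall A : set R, A = set0 -> sup A = 0 by move=> A ->; exact: sup0.
congr pair; apply: e; apply/seteqP; split => // s.
- move=> [u /=]; rewrite in_itv/= => /andP[a b].
  by have := le_lt_trans (le_trans a b) t0; rewrite ltxx.
- move=> [/=]; rewrite in_itv/= => /andP[a b].
  by have := le_lt_trans (le_trans a b) t0; rewrite ltxx.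
Qed.

Lemma num_epochs_max0 (i : nat -> R) t : (forall n, 0 <= i n) ->
  num_epochs i (Num.max t 0) = num_epochs i t.
Proof.
move=> i0; rewrite /num_epochs; congr (#|` fset_set _|).
apply/seteqP; split => n /= [n0]; rewrite lt_max.
  by rewrite [i n < 0]ltNge i0 orbF.
by rewrite [i n < 0]ltNge i0 orbF.
Qed.

Lemma num_epochs_window (i : nat -> R) t n : (forall k j, (k <= j)%N -> i k <= i j) ->
  i n < t <= i n.+1 -> num_epochs i t = n.
Proof.
move=> mono /andP[h1 h2]; rewrite /num_epochs.
have -> : [set k | (0 < k)%N /\ i k < t] = [set` seq_fset tt (iota 1 n)].
  apply/seteqP; split => k.
    move=> [k0 ik]; suff : k \in seq_fset tt (iota 1 n) by [].
    rewrite seq_fsetE mem_iota add1n ltnS k0/= leqNgt; apply/negP => /mono nk.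
    by have := lt_le_trans ik (le_trans h2 nk); rewrite ltxx.
  move=> kn; have : k \in seq_fset tt (iota 1 n) by [].
  rewrite seq_fsetE mem_iota add1n ltnS => /andP[k0 /mono kn'].
  by split => //; exact: le_lt_trans kn' h1.
by rewrite set_fsetK size_seq_fset undup_id ?iota_uniq// size_iota.
Qed.

(** If infinitely many epochs precede t, the count is 0 by convention; hence a
positive count is always a true count. *)
Lemma num_epochs_gt0 (i : nat -> R) t : i 0%N = 0 -> (forall k j, (k <= j)%N -> i k <= i j) ->
  (0 < num_epochs i t)%N -> let n := num_epochs i t in i n < t <= i n.+1.
Proof.
move=> i0 mono; have [[n tn]|H] := pselect (exists n, t <= i n).
  have ex : exists n, (t <= i n) by exists n.
  case: (ex_minnP ex) => -[|m] tm mmin.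
    rewrite /num_epochs (_ : [set k | _] = set0) ?fset_set0//.
    apply/seteqP; split => // k /= [_ kt].
    by have := lt_le_trans kt (le_trans tm (mono _ _ (leq0n k))); rewrite ltxx.
  have im : i m < t by rewrite ltNge; apply/negP => /mmin; rewrite ltnn.
  by rewrite /= (@num_epochs_window i t m)// im tm.
rewrite /num_epochs /fset_set; case: pselect => //= fin; exfalso.
apply: (infinite_setD infinite_nat (finite_set1 0%N)); apply: sub_finite_set fin => k /= [_ k0].
split; first by rewrite lt0n; apply/eqP.
by rewrite ltNge; apply/negP => tk; apply: H; exists k.
Qed.

End clipped_time.

(** * The decomposition of the running maximum *)

Section independent_sum.
Local Open Scope ereal_scope.
Context {R : realType} d (T : measurableType d) (P : probability T R).

(** Independent copies of B and C are provided by the two coordinates of the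
product of the sample space with itself. *)
Lemma eq_law_indep_sum_integral (X B C : T -> R * R) :
  measurable_fun setT X -> measurable_fun setT B -> measurable_fun setT C ->
  (forall A, measurable A ->
    P (X @^-1` A) = \int[P]_w \int[P]_u (\1_A (B w + C u)%R)%:E) ->
  eq_law_indep_sum P X B C.
Proof.
move=> mX mB mC H.
pose Q : probability (T * T)%type R := (P \x P)%E.
have mB' := measurableT_comp mB (@measurable_fst _ _ T T).
have mC' := measurableT_comp mC (@measurable_snd _ _ T T).
have QX A1 A2 : measurable A1 -> measurable A2 -> Q (A1 `*` A2) = P A1 * P A2.
  by move=> m1 m2; exact: product_measure1E.
have Qfst A : measurable A -> Q ((B \o fst) @^-1` A) = P (B @^-1` A).
  move=> mA; have := QX _ setT (preimage_measurable mB mA) measurableT.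
  rewrite probability_setT mule1 => <-; congr (Q _).
  by apply/seteqP; split => z //= [].
have Qsnd A : measurable A -> Q ((C \o snd) @^-1` A) = P (C @^-1` A).
  move=> mA; have := QX setT _ measurableT (preimage_measurable mC mA).
  rewrite probability_setT mul1e => <-; congr (Q _).
  by apply/seteqP; split => z //= [].
exists _, (T * T)%type, Q, (B \o fst), (C \o snd); split.
- by split.
- by split.
- apply: indep_rv_independent_list => // A1 A2 m1 m2.
  rewrite Qfst// Qsnd// -QX//; exact: preimage_measurable.
have mBC := measurable_pair_add mB' mC'.
split => // A mA; rewrite H//.
have m1 : measurable_fun setT (fun z : T * T => (\1_A (B z.1 + C z.2)%R : R)%:E).
  by apply/measurable_EFinP; apply: (measurableT_comp (measurable_indic mA)).
have := integral_indic Q measurableT (preimage_measurable mBC mA).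
rewrite setIT => <-; apply/esym.
exact: (fubini_tonelli1 (m1 := P) (m2 := P) _ m1).
Qed.

End independent_sum.

Theorem theorem2 (R : realType) (d : measure_display) (Omega : measurableType d)
    (P : probability Omega R) (Y : R -> Omega -> R) (beta omega : R)
    (Tbeta Tsum : Omega -> R) (I : nat -> Omega -> R)
    (beta_gt0 : 0 < beta) (omega_gt0 : 0 < omega)
    (levyY : levy_process P Y)
    (expTbeta : exponential_rv P beta Tbeta)
    (expTsum : exponential_rv P (beta + omega) Tsum)
    (poissonI : poisson_epochs P omega I)
    (indep_Y_I_Tbeta : independent_list P
      [:: sigma_process [set t : R | 0 <= t] Y; sigma_process setT I;
          sigma_rv Tbeta])
    (indep_Y_Tsum : independent_list P
      [:: sigma_process [set t : R | 0 <= t] Y; sigma_rv Tsum]) :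
  eq_law_indep_sum P
    (fun w => (running_max (Y^~ w) (Tbeta w), last_max_epoch (Y^~ w) (Tbeta w)))
    (fun w => (running_max (Y^~ w) (Tsum w), last_max_epoch (Y^~ w) (Tsum w)))
    (fun w => let N := num_epochs (I^~ w) (Tbeta w) in
      (observed_max (Y^~ w) (I^~ w) N,
       last_observed_max_epoch (Y^~ w) (I^~ w) N)).
Proof.
pose Z := path_of levyY; pose e := rseq_of (fun k w => I k.+1 w - I k w).
pose U w := Num.max (Tbeta w) 0; pose S w := Num.max (Tsum w) 0.
have [I0 Iincr Iexp Iindep] := poissonI.
have levyZ : levy_path P Z := levy_path_of levyY.
have mZ : measurable_fun setT Z := levy_path_measurable levyZ.
have mek k : measurable_fun setT (fun w => e w k) := (Iexp k).1.
have me : measurable_fun setT e by exact: measurable_fun_rseq.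
have bo_gt0 : 0 < beta + omega by exact: addr_gt0.
have expU : exponential_rv P beta U by exact: exponential_rv_max0.
have expS : exponential_rv P (beta + omega) S by exact: exponential_rv_max0.
have U0 w : 0 <= U w by exact: max0_ge0.
have S0 w : 0 <= S w by exact: max0_ge0.
have e0 w k : 0 <= e w k by rewrite subr_ge0 ltW.
have mU := expU.1; have mS := expS.1.
have mmax0 : measurable_fun setT (fun t : R => Num.max t 0).
  by apply: measurable_maxr => //; exact: measurable_cst.
have indepSZ : indep_rv P S Z.
  suff i : indep_rv P Z Tsum.
    exact: (indep_rv_comp mmax0 (@measurable_id _ _ setT) (indep_rv_sym i)).
  move=> A B mA mB; apply: (independent_list2 indep_Y_Tsum).
  - exact: sigma_process_path.
  - by exists B; rewrite ?setTI.
  - exact: preimage_measurable.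
  - by apply: preimage_measurable => //; exact: expTsum.1.
have [indep_Ze indep_Ze_T] : indep_rv P Z e /\ indep_rv P (fun w => (Z w, e w)) Tbeta.
  apply: indep_rv_triple => //; first exact: expTbeta.1.
  move=> A B C mA mB mC; apply: (independent_list3 indep_Y_I_Tbeta).
  - exact: sigma_process_path.
  - exact: sigma_process_increments.
  - by exists C; rewrite ?setTI.
  - exact: preimage_measurable.
  - exact: preimage_measurable.
  - by apply: preimage_measurable => //; exact: expTbeta.1.
have indepU : indep_rv P U (fun w => (Z w, e w)).
  exact: (indep_rv_comp mmax0 (@measurable_id _ _ setT) (indep_rv_sym indep_Ze_T)).
have indepUZ : indep_rv P U Z.
  exact: (indep_rv_comp (@measurable_id _ _ setT) measurable_fst indepU).
have indep_e : indep_seq P (fun k w => e w k) := independent_systems_nat_indep_seq Iindep.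
have epochE w : epoch (e w) = I^~ w.
  apply/funext => k; elim: k => [|k ih]; first by rewrite epoch0 I0.
  by rewrite epochS ih max_l// addrC subrK.
have Imono w k j : (k <= j)%N -> I k w <= I j w.
  by move=> /subnK <-; elim: (j - k)%N => // i ih; rewrite addSn (le_trans ih)// ltW.
have Ige0 w k : 0 <= I k w by rewrite -(I0 w) Imono.
pose N w := num_epochs (I^~ w) (Tbeta w).
have NE w : N w = num_epochs (I^~ w) (U w) by rewrite num_epochs_max0.
have N_window n w : in_window e U n w -> N w = n.
  by rewrite /in_window epochE NE; apply: num_epochs_window => k j; exact: Imono.
have window_N w : (0 < N w)%N -> in_window e U (N w) w.
  rewrite /in_window epochE NE; apply: num_epochs_gt0; first exact: I0.
  by move=> k j; exact: Imono.
have mwin n : measurable [set w | in_window e U n w] by exact: (measurable_in_window expU Iexp n).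
have mNS n : measurable [set w | N w = n.+1].
  rewrite (_ : [set w | _] = [set w | in_window e U n.+1 w])//.
  by apply/seteqP; split => w /= h; [by have := window_N w; rewrite h => /(_ isT)|exact: N_window].
have mN n : measurable [set w | N w = n].
  case: n => [|n]; last exact: mNS.
  rewrite (_ : [set w | _] = ~` \bigcup_n [set w | N w = n.+1]).
    by apply: measurableC; exact: bigcupT_measurable.
  apply/seteqP; split => w /=; first by move=> h [n _ /=]; rewrite h.
  by case E : (N w) => [//|n] h; exfalso; apply: h; exists n.
pose C w := inspected_max (N w) (Z w, e w).
have mC : measurable_fun setT C.
  apply: (measurable_fun_nat_index (k := N) (f := fun n w => inspected_max n (Z w, e w))) => // n.
  exact: (measurableT_comp (measurable_inspected_max n) (measurable_fun_pair mZ me)).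
have CE n w : in_window e U n w -> C w = inspected_max n (Z w, e w).
  by move=> /N_window h; rewrite /C h.
have -> : (fun w => let N := num_epochs (I^~ w) (Tbeta w) in
    (observed_max (Y^~ w) (I^~ w) N, last_observed_max_epoch (Y^~ w) (I^~ w) N)) = C.
  by apply/funext => w; rewrite /C -observed_maxE epochE.
have -> : (fun w => (running_max (Y^~ w) (Tbeta w), last_max_epoch (Y^~ w) (Tbeta w))) =
    (fun w => max_pair (U w) (Z w)).
  by apply/funext => w; rewrite -max_pair_max0.
have -> : (fun w => (running_max (Y^~ w) (Tsum w), last_max_epoch (Y^~ w) (Tsum w))) =
    (fun w => max_pair (S w) (Z w)).
  by apply/funext => w; rewrite -max_pair_max0.
have ma : measurable_fun setT (fun w => max_pair (S w) (Z w)) by exact: measurable_max_pair.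
have mb : measurable_fun setT (fun w => gap_pair (S w) (Z w)) by exact: measurable_gap_pair.
have mX : measurable_fun setT (fun w => max_pair (U w) (Z w)) by exact: measurable_max_pair.
apply: eq_law_indep_sum_integral => // A mA.
have bo_neq0 : beta + omega != 0 by rewrite gt_eqF.
apply: (@renewal_unique _ _ _ P _ (fun w => gap_pair (S w) (Z w)) _ _
  (beta / (beta + omega)) (omega / (beta + omega))) => //.
- by rewrite divr_ge0// ltW.
- by rewrite divr_ge0// ltW.
- by rewrite ltr_pdivrMr// mul1r ltrDr.
- move=> f mf f0.
  exact: (max_pair_renewal beta_gt0 omega_gt0 levyZ expU (Iexp 0%N)
    expS U0 (e0^~ 0%N) S0 indepUZ indepSZ).
- move=> f mf f0.
  exact: (inspected_renewal beta_gt0 omega_gt0 levyZ expU expS Iexp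
    indep_e e0 S0 indepSZ (indep_rv_sym indep_Ze) indepU mC CE mf f0).
Qed.
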